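(* Let $n\ge1$, $\sigma=1$, $s\ge0$ and $1\le p\le q\le\infty$. Assume $(|D|^2u_0,u_1,\theta_0)\in L^p(\mathbb{R}^n)\times L^p(\mathbb{R}^n)\times L^p(\mathbb{R}^n)$. Then the solution to the Cauchy problem (P) satisfies, for all $t>0$, $$\left\||D|^2u(t,\cdot)\right\|_{\dot H^s_q(\mathbb{R}^n)}+\|u_t(t,\cdot)\|_{\dot H^s_q(\mathbb{R}^n)}+\|\theta(t,\cdot)\|_{\dot H^s_q(\mathbb{R}^n)}\lesssim t^{-\mu(1,n,p,q,s)}\left\|\left(|D|^2u_0,u_1,\theta_0\right)\right\|_{\left(L^p(\mathbb{R}^n)\right)^3},$$ where $\mu(1,n,p,q,s)=\frac s2+\frac n2\left(\frac1p-\frac1q\right)$.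
   Context: Cauchy problem (P) (here $\sigma=1$): for unknown functions $u=u(t,x)$, $\theta=\theta(t,x)$, $$u_{tt}+\Delta^2u+\Delta\theta-\Delta u_t=0,\qquad \theta_t-\Delta\theta-\Delta u_t=0,\qquad t>0,\ x\in\mathbb{R}^n,$$ with $(u,u_t,\theta)(0,x)=(u_0,u_1,\theta_0)(x)$. $|D|^s$ is the pseudo-differential operator with symbol $|\xi|^s$; $\|f\|_{\dot H^s_q}=\||D|^sf\|_{L^q}$ (also for $q=\infty$). The partial Fourier transform $w^{(0)}(t,\xi)$ in $x$ of $(u_t+|D|^2u,u_t-|D|^2u,\theta)^{\mathrm T}$ solves $w^{(0)}_t+|\xi|^2(A_0+A_1)w^{(0)}=0$ with initial value the Fourier transform of $(u_1+|D|^2u_0,u_1-|D|^2u_0,\theta_0)^{\mathrm T}$, where $$A_0=\tfrac12\begin{pmatrix}0&-2&-2\\2&0&-2\\1&1&2\end{pmatrix},\qquad A_1=\tfrac12\begin{pmatrix}1&1&0\\1&1&0\\0&0&0\end{pmatrix}.$$ $f\lesssim g$ means $f\le Cg$ with a constant $C>0$ independent of $t$ and of the initial data. *)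

(* Defs.v *)
From HB Require Import structures.
From mathcomp Require Import all_boot all_order all_algebra.
From mathcomp Require Import all_classical all_reals all_analysis.
From mathcomp.real_closed Require Import complex.

Set Implicit Arguments.
Unset Strict Implicit.
Unset Printing Implicit Defensive.

Import Order.TTheory GRing.Theory Num.Theory.
Import numFieldNormedType.Exports.

Local Open Scope classical_set_scope.
Local Open Scope ring_scope.

(* R^n is the type of row vectors, which carries the topology and directional
   derivatives of the library; its Borel sigma-algebra is the one generated by
   the coordinates, as the library does for tuples. *)

Section measurable_rV.
Context {R : realType} (n : nat).

Let coors : 'I_n -> 'rV[R]_n -> R := fun i x => x ord0 i.

Let rV_set0 : g_sigma_preimage coors set0.
Proof. exact: sigma_algebra0. Qed.

Let rV_setC A : g_sigma_preimage coors A -> g_sigma_preimage coors (~` A).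
Proof. exact: sigma_algebraC. Qed.

Let rV_bigcup (F : _^nat) : (forall i, g_sigma_preimage coors (F i)) ->
  g_sigma_preimage coors (\bigcup_i (F i)).
Proof. exact: sigma_algebra_bigcup. Qed.

Definition rV_display : measure_display :=
  measure_tuple_display default_measure_display.

HB.instance Definition _ := @isMeasurable.Build rV_display
  'rV[R]_n (g_sigma_preimage coors) rV_set0 rV_setC rV_bigcup.

Lemma measurable_coor (i : 'I_n) :
  measurable_fun [set: 'rV[R]_n] (fun x : 'rV[R]_n => x ord0 i).
Proof.
move=> _ Y mY; rewrite setTI; apply: sub_sigma_algebra => /=.
rewrite -bigcup_seq/=; exists i => /=; first by rewrite mem_index_enum.
by exists Y => //; rewrite setTI.
Qed.

Lemma measurable_fun_rV d (T : measurableType d) (f : T -> 'rV[R]_n) :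
  (forall i, measurable_fun [set: T] (fun t => f t ord0 i)) ->
  measurable_fun [set: T] f.
Proof.
move=> mf; have gf : g_sigma_preimage (fun i t => f t ord0 i) `<=` measurable.
  apply: smallest_sub; first exact: sigma_algebra_measurable.
  rewrite -bigcup_seq; apply: bigcup_sub => i _ A [B mB <-].
  exact: mf.
move=> _ A mA; apply: gf.
have -> := @g_sigma_preimage_comp _ R n 'rV[R]_n coors T f.
by exists A.
Qed.

End measurable_rV.

Section lebesgue_rV.
Context {R : realType}.

Definition rV_cons n (z : R * 'rV[R]_n) : 'rV[R]_(1 + n) :=
  row_mx (\row_(_ < 1) z.1) z.2.

Lemma measurable_rV_cons n : measurable_fun setT (@rV_cons n).
Proof.
apply: measurable_fun_rV => i; rewrite /rV_cons.
case: (split_ordP i) => j ->.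
  rewrite (_ : (fun _ => _) = fst)//.
  by apply/funext => z /=; rewrite row_mxEl mxE.
rewrite (_ : (fun _ => _) = (fun x : 'rV[R]_n => x ord0 j) \o snd); last first.
  by apply/funext => z /=; rewrite row_mxEr.
by apply: measurableT_comp; [exact: measurable_coor|exact: measurable_snd].
Qed.

Definition lebesgue_rV_step n (m : {sigma_finite_measure set 'rV[R]_n -> \bar R})
    : set 'rV[R]_n.+1 -> \bar R :=
  pushforward (@lebesgue_measure R \x m)%E (@rV_cons n).

Section step.
Context n (m : {sigma_finite_measure set 'rV[R]_n -> \bar R}).

Let step0 : lebesgue_rV_step m set0 = 0%E.
Proof. by rewrite /lebesgue_rV_step /pushforward preimage_set0 measure0. Qed.

Let step_ge0 A : (0 <= lebesgue_rV_step m A)%E.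
Proof. by rewrite /lebesgue_rV_step /pushforward; exact: measure_ge0. Qed.

Let step_sigma_additive : semi_sigma_additive (lebesgue_rV_step m).
Proof.
move=> F mF tF mUF; rewrite /lebesgue_rV_step /pushforward preimage_bigcup.
apply: measure_semi_sigma_additive.
- by move=> k; rewrite -[X in measurable X]setTI; exact: measurable_rV_cons.
- apply/trivIsetP => /= i j _ _ ij; rewrite -preimage_setI.
  by move/trivIsetP : tF => /(_ _ _ _ _ ij) ->//; rewrite preimage_set0.
- by rewrite -preimage_bigcup -[X in measurable X]setTI;
    exact: measurable_rV_cons.
Qed.

HB.instance Definition _ := isMeasure.Build _ _ _ (lebesgue_rV_step m)
  step0 step_ge0 step_sigma_additive.

Let step_sigma_finite : sigma_finite setT (lebesgue_rV_step m).
Proof.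
have /sigma_finiteP[F [TF ndF Foo]] := sigma_finiteT (@lebesgue_measure R).
have /sigma_finiteP[G [TG ndG Goo]] := sigma_finiteT m.
pose g (x : 'rV[R]_n.+1) : R * 'rV[R]_n :=
  (x ord0 ord0, @rsubmx _ 1 1 n x).
have mg : measurable_fun setT g.
  apply/measurable_fun_pairP; split; first exact: measurable_coor.
  apply: measurable_fun_rV => i.
  under eq_fun do rewrite /= mxE.
  exact: measurable_coor.
have gK z : g (@rV_cons n z) = z.
  case: z => a b; rewrite /g /rV_cons/=; congr (_, _).
    rewrite (_ : ord0 = lshift n ord0 :> 'I_(1 + n)); last exact: val_inj.
    by rewrite (row_mxEl (\row_(_ < 1) a)) mxE.
  by rewrite row_mxKr.
exists (fun i => g @^-1` (F i `*` G i)) => [|i].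
  rewrite -preimage_bigcup (_ : \bigcup_i _ = setT) ?preimage_setT//.
  rewrite -setXTT TF TG predeqE => -[x y]; split.
    by move=> [k _ []/= ? ?]; split; exists k.
  move=> [/= [k _ Fkx] [l _ Gly]]; exists (maxn k l) => //; split.
  - by move: x Fkx; exact/subsetPset/ndF/leq_maxl.
  - by move: y Gly; exact/subsetPset/ndG/leq_maxr.
have [mF Foo'] := Foo i; have [mG Goo'] := Goo i; split.
  by rewrite -[X in measurable X]setTI; apply: mg => //; exact: measurableX.
rewrite /lebesgue_rV_step /pushforward -comp_preimage.
rewrite (_ : g \o _ = id); last by rewrite funeqE => z /=; rewrite gK.
by rewrite preimage_id product_measure1E// lte_mul_pinfty// ge0_fin_numE.
Qed.

HB.instance Definition _ := Measure_isSigmaFinite.Build _ _ _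
  (lebesgue_rV_step m) step_sigma_finite.

End step.

(* Lebesgue measure on R^n as the iterated product of the one on R. *)
Fixpoint lebesgue_rV n : {sigma_finite_measure set 'rV[R]_n -> \bar R} :=
  if n is n'.+1 then lebesgue_rV_step (lebesgue_rV n')
  else dirac (0 : 'rV[R]_0).

End lebesgue_rV.
Arguments lebesgue_rV {R} n.

Lemma lebesgue_rV_box {R : realType} n (A : 'I_n -> set R) :
  (forall i, measurable (A i)) ->
  lebesgue_rV n [set x | forall i, A i (x ord0 i)] =
  (\prod_(i < n) lebesgue_measure (A i))%E.
Proof.
elim: n A => [|n IHn] A mA.
  by rewrite big_ord0 /= diracE mem_set// => -[].
rewrite big_ord_recl -IHn => [|i]; last exact: mA.
have mB : measurable [set x : 'rV[R]_n | forall i, A (lift ord0 i) (x ord0 i)].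
  rewrite (_ : [set _ | _] =
    \bigcap_(i in [set: 'I_n]) (fun x : 'rV[R]_n => x ord0 i) @^-1` A (lift ord0 i)).
    apply: fin_bigcap_measurable => // i _.
    by rewrite -[X in measurable X]setTI; exact: measurable_coor.
  by apply/seteqP; split => x /= Ax i => [_|]; exact: Ax.
have := product_measure1E (@lebesgue_measure R) (lebesgue_rV n) (mA ord0) mB.
move=> /= <-; rewrite /lebesgue_rV_step /pushforward.
congr (product_measure1 _ _ _).
apply/seteqP; split => -[a x] /=.
  move=> Ax; split; last move=> i.
    have := Ax (lshift n (ord0 : 'I_1)); rewrite /rV_cons (row_mxEl (\row_(_ < 1) a)) mxE.
    by rewrite (_ : lshift n (ord0 : 'I_1) = ord0)//; exact: val_inj.
  have := Ax (rshift 1 i : 'I_(1 + n)); rewrite /rV_cons (row_mxEr (\row_(_ < 1) a)).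
  by rewrite (_ : rshift 1 i = lift ord0 i)//; exact: val_inj.
move=> [Aa Ax] i; case: (split_ordP (i : 'I_(1 + n))) => j ->.
  rewrite /rV_cons (row_mxEl (\row_(_ < 1) a)) mxE ord1.
  by rewrite (_ : lshift n (ord0 : 'I_1) = ord0)//; exact: val_inj.
rewrite /rV_cons (row_mxEr (\row_(_ < 1) a)).
by rewrite (_ : rshift 1 j = lift ord0 j)//; exact: val_inj.
Qed.

Section fourier.
Context {R : realType} (n : nat).
Implicit Types (x xi : 'rV[R]_n) (F : 'rV[R]_n -> R[i]).

Definition dotp x xi : R := \sum_i x ord0 i * xi ord0 i.

(* The norm of the library on row vectors is the sup norm; the symbols below
   need the Euclidean one. *)
Definition enorm x : R := Num.sqrt (dotp x x).

Definition expi (a : R) : R[i] := (cos a +i* sin a)%C.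

Definition cintegral F : R[i] :=
  (\int[lebesgue_rV n]_x complex.Re (F x) +i*
   \int[lebesgue_rV n]_x complex.Im (F x))%C.

Definition fourier F xi : R[i] :=
  cintegral (fun x => expi (- dotp x xi) * F x).

Definition inv_fourier F x : R[i] :=
  (((2 * pi) ^- n)%:C)%C * cintegral (fun xi => expi (dotp x xi) * F xi).

(* |D|^s on real Schwartz functions. The symbol |xi|^s is real and even, so the
   inverse transform is real-valued and taking its real part loses nothing. *)
Definition absD (s : R) (phi : 'rV[R]_n -> R) x : R :=
  complex.Re (inv_fourier
    (fun xi => ((enorm xi `^ s)%:C)%C * fourier (fun y => ((phi y)%:C)%C) xi) x).

End fourier.

Section distributions.
Context {R : realType} (n : nat).
Local Notation rn := 'rV[R]_n.
Implicit Types (phi : rn -> R) (T : (rn -> R) -> R).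

Definition pderiv (i : 'I_n) phi : rn -> R :=
  fun x => 'D_(delta_mx ord0 i) phi x.

Definition pderivs (l : seq 'I_n) phi : rn -> R := foldr pderiv phi l.

Definition schwartz phi : Prop := forall l : seq 'I_n,
  (forall x, differentiable (pderivs l phi) x) /\
  (forall k : nat, exists M : R,
     forall x, (1 + enorm x) ^+ k * `|pderivs l phi x| <= M).

Definition laplacian phi : rn -> R :=
  fun x => \sum_i pderiv i (pderiv i phi) x.

(* Real tempered distributions are functionals of which only the values on
   Schwartz functions matter: linear there, and bounded by a Schwartz
   seminorm. *)
Definition tempered T : Prop :=
  (forall (a : R) phi psi, schwartz phi -> schwartz psi ->
     T (fun x => a * phi x + psi x) = a * T phi + T psi) /\
  (exists (N k : nat) (C : R), forall phi, schwartz phi ->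
     forall M : R,
       (forall l : seq 'I_n, (size l <= N)%N ->
          forall x, (1 + enorm x) ^+ k * `|pderivs l phi x| <= M) ->
       `|T phi| <= C * M).

Definition dist_of (f : rn -> R) : (rn -> R) -> R :=
  fun phi => \int[lebesgue_rV n]_x (f x * phi x).

Definition is_dist_of (f : rn -> R) T : Prop := forall phi, schwartz phi ->
  (lebesgue_rV n).-integrable setT (EFin \o (fun x => f x * phi x)) /\
  T phi = dist_of f phi.

(* -Delta = |D|^2 acts on every tempered distribution, because its symbol
   |xi|^2 is smooth. *)
Definition absD2 T : (rn -> R) -> R := fun phi => T (absD 2 phi).

(* g = |D|^s f, by duality. For s not an even integer |D|^s phi is in general
   not a Schwartz function: it only decays like |x|^(-n-s), so f has to be a
   function for which the pairing with |D|^s phi converges, and not an arbitrary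
   tempered distribution; all f in all L^p qualify. *)
Definition is_absD (s : R) (f g : rn -> R) : Prop := forall phi, schwartz phi ->
  [/\ (lebesgue_rV n).-integrable setT (EFin \o (fun x => f x * absD s phi x)),
      (lebesgue_rV n).-integrable setT (EFin \o (fun x => g x * phi x)) &
      \int[lebesgue_rV n]_x (g x * phi x) =
      \int[lebesgue_rV n]_x (f x * absD s phi x)].

(* || T ||_{dot H^s_q} = || |D|^s T ||_{L^q}. The function |D|^s T is unique
   almost everywhere, so that the infimum is over a single value when |D|^s T is
   a function, and is +oo otherwise. *)
Definition Hdot_norm (s : R) (q : \bar R) T : \bar R :=
  ereal_inf [set ('N[lebesgue_rV n]_q[EFin \o g])%E |
    g in [set g : rn -> R | measurable_fun setT g /\
                            exists2 f, is_dist_of f T & is_absD s f g]].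

End distributions.

Section thermoelastic_plate.
Context {R : realType} (n : nat).
Local Notation rn := 'rV[R]_n.
Local Notation dist := ((rn -> R) -> R).

Definition dt (u : R -> dist) (t : R) : dist := fun phi => derive1 (u ^~ phi) t.

(* (u, theta) solves
     u_tt + Delta^2 u + Delta theta - Delta u_t = 0,
     theta_t - Delta theta - Delta u_t = 0           for t > 0,
   as functions of t with values in the tempered distributions on R^n; limits
   and derivatives in t are taken in the weak-* topology. *)
Record plate_solution (u0 u1 theta0 : dist) (u theta : R -> dist) : Prop := {
  plate_tempered : forall t, 0 < t ->
    [/\ tempered (u t), tempered (dt u t) & tempered (theta t)];
  plate_derivable : forall t phi, 0 < t -> schwartz phi ->
    [/\ derivable (u ^~ phi) t 1, derivable (dt u ^~ phi) t 1 &
        derivable (theta ^~ phi) t 1];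
  plate_eq1 : forall t phi, 0 < t -> schwartz phi ->
    dt (dt u) t phi + u t (laplacian (laplacian phi))
      + theta t (laplacian phi) - dt u t (laplacian phi) = 0;
  plate_eq2 : forall t phi, 0 < t -> schwartz phi ->
    dt theta t phi - theta t (laplacian phi) - dt u t (laplacian phi) = 0;
  plate_init : forall phi, schwartz phi ->
    [/\ u t phi @[t --> 0^'+] --> u0 phi,
        dt u t phi @[t --> 0^'+] --> u1 phi &
        theta t phi @[t --> 0^'+] --> theta0 phi]
}.

End thermoelastic_plate.

Definition mu1 {R : realType} (n : nat) (p q : \bar R) (s : R) : R :=
  s / 2 + n%:R / 2 * (fine (p^-1)%E - fine (q^-1)%E).

(* Main.v *)
(** The vector (|D|^2 u, u_t, theta) solves W_t = A Delta W, where A is similar to A_0 + A_1 and has one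
    real positive eigenvalue and a pair al +- i be with al > 0. Pairing W with left eigenvectors
    decouples the system into equations w_t = z Delta w with Re z > 0. A duality argument shows that a
    solution in the tempered distributions is the convolution of its initial value with the complex
    Gaussian of parameter z t: the pairing of w(T - s^2) with the Gaussian of scale s convolved with a
    test function does not depend on s in [0, sqrt T). Since w is only weakly differentiable in time,
    this needs the Banach-Steinhaus theorem on Schwartz functions. Hence W(t) is a
    convolution with Schwartz kernels dilated by sqrt t, and |D|^s W(t) one with |D|^s of these kernels.
    For a Schwartz function K, |D|^s K is bounded, and it is integrable because it is a superposition
    of heat flows; homogeneity of |D|^s and Young's inequality give the power of t. *)

Require Import Defs.
From HB Require Import structures.
From mathcomp Require Import all_boot all_order all_algebra.
From mathcomp Require Import all_classical all_reals all_analysis.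
From mathcomp Require Import measurable_realfun gauss_integral ring lra.
From mathcomp.real_closed Require Import complex.

Set Implicit Arguments.
Unset Strict Implicit.
Unset Printing Implicit Defensive.

Import Order.TTheory GRing.Theory Num.Theory.
Import numFieldNormedType.Exports.

Local Open Scope classical_set_scope.
Local Open Scope ring_scope.

(** * Lebesgue measure on R^n *)

(** All complex objects are kept as pairs of real ones, Fourier transforms included. The Gaussian
    flow is parametrized by a scale [s], with variance proportional to [s^2]: averaging at scale [s]
    depends smoothly on [s] through [s = 0], where a kernel of integral 1 gives back the test
    function, so the duality argument can start at its endpoint. The dual pairing depends on [s]
    both through the time and through the test function. Its increments are bounded by
    [C (b - a)^2], and such a function is constant; for this reason Taylor remainders are estimated
    quadratically and in all Schwartz seminorms. The integral of a complex Gaussian is never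
    evaluated, only shown to be nonzero, which is enough to normalize it. Since [|D|^s] of a
    Schwartz function need not be Schwartz, pairings with it are handled by Fubini for functions
    that are bounded and integrable. These two properties of [|D|^s K] are also all that enters the
    estimates: every pair [p <= q] is reached by interpolating between the L^1 bound and the
    supremum bound of the kernel. *)

Section rV_measurability.
Context {R : realType}.

Lemma rV_normP n (x : 'rV[R]_n) (e : R) : 0 <= e ->
  (`|x| <= e) <-> (forall i, `|x ord0 i| <= e).
Proof.
move=> e0; rewrite /Num.norm/= mx_normrE; split.
  by move=> /bigmax_leP/=[_ H] i; exact: (H (ord0, i) isT).
by move=> H; apply/bigmax_leP; split => // -[i j] _ /=; rewrite ord1; exact: H.
Qed.

Lemma rV_coord_le n (x : 'rV[R]_n) i : `|x ord0 i| <= `|x|.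
Proof. by have [+ _] := @rV_normP n x `|x| (normr_ge0 _); exact. Qed.

(** The sigma-algebra is generated by coordinates, not by open sets. An open set is the countable
    union of the boxes with rational centre and radius [1 / (m + 1)] that it contains, and boxes are
    finite intersections of coordinate conditions. *)
Lemma open_measurable_rV n (U : set 'rV[R]_n) : open U -> measurable U.
Proof.
move=> oU.
pose box (qm : 'rV[rat]_n * nat) : set 'rV[R]_n :=
  [set x | forall i, `|ratr (qm.1 ord0 i) - x ord0 i| < qm.2.+1%:R^-1].
have mbox qm : measurable (box qm).
  rewrite (_ : box qm = \bigcap_(i in [set: 'I_n])
      ((fun x : 'rV[R]_n => `|ratr (qm.1 ord0 i) - x ord0 i|) @^-1`
         `]-oo, qm.2.+1%:R^-1[)); last first.
    apply/seteqP; split => x /=.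
      by move=> xb i _ /=; rewrite in_itv/=; exact: xb.
    by move=> xb i; have := xb i I; rewrite /= in_itv.
  apply: fin_bigcap_measurable => // i _; rewrite -[X in measurable X]setTI.
  have mf : measurable_fun setT (fun x : 'rV[R]_n => `|ratr (qm.1 ord0 i) - x ord0 i|).
    apply: measurableT_comp => //; apply: measurable_funB => //.
    exact: measurable_coor.
  by apply: mf => //; exact: measurable_itv.
rewrite (_ : U = \bigcup_qm (if `[< box qm `<=` U >] then box qm else set0)).
  apply: countable_bigcupT_measurable => // qm.
  by case: ifPn.
apply/seteqP; split => x; last first.
  by move=> [qm _]; case: ifPn => // /asboolP; exact.
move=> Ux; have /nbhs_ballP[e/= e0 eU] := open_nbhs_nbhs (conj oU Ux).
(* The box is centred at the rational point [q], so its points may be at twice its radius from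
   [x]. *)
have [m me] : exists m : nat, m.+1%:R^-1 < e / 2.
  have [m _ /(_ m (leqnn m)) ?] := near_infty_natSinv_lt (PosNum (divr_gt0 e0 (ltr0Sn R 1))).
  by exists m.
have qP i : exists q : rat, `|ratr q - x ord0 i| < m.+1%:R^-1 :> R.
  have m0 : 0 < m.+1%:R^-1 :> R by rewrite invr_gt0.
  have /= := @rat_in_itvoo R (x ord0 i) (x ord0 i + m.+1%:R^-1).
  rewrite ltrDl => /(_ m0)[q]; rewrite in_itv/= => /andP[q1 q2].
  by exists q; rewrite gtr0_norm ?subr_gt0// ltrBlDl.
pose q : 'rV[rat]_n := \row_i projT1 (cid (qP i)).
have xq : box (q, m) x by move=> i /=; rewrite mxE; case: cid.
exists (q, m) => //; rewrite ifT//; apply/asboolP => y /= yq; apply: eU.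
rewrite -ball_normE /ball_/=; apply: (@le_lt_trans _ _ (m.+1%:R^-1 + m.+1%:R^-1)).
  apply/rV_normP => [|i]; first by rewrite addr_ge0// invr_ge0.
  rewrite !mxE -[x ord0 i](subrK (ratr (q ord0 i))) -addrA.
  rewrite (le_trans (ler_normD _ _))// lerD//; last exact/ltW/yq.
  by rewrite distrC; exact/ltW/xq.
by rewrite [e]splitr ltrD.
Qed.

Lemma continuous_measurable_rV n (f : 'rV[R]_n -> R) :
  continuous f -> measurable_fun setT f.
Proof.
move=> /continuousP cf; apply: (measurability _ (@RGenOInfty.measurableE R)).
move=> _ [_ [a ->] <-]; rewrite setTI; apply: open_measurable_rV.
by apply: cf; exact: interval_open.
Qed.

Lemma measurable_funD_rV d (T : measurableType d) n (f g : T -> 'rV[R]_n) :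
  measurable_fun setT f -> measurable_fun setT g ->
  measurable_fun setT (fun x => f x + g x).
Proof.
move=> mf mg; apply: measurable_fun_rV => i; under eq_fun do rewrite mxE.
by apply: measurable_funD; exact: measurableT_comp (measurable_coor i) _.
Qed.

Lemma measurable_funZ_rV d (T : measurableType d) n (f : T -> 'rV[R]_n) (a : T -> R) :
  measurable_fun setT a -> measurable_fun setT f ->
  measurable_fun setT (fun x => a x *: f x).
Proof.
move=> ma mf; apply: measurable_fun_rV => i; under eq_fun do rewrite mxE.
by apply: measurable_funM => //; exact: measurableT_comp (measurable_coor i) _.
Qed.

Lemma measurable_funB_rV d (T : measurableType d) n (f g : T -> 'rV[R]_n) :
  measurable_fun setT f -> measurable_fun setT g ->
  measurable_fun setT (fun x => f x - g x).
Proof.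
move=> mf mg; apply: measurable_fun_rV => i; under eq_fun do rewrite !mxE.
by apply: measurable_funB; exact: measurableT_comp (measurable_coor i) _.
Qed.

End rV_measurability.

(** * Affine changes of variables *)

Section change_of_variables.
Context {R : realType}.
Local Open Scope ereal_scope.

(** Both sides are measures in [A], so it suffices to compare them on intervals []c, d]]. For
    [a < 0] the preimage is closed at the other end, which does not change its length. *)
Lemma lebesgue_measure_affine (a v : R) (A : set R) : (a != 0)%R -> measurable A ->
  lebesgue_measure A =
  `|a|%:E * lebesgue_measure ((fun x : R => (a * x + v)%R) @^-1` A).
Proof.
move=> a0 mA.
have mg : measurable_fun setT (fun x : measurableTypeR R => (a * x + v)%R : measurableTypeR R).
  by apply: measurable_funD => //; apply: measurable_funM.
pose g (x : measurableTypeR R) : measurableTypeR R := (a * x + v)%R.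
pose m : {measure set _ -> \bar R} := mscale (NngNum (normr_ge0 a)) (pushforward lebesgue_measure g).
apply: (@lebesgue_measure_unique R (m mg)) => // _ [[c d]] _ <-.
rewrite /= /pushforward /=.
change (mscale _ _ _) with (`|a|%:E * lebesgue_measure (g @^-1` `]c, d])).
have [ap|an|] := ltgtP a 0%R; last by move/eqP; rewrite (negPf a0).
- have -> : g @^-1` `]c, d] = `[((d - v) / a)%R, ((c - v) / a)%R[%classic.
    apply/seteqP; split => x /=; rewrite !in_itv/=.
      by move=> /andP[h1 h2]; rewrite ler_ndivrMr// ltr_ndivlMr// lerBrDr ltrBlDr ![(x * a)%R]mulrC h1 h2.
    by rewrite ler_ndivrMr// ltr_ndivlMr// lerBrDr ltrBlDr ![(x * a)%R]mulrC => /andP[-> ->].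
  rewrite !lebesgue_measure_itv/= !lte_fin ltr_ndivrMr// divfK// ltrD2r.
  case: ifPn => // cd; rewrite ?mule0//.
  by rewrite ltr0_norm// -EFinM -EFinD; congr EFin; field.
- have -> : g @^-1` `]c, d] = `]((c - v) / a)%R, ((d - v) / a)%R]%classic.
    apply/seteqP; split => x /=; rewrite !in_itv/=.
      by move=> /andP[h1 h2]; rewrite ler_pdivlMr// ltr_pdivrMr// lerBrDr ltrBlDr ![(x * a)%R]mulrC h1 h2.
    by rewrite ler_pdivlMr// ltr_pdivrMr// lerBrDr ltrBlDr ![(x * a)%R]mulrC => /andP[-> ->].
  rewrite !lebesgue_measure_itv/= !lte_fin ltr_pdivrMr// divfK// ltrD2r.
  case: ifPn => // cd; rewrite ?mule0//.
  by rewrite gtr0_norm// -EFinM -EFinD; congr EFin; field.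
Qed.

Lemma ge0_integral_affine (a v : R) (f : R -> \bar R) : (a != 0)%R ->
  measurable_fun setT f -> (forall x, 0 <= f x) ->
  \int[lebesgue_measure]_x f x = `|a|%:E * \int[lebesgue_measure]_x f (a * x + v)%R.
Proof.
move=> a0 mf f0.
have mg : measurable_fun setT (fun x : measurableTypeR R => (a * x + v)%R : measurableTypeR R).
  by apply: measurable_funD => //; apply: measurable_funM.
have := @ge0_integral_pushforward _ _ _ _ R _ mg lebesgue_measure setT f measurableT mf (fun y _ => f0 y).
rewrite preimage_setT /= => <-.
pose g (x : measurableTypeR R) : measurableTypeR R := (a * x + v)%R.
pose m : {measure set _ -> \bar R} := pushforward lebesgue_measure g.
have := @ge0_integral_mscale _ _ R (m mg) setT measurableT (NngNum (normr_ge0 a)) f mf (fun x _ => f0 x).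
move=> /= <-; apply: eq_measure_integral => A mA _ /=.
by rewrite /mscale/= /pushforward (lebesgue_measure_affine v a0).
Qed.

Lemma ge0_integral_rVS n (f : 'rV[R]_n.+1 -> \bar R) :
  measurable_fun setT f -> (forall x, 0 <= f x) ->
  \int[lebesgue_rV n.+1]_x f x =
  \int[lebesgue_measure]_a \int[lebesgue_rV n]_y f (rV_cons (a, y)).
Proof.
move=> mf f0.
transitivity (\int[pushforward (@lebesgue_measure R \x lebesgue_rV n) (@rV_cons R n)]_x f x).
  by [].
rewrite ge0_integral_pushforward//; last exact: measurable_rV_cons.
rewrite preimage_setT fubini_tonelli1//; last by move=> x; exact: f0.
exact: measurableT_comp mf (@measurable_rV_cons R n).
Qed.

Lemma rV_cons_affine n (c : R) (x : R) (y : 'rV[R]_n) (v : 'rV[R]_n.+1) :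
  (c *: rV_cons (x, y) + v = rV_cons ((c * x + v ord0 ord0)%R, c *: y + \row_i v ord0 (lift ord0 i)))%R.
Proof.
apply/rowP => i; rewrite /rV_cons !mxE; case: (split_ordP (i : 'I_(1 + n))) => j ->;
  rewrite ?split_lshift ?split_rshift.
  rewrite !mxE/= ord1; congr (_ + v _ _)%R.
  exact: val_inj.
by rewrite /= !mxE; congr (_ + v _ _)%R; exact: val_inj.
Qed.

(** Induction on the dimension: Tonelli splits off the first coordinate, where the one-dimensional
    formula contributes one factor [|c|]. *)
Lemma ge0_integral_rV_affine n (c : R) (v : 'rV[R]_n) (f : 'rV[R]_n -> \bar R) : (c != 0)%R ->
  measurable_fun setT f -> (forall x, 0 <= f x) ->
  \int[lebesgue_rV n]_x f x = (`|c| ^+ n)%:E * \int[lebesgue_rV n]_x f (c *: x + v)%R.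
Proof.
move=> c0; elim: n v f => [|n IH] v f mf f0.
  rewrite expr0 mul1e; apply: eq_integral => x _; congr f.
  by apply/rowP => -[].
have mc (m : nat) (w : 'rV[R]_m) : measurable_fun setT (fun x : 'rV[R]_m => c *: x + w)%R.
  by apply: measurable_funD_rV => //; exact: measurable_funZ_rV.
rewrite ge0_integral_rVS//.
have mfc : measurable_fun setT (f \o @rV_cons R n) by exact: measurableT_comp (@measurable_rV_cons R n).
have mF := @measurable_fun_fubini_tonelli_F _ _ _ _ R (lebesgue_rV n) (f \o @rV_cons R n) mfc (fun x => f0 _).
rewrite (@ge0_integral_affine c (v ord0 ord0)) //; last by move=> x; exact: integral_ge0.
rewrite [X in _ = _ * X]ge0_integral_rVS//; last first.
  by apply: measurableT_comp mf _; exact: mc.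
rewrite exprS EFinM -muleA; congr (_ * _).
rewrite -ge0_integralZl_EFin//; last 2 first.
- by move=> x _; exact: integral_ge0.
- have := @measurable_fun_fubini_tonelli_F _ _ _ _ R (lebesgue_rV n) (fun z => f (c *: (rV_cons z) + v)%R).
  apply; last by move=> x; exact: f0.
  exact: measurableT_comp mf (measurableT_comp (mc _ v) (@measurable_rV_cons R n)).
apply: eq_integral => x _.
rewrite (IH (\row_i v ord0 (lift ord0 i))%R); first last.
- by move=> y; exact: f0.
- apply: measurableT_comp mf (measurableT_comp (@measurable_rV_cons R n) _).
  exact: measurable_fun_pair.
by congr (_ * _); apply: eq_integral => y _; rewrite -rV_cons_affine.
Qed.

End change_of_variables.

(** * Real-valued integrals and Fubini's theorem *)

Section real_integrals.
Context {R : realType} d {T : measurableType d} (mu : {measure set T -> \bar R}).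
Implicit Types f g : T -> R.

Definition intg f : Prop := mu.-integrable setT (EFin \o f).

Lemma intg_measurable f : intg f -> measurable_fun setT f.
Proof. by move=> /integrableP[/measurable_EFinP]. Qed.

Lemma intg_le f g : measurable_fun setT f -> intg g ->
  (forall x, `|f x| <= g x) -> intg f.
Proof.
move=> mf ig fg; apply: le_integrable ig => //; first exact/measurable_EFinP.
by move=> x _ /=; rewrite lee_fin (le_trans (fg x))// ler_norm.
Qed.

Lemma intg_norm f : intg f -> intg (fun x => `|f x|).
Proof.
by move=> fi; apply: (@integrable_norm _ _ _ mu setT f).
Qed.

Lemma intg_eq f g : f =1 g -> intg f -> intg g.
Proof. by move=> fg; rewrite /intg (funext fg). Qed.

Lemma intgZl (c : R) f : intg f -> intg (fun x => c * f x).
Proof.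
move=> fi; have := @integrableZl _ _ _ mu setT measurableT c _ fi.
by apply: eq_integrable => // x _ /=; rewrite EFinM.
Qed.

Lemma intgZr (c : R) f : intg f -> intg (fun x => f x * c).
Proof. by move=> fi; apply: intg_eq (intgZl c fi) => x; rewrite mulrC. Qed.

Lemma intgD f g : intg f -> intg g -> intg (fun x => f x + g x).
Proof.
move=> fi gi; have := @integrableD _ _ _ mu setT measurableT _ _ fi gi.
by apply: eq_integrable => // x _ /=; rewrite EFinD.
Qed.

Lemma intgN f : intg f -> intg (fun x => - f x).
Proof.
move=> fi; apply: intg_eq (intgZl (-1) fi) => x; by rewrite mulN1r.
Qed.

Lemma intgB f g : intg f -> intg g -> intg (fun x => f x - g x).
Proof. by move=> fi gi; apply: intgD => //; exact: intgN. Qed.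

Lemma intg0 : intg (fun _ => 0).
Proof. exact: integrable0. Qed.

Lemma intg_sum (I : Type) (r : seq I) (P : pred I) (F : I -> T -> R) :
  (forall i, P i -> intg (F i)) -> intg (fun x => \sum_(i <- r | P i) F i x).
Proof.
move=> Fi; elim: r => [|i r IH].
  by apply: intg_eq intg0 => x; rewrite big_nil.
have [Pi|nPi] := boolP (P i).
  apply: intg_eq (intgD (Fi i Pi) IH) => x; by rewrite big_cons Pi.
by apply: intg_eq IH => x; rewrite big_cons (negPf nPi).
Qed.

Lemma Rint_sum (I : Type) (r : seq I) (P : pred I) (F : I -> T -> R) :
  (forall i, P i -> intg (F i)) ->
  \int[mu]_x (\sum_(i <- r | P i) F i x) = \sum_(i <- r | P i) \int[mu]_x F i x.
Proof.
move=> Fi; elim: r => [|i r IH].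
  under eq_Rintegral do rewrite big_nil.
  by rewrite big_nil Rintegral_cst// mul0r.
have [Pi|nPi] := boolP (P i).
  under eq_Rintegral do rewrite big_cons Pi.
  rewrite RintegralD//; [by rewrite IH big_cons Pi|exact: Fi|exact: intg_sum].
under eq_Rintegral do rewrite big_cons (negPf nPi).
by rewrite IH big_cons (negPf nPi).
Qed.

Lemma eq_Rint f g : f =1 g -> \int[mu]_x f x = \int[mu]_x g x.
Proof. by move=> fg; apply: eq_Rintegral => x _. Qed.

Lemma RintZl (c : R) f : intg f -> \int[mu]_x (c * f x) = c * \int[mu]_x f x.
Proof. by move=> fi; rewrite RintegralZl. Qed.

Lemma RintZr (c : R) f : intg f -> \int[mu]_x (f x * c) = (\int[mu]_x f x) * c.
Proof. by move=> fi; rewrite RintegralZr. Qed.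

Lemma RintN f : intg f -> \int[mu]_x (- f x) = - \int[mu]_x f x.
Proof.
move=> fi; rewrite -[RHS]mulN1r -RintegralZl//.
by apply: eq_Rintegral => x _; rewrite mulN1r.
Qed.

Lemma Rint_norm_le f g : intg f -> intg g -> (forall x, `|f x| <= g x) ->
  `|\int[mu]_x f x| <= \int[mu]_x g x.
Proof.
move=> fi gi fg; apply: (le_trans (le_normr_Rintegral _ fi)) => //.
by apply: le_Rintegral => //; exact: intg_norm.
Qed.

Lemma Rint_norm_le_bound f g (c : R) : intg f -> intg g ->
  (forall x, `|f x| <= c * g x) -> `|\int[mu]_x f x| <= c * \int[mu]_x g x.
Proof.
by move=> fi gi fg; rewrite -RintegralZl//; apply: Rint_norm_le => //; exact: intgZl.
Qed.

Lemma EFin_Rint f : intg f -> ((\int[mu]_x f x)%:E = \int[mu]_x (f x)%:E)%E.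
Proof. by move=> fi; rewrite /Rintegral fineK//; exact: integrable_fin_num. Qed.

Lemma intg_ltyP f : measurable_fun setT f ->
  (intg f <-> (\int[mu]_x (`|f x|)%:E < +oo)%E).
Proof.
move=> mf; split=> [/integrableP[]//|fi]; apply/integrableP; split => //.
exact/measurable_EFinP.
Qed.

Lemma intg_mul_bounded f g (M : R) : intg f -> measurable_fun setT g ->
  (forall x, `|g x| <= M) -> intg (fun x => f x * g x).
Proof.
move=> fi mg gM; apply: (@intg_le _ (fun x => M * `|f x|)).
- by apply: measurable_funM => //; exact: intg_measurable.
- exact/intgZl/intg_norm.
- by move=> x; rewrite normrM mulrC ler_wpM2r.
Qed.

Lemma Rint_cvg (F : nat -> T -> R) f g : (forall m, measurable_fun setT (F m)) ->
  measurable_fun setT f -> intg g -> (forall m x, `|F m x| <= g x) ->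
  (forall x, F ^~ x @ \oo --> f x) ->
  intg f /\ (\int[mu]_x F m x @[m --> \oo] --> \int[mu]_x f x).
Proof.
move=> mF mf gi Fg Ff.
have [|||||fi _ cv] := @dominated_convergence _ _ R mu setT measurableT
  (fun m => EFin \o F m) (EFin \o f) (EFin \o g).
- by move=> m; exact/measurable_EFinP.
- exact/measurable_EFinP.
- by apply/aeW => x _; apply: cvg_EFin; [exact: nearW|exact: Ff].
- exact: gi.
- by apply/aeW => x m _ /=; rewrite lee_fin.
split => //; have Fi m : intg (F m) by exact: intg_le (gi) _.
have cv' : ((fun m => \int[mu]_x (F m x)%:E) @ \oo --> (\int[mu]_x f x)%:E)%E.
  by rewrite EFin_Rint.
exact: fine_cvg cv'.
Qed.

End real_integrals.
Arguments Rint_cvg {R d T mu} F f g.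

Section real_fubini.
Context {R : realType} d1 d2 {T1 : measurableType d1} {T2 : measurableType d2}.
Variables (m1 : {sigma_finite_measure set T1 -> \bar R})
          (m2 : {sigma_finite_measure set T2 -> \bar R}).

Lemma intg_prodP (f : T1 -> T2 -> R) (G : T1 -> R) :
  measurable_fun setT (fun z : T1 * T2 => f z.1 z.2) ->
  (forall x, intg m2 (f x)) -> (forall x, \int[m2]_y `|f x y| <= G x) ->
  intg m1 G -> intg (m1 \x m2)%E (fun z => f z.1 z.2).
Proof.
move=> mf fi fG Gi; apply/(@integrable12ltyP _ _ _ _ _ m1 m2 (EFin \o (fun z => f z.1 z.2))).
  exact/measurable_EFinP.
move: (Gi) => /integrableP[_]; apply: le_lt_trans.
apply: ge0_le_integral => //.
- by move=> x _; exact: integral_ge0.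
- apply: (@measurable_fun_fubini_tonelli_F _ _ _ _ R m2 (fun z => (`|f z.1 z.2|)%:E)) => //.
  by apply/measurable_EFinP; exact: measurableT_comp.
- apply: measurableT_comp => //; apply/measurable_EFinP; exact: intg_measurable Gi.
- move=> x _ /=; rewrite (_ : \int[m2]_y _ = (\int[m2]_y `|f x y|)%:E)%E.
    by rewrite lee_fin (le_trans (fG x))// ler_norm.
  by rewrite EFin_Rint//; exact: intg_norm.
Qed.

(** Slices are asked to be integrable at every point, not only at almost every one, so that the
    inner integrals are finite everywhere and passing to real values loses nothing. *)
Lemma RFubini (f : T1 -> T2 -> R) :
  intg (m1 \x m2)%E (fun z => f z.1 z.2) ->
  (forall x, intg m2 (f x)) -> (forall y, intg m1 (f ^~ y)) ->
  [/\ intg m1 (fun x => \int[m2]_y f x y), intg m2 (fun y => \int[m1]_x f x y) &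
      \int[m1]_x \int[m2]_y f x y = \int[m2]_y \int[m1]_x f x y].
Proof.
move=> fi f1 f2.
have e1 : fubini_F m2 (EFin \o (fun z => f z.1 z.2)) = EFin \o (fun x => \int[m2]_y f x y).
  by apply/funext => x; rewrite /fubini_F /= EFin_Rint.
have e2 : fubini_G m1 (EFin \o (fun z => f z.1 z.2)) = EFin \o (fun y => \int[m1]_x f x y).
  by apply/funext => y; rewrite /fubini_G /= EFin_Rint.
have i1 : intg m1 (fun x => \int[m2]_y f x y).
  by rewrite /intg -e1; exact: integrable_fubini_F.
have i2 : intg m2 (fun y => \int[m1]_x f x y).
  rewrite /intg -e2; have mf := intg_measurable fi.
  have mf' : measurable_fun setT (fun z : T2 * T1 => (f z.2 z.1)%:E).
    by apply/measurable_EFinP; exact: measurableT_comp mf (@measurable_swap _ _ T2 T1).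
  apply: (@integrable_fubini_F _ _ _ _ _ m2 m1 (fun z => (f z.2 z.1)%:E)).
  apply/(integrable21ltyP _ _ mf').
  by apply/(@integrable12ltyP _ _ _ _ _ m1 m2 (EFin \o (fun z => f z.1 z.2))) => //; exact/measurable_EFinP.
split => //; apply: EFin_inj; rewrite !EFin_Rint//.
have := Fubini fi; rewrite /= => E.
under eq_integral do rewrite EFin_Rint//.
rewrite E; apply: eq_integral => y _; by rewrite EFin_Rint.
Qed.

End real_fubini.

Section integrals_rV.
Context {R : realType} (n : nat).
Local Notation rn := 'rV[R]_n.
Local Notation mu := (@lebesgue_rV R n).
Implicit Types f : rn -> R.

Lemma measurable_affine (c : R) (v : rn) : measurable_fun setT (fun x : rn => c *: x + v).
Proof. by apply: measurable_funD_rV => //; exact: measurable_funZ_rV. Qed.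

Lemma intg_affine (c : R) (v : rn) f : c != 0 ->
  intg mu f -> intg mu (fun x => f (c *: x + v)).
Proof.
move=> c0 fi; have mf := intg_measurable fi.
have mfc : measurable_fun setT (fun x : rn => f (c *: x + v)).
  exact: measurableT_comp mf (measurable_affine c v).
apply/intg_ltyP => //; move: fi => /(intg_ltyP _ mf).
rewrite (@ge0_integral_rV_affine _ _ c v)//; last first.
  by apply/measurable_EFinP; exact: measurableT_comp.
by rewrite !ltey; apply: contra => /eqP ->; rewrite gt0_muley// lte_fin exprn_gt0// normr_gt0.
Qed.

Lemma Rint_affine (c : R) (v : rn) f : c != 0 -> intg mu f ->
  \int[mu]_x f x = `|c| ^+ n * \int[mu]_x f (c *: x + v).
Proof.
move=> c0 fi; have fci := intg_affine v c0 fi.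
apply: EFin_inj; rewrite EFinM !EFin_Rint//.
rewrite integralE [in RHS]integralE.
have mf : measurable_fun setT (EFin \o f) by apply/measurable_EFinP; exact: intg_measurable fi.
have := @ge0_integral_rV_affine R n c v _ c0 (measurable_funepos mf) (fun x => funepos_ge0 _ x).
have := @ge0_integral_rV_affine R n c v _ c0 (measurable_funeneg mf) (fun x => funeneg_ge0 _ x).
rewrite /= => -> ->.
have eN : (\int[mu]_x (EFin \o f)^\- (c *: x + v)%R =
    \int[mu]_x (fun x0 : 'rV_n => (f (c *: x0 + v))%:E)^\- x)%E.
  by apply: eq_integral => x _; rewrite !funenegE.
have eP : (\int[mu]_x (EFin \o f)^\+ (c *: x + v)%R =
    \int[mu]_x (fun x0 : 'rV_n => (f (c *: x0 + v))%:E)^\+ x)%E.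
  by apply: eq_integral => x _; rewrite !funeposE.
have Nfin := integrable_neg_fin_num measurableT fci.
rewrite eN eP -muleBr// fin_num_adde_defl// fin_numN.
exact: Nfin.
Qed.

Lemma intg_shift (v : rn) f : intg mu f -> intg mu (fun x => f (x + v)).
Proof.
move=> fi; have := intg_affine v (oner_neq0 R) fi.
by apply: intg_eq => x; rewrite scale1r.
Qed.

Lemma Rint_shift (v : rn) f : intg mu f -> \int[mu]_x f (x + v) = \int[mu]_x f x.
Proof.
move=> fi; rewrite [RHS](Rint_affine v (oner_neq0 R))// normr1 expr1n mul1r.
by apply: eq_Rintegral => x _; rewrite scale1r.
Qed.

Lemma intg_reflect (v : rn) f : intg mu f -> intg mu (fun x => f (v - x)).
Proof.
move=> fi; have N1 : (-1 : R) != 0 by rewrite oppr_eq0 oner_eq0.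
by apply: intg_eq (intg_affine v N1 fi) => x; rewrite scaleN1r addrC.
Qed.

Lemma Rint_reflect (v : rn) f : intg mu f -> \int[mu]_x f (v - x) = \int[mu]_x f x.
Proof.
move=> fi; have N1 : (-1 : R) != 0 by rewrite oppr_eq0 oner_eq0.
rewrite [RHS](Rint_affine v N1)// normrN1 expr1n mul1r.
by apply: eq_Rintegral => x _; rewrite scaleN1r addrC.
Qed.

End integrals_rV.

(** * Product functions and integrable weights *)

Section product_functions.
Context {R : realType}.

Lemma ge0_integral_rV_prod n (f : R -> R) : measurable_fun setT f -> (forall x, 0 <= f x) ->
  intg lebesgue_measure f ->
  (\int[lebesgue_rV n]_x (\prod_i f (x ord0 i))%:E =
   ((\int[lebesgue_measure]_a f a) ^+ n)%:E)%E.
Proof.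
move=> mf f0 fi; elim: n => [|n IH].
  under eq_integral do rewrite big_ord0.
  by rewrite expr0 /= integral_dirac// diracE mem_set// mul1e.
have mp m : measurable_fun setT (fun x : 'rV[R]_m => \prod_i f (x ord0 i)).
  apply: measurable_prod => i _; exact: measurableT_comp mf (measurable_coor i).
rewrite ge0_integral_rVS//; last 2 first.
- by apply/measurable_EFinP; exact: mp.
- by move=> x; rewrite lee_fin; apply: prodr_ge0.
rewrite exprSr EFinM.
transitivity (\int[lebesgue_measure]_a ((((\int[lebesgue_measure]_a f a) ^+ n)%:E * (f a)%:E)))%E.
  apply: eq_integral => a _; rewrite -IH muleC -ge0_integralZl_EFin//; last 2 first.
    by move=> x _; rewrite lee_fin prodr_ge0.
    by apply/measurable_EFinP; exact: mp.
  apply: eq_integral => x _; rewrite -EFinM; congr EFin.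
  rewrite big_ord_recl; congr (f _ * _).
    by rewrite /rV_cons mxE; case: (split_ordP _) => j e; rewrite ?mxE//; move/(congr1 val): e.
  apply: eq_bigr => i _; congr f; rewrite /rV_cons mxE.
  case: (split_ordP _) => j e; first by move/(congr1 val): e; rewrite /= ord1.
  by congr (x _ _); apply: val_inj; move/(congr1 val): e => /= [].
rewrite ge0_integralZl_EFin//.
- by rewrite EFin_Rint.
- by move=> x _; rewrite lee_fin.
- exact/measurable_EFinP.
- by rewrite exprn_ge0// Rintegral_ge0.
Qed.

Lemma intg_oneDsqrV : intg lebesgue_measure (fun x : R => (1 + x ^+ 2)^-1).
Proof.
have cf : continuous (fun x : R => (1 + x ^+ 2)^-1) by exact: continuous_oneDsqrV.
have f0 (x : R) : 0 <= (1 + x ^+ 2)^-1 by rewrite invr_ge0 addr_ge0// sqr_ge0.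
apply/intg_ltyP; first exact: continuous_measurable_fun.
under eq_integral do rewrite ger0_norm//.
rewrite ge0_symfun_integralT//; last by move=> x /=; rewrite sqrrN.
rewrite -set_itvcy integral0y_oneDsqr.
by rewrite -EFinM ltry.
Qed.

Definition wt n (N : nat) (x : 'rV[R]_n) : R := (1 + `|x|) ^- N.

Lemma wt_gt0 n N (x : 'rV[R]_n) : 0 < wt N x.
Proof. by rewrite invr_gt0 exprn_gt0// ltr_pwDl. Qed.

Lemma wt_ge0 n N (x : 'rV[R]_n) : 0 <= wt N x. Proof. exact/ltW/wt_gt0. Qed.

Lemma wt_le n N M (x : 'rV[R]_n) : (M <= N)%N -> wt N x <= wt M x.
Proof.
move=> MN; rewrite /wt lef_pV2 ?posrE ?exprn_gt0 ?ltr_pwDl//.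
by rewrite ler_weXn2l// lerDl.
Qed.

Lemma measurable_wt n N : measurable_fun setT (@wt n N).
Proof.
have cg : continuous (fun r : R => (1 + `|r|) ^- N).
  move=> r; apply: (@cvgV _ _ _ _ (fun r : R => (1 + `|r|) ^+ N)).
    by rewrite expf_neq0// gt_eqF// ltr_pwDl.
  apply: (@continuous_comp _ _ _ (fun r : R => 1 + `|r|) (fun r => r ^+ N)).
    by apply: cvgD; [exact: cvg_cst|exact: norm_continuous].
  exact: exprn_continuous.
have mn : measurable_fun setT (fun x : 'rV[R]_n => `|x|).
  by apply: continuous_measurable_rV; exact: norm_continuous.
have := measurableT_comp (continuous_measurable_fun cg) mn.
by apply: eq_measurable_fun => x _ /=; rewrite normr_id.
Qed.

(** Since [1 + x_i^2 <= (1 + |x|)^2] for every coordinate, the weight is below the product of the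
    functions [1 / (1 + x_i^2)], whose integral factorizes. *)
Lemma intg_wt n N : (2 * n <= N)%N -> intg (lebesgue_rV n) (@wt n N).
Proof.
move=> nN.
have H : intg (lebesgue_rV n) (fun x : 'rV[R]_n => \prod_i (1 + x ord0 i ^+ 2)^-1).
  have f0 (x : R) : 0 <= (1 + x ^+ 2)^-1 by rewrite invr_ge0 addr_ge0// sqr_ge0.
  have mf := intg_measurable intg_oneDsqrV.
  apply/intg_ltyP.
    apply: measurable_prod => i _; exact: measurableT_comp mf (measurable_coor i).
  under eq_integral do rewrite ger0_norm ?prodr_ge0//.
  by rewrite (ge0_integral_rV_prod n mf f0 intg_oneDsqrV) ltry.
apply: intg_le H _; first exact: measurable_wt.
move=> x; rewrite ger0_norm ?wt_ge0//; apply: (le_trans (wt_le x nN)).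
  rewrite /wt exprM prodfV lef_pV2 ?posrE; last 2 first.
  - by rewrite !exprn_gt0// ltr_pwDl.
  - by apply: prodr_gt0 => i _; rewrite ltr_pwDl// sqr_ge0.
  rewrite -[X in _ <= _ ^+ X](card_ord n) -prodr_const.
  apply: ler_prod => i _; rewrite addr_ge0 ?sqr_ge0//=.
  have := rV_coord_le x i; have := normr_ge0 (x ord0 i).
  by rewrite -(real_normK (num_real (x ord0 i))); nra.
Qed.

End product_functions.

(** * Differential calculus *)

Section one_variable.
Context {R : realType}.

Lemma is_derive_continuous (f df : R -> R) :
  (forall t : R, is_derive t (1 : R) f (df t)) -> continuous f.
Proof.
move=> fd t; apply: differentiable_continuous; apply/derivable1_diffP.
by have := fd t; case.
Qed.

Lemma MVT_two_sided (f df : R -> R) (a b : R) :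
  (forall t : R, is_derive t (1 : R) f (df t)) ->
  exists2 c, `|c - a| <= `|b - a| & f b - f a = df c * (b - a).
Proof.
move=> fd; have fc := is_derive_continuous fd.
have H u v : u <= v -> exists2 c, c \in `[u, v] & f v - f u = df c * (v - u).
  by move=> uv; apply: MVT_segment => //; exact: continuous_subspaceT.
have [ab|/ltW ba] := leP a b.
  have [c] := H _ _ ab; rewrite in_itv/= => /andP[ac cb] E; exists c => //.
  by rewrite !ger0_norm ?subr_ge0// lerD2r.
have [c] := H _ _ ba; rewrite in_itv/= => /andP[bc ca] E; exists c.
  by rewrite ![`|_ - a|]distrC !ger0_norm ?subr_ge0// lerD2l lerN2.
by rewrite -[LHS]opprB E -mulrN opprB.
Qed.

Lemma taylor2 (f df ddf : R -> R) (a b M : R) :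
  (forall t : R, is_derive t (1 : R) f (df t)) -> (forall t : R, is_derive t (1 : R) df (ddf t)) ->
  (forall t, `|t - a| <= `|b - a| -> `|ddf t| <= M) ->
  `|f b - f a - (b - a) * df a| <= M * (b - a) ^+ 2.
Proof.
move=> fd dfd ddfM; have [c ca E] := MVT_two_sided a b fd.
have [c' c'a E'] := MVT_two_sided a c dfd.
have -> : f b - f a - (b - a) * df a = (b - a) * (df c - df a) by rewrite E; ring.
rewrite E' !normrM -(real_normK (num_real (b - a))) expr2 mulrA mulrC.
rewrite (_ : _ * _ = `|c - a| * `|b - a| * `|ddf c'|); last by ring.
rewrite (_ : M * _ = `|b - a| * `|b - a| * M); last by ring.
apply: ler_pM => //; first by rewrite ler_wpM2r.
by apply: ddfM; exact: le_trans ca.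
Qed.

(** A remainder bounded by [C h^2] can be integrated term by term, so derivatives of integrals are
    obtained from such bounds rather than from limits of difference quotients. *)
Lemma is_derive_quad (f : R -> R) (t l C : R) :
  (forall h, `|h| <= 1 -> `|f (t + h) - f t - h * l| <= C * h ^+ 2) -> is_derive t (1 : R) f l.
Proof.
move=> fC.
have C0 : 0 <= C.
  by have := le_trans (normr_ge0 _) (fC 1 _); rewrite normr1 expr1n mulr1; apply.
have E : (fun h => h^-1 *: ((f \o shift t) (h *: 1) - f t)) @ 0^' --> l.
  apply/cvgrPdist_le => e e0; near=> h.
  have h0 : h != 0 by near: h; exact: nbhs_dnbhs_neq.
  have h1 : `|h| <= 1.
    by near: h; apply: dnbhs0_le.
  have he : `|h| <= e / (C + 1).
    by near: h; apply: dnbhs0_le; rewrite divr_gt0// ltr_wpDl.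
  rewrite /= scaler1 [h + t]addrC.
  rewrite (_ : _ - _ = - (h^-1 * (f (t + h) - f t - h * l))); last first.
    by rewrite /GRing.scale/=; field.
  rewrite normrN normrM normfV ler_pdivrMl ?normr_gt0//.
  apply: (le_trans (fC h h1)); rewrite -(real_normK (num_real h)) expr2 mulrA.
  rewrite mulrC ler_wpM2l//.
  apply: (le_trans (ler_wpM2l C0 he)).
  by rewrite mulrA ler_pdivrMr ?ltr_wpDl// mulrDr mulr1 [e * C]mulrC lerDl ltW.
by apply: DeriveDef; [apply/cvg_ex; exists l|exact: cvg_lim].
Unshelve. all: by end_near. Qed.

(** Cutting [[a, b]] into [m + 1] equal pieces, each contributing at most [C ((b - a) / (m + 1))^2],
    bounds the increment by [C (b - a)^2 / (m + 1)]. *)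
Lemma quad_cst (f : R -> R) (C u v : R) :
  (forall a b, u <= a -> a < b -> b < v -> `|f b - f a| <= C * (b - a) ^+ 2) ->
  forall a b, u <= a -> a < b -> b < v -> f a = f b.
Proof.
move=> fC a b ua ab bv; have ba0 : 0 < b - a by rewrite subr_gt0.
have C0 : 0 <= C.
  have := le_trans (normr_ge0 _) (fC a b ua ab bv).
  by rewrite pmulr_lge0// exprn_gt0.
have H (m : nat) : `|f b - f a| <= C * (b - a) ^+ 2 / m.+1%:R.
  pose p (k : nat) := a + k%:R * ((b - a) / m.+1%:R).
  have m0 : 0 < m.+1%:R :> R by [].
  have -> : f b - f a = \sum_(k < m.+1) (f (p k.+1) - f (p k)).
    rewrite -(big_mkord xpredT (fun k => f (p k.+1) - f (p k))) telescope_sumr// /p mul0r addr0.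
    by rewrite mulrCA divff ?mulr1 ?lt0r_neq0// [a + _]addrC subrK.
  apply: (le_trans (ler_norm_sum _ _ _)).
  apply: (@le_trans _ _ (\sum_(k < m.+1) C * ((b - a) / m.+1%:R) ^+ 2)).
    apply: ler_sum => k _; have := fC (p k) (p k.+1).
    have -> : p k.+1 - p k = (b - a) / m.+1%:R by rewrite /p -natr1; ring.
    have d0 : 0 < (b - a) / m.+1%:R by rewrite divr_gt0.
    apply.
    - by rewrite (le_trans ua)// /p lerDl mulr_ge0// ltW.
    - by rewrite /p ltrD2l ltr_pM2r// ltr_nat.
    - rewrite (le_lt_trans _ bv)// /p -lerBrDl mulrA ler_pdivrMr// mulrC.
      by rewrite ler_pM2l// ler_nat ltn_ord.
  rewrite sumr_const card_ord -[X in X <= _]mulr_natr.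
  have m1 := lt0r_neq0 m0; move: m1; set mm := m.+1%:R => m1.
  by rewrite (_ : _ * mm = C * (b - a) ^+ 2 / mm)//; field.
apply/esym/eqP; rewrite -subr_eq0 -normr_le0.
apply/ler_addgt0Pr => e e0; rewrite add0r.
have [m me] : exists m : nat, C * (b - a) ^+ 2 / e <= m.+1%:R.
  exists (Num.truncn (C * (b - a) ^+ 2 / e)).
  by apply/ltW/truncnS_gt.
apply: (le_trans (H m)); rewrite ler_pdivrMr// [e * _]mulrC -ler_pdivrMr//.
Qed.

End one_variable.

Section frechet.
Context {R : realType} (n : nat).
Local Notation rn := 'rV[R]_n.
Implicit Types (f : rn -> R) (x h : rn).

Definition ebase (i : 'I_n) : rn := delta_mx ord0 i.

Lemma rV_decomp (h : rn) : h = \sum_i h ord0 i *: ebase i.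
Proof. exact: row_sum_delta. Qed.

Lemma diff_pderiv f x (h : rn) : differentiable f x ->
  'd f x h = \sum_i h ord0 i * pderiv i f x.
Proof.
move=> df; rewrite {1}[h]rV_decomp linear_sum; apply: eq_bigr => i _.
by rewrite linearZ /pderiv deriveE.
Qed.

Definition grad f x : 'I_n -> R := fun i => pderiv i f x.

Definition lincomb (g : 'I_n -> R) (h : rn) : R := \sum_i h ord0 i * g i.

Lemma lincomb_linear g : linear (lincomb g).
Proof.
move=> a u v; rewrite /lincomb scaler_sumr -big_split; apply: eq_bigr => i _.
by rewrite !mxE mulrDl -mulrA.
Qed.

HB.instance Definition _ (g : 'I_n -> R) :=
  GRing.isLinear.Build R rn R _ (lincomb g) (lincomb_linear g).

Lemma continuous_lincomb g : continuous (lincomb g).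
Proof.
rewrite (_ : lincomb g = \sum_i (fun h : rn => h ord0 i * g i)); last first.
  by apply/funext => h; rewrite fct_sumE.
move=> x; apply: (@differentiable_continuous _ _ _ x); apply: differentiable_sum => i.
apply: differentiableM; last exact: differentiable_cst.
exact: differentiable_coord.
Qed.

Lemma lincomb_le g (h : rn) (M : R) : (forall i, `|g i| <= M) ->
  `|lincomb g h| <= n%:R * M * `|h|.
Proof.
move=> gM; apply: (le_trans (ler_norm_sum _ _ _)).
apply: (@le_trans _ _ (\sum_(i < n) `|h| * M)).
  by apply: ler_sum => i _; rewrite normrM ler_pM// rV_coord_le.
by rewrite sumr_const card_ord -[_ *+ n]mulr_natl [`|h| * M]mulrC mulrA.
Qed.

Lemma differentiable_quad f x (g : 'I_n -> R) (C : R) :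
  (forall h, `|h| <= 1 -> `|f (x + h) - f x - lincomb g h| <= C * `|h| ^+ 2) ->
  differentiable f x /\ (forall i, pderiv i f x = g i).
Proof.
move=> fC.
have C0 : 0 <= `|C| + 1 by rewrite addr_ge0.
have E : f \o shift x = cst (f x) + lincomb g +o_ (0 : rn) id.
  have H (d : R) : 0 < d -> \forall h \near (0 : rn), `|h| <= d.
    by move=> d0; apply/nbhs_normP; exists d => //= y; rewrite /ball_/= sub0r normrN => /ltW.
  apply/eqaddoP => e e0; near=> h.
  have h1 : `|h| <= 1 by near: h; exact: H.
  have he : `|h| <= e / (`|C| + 1).
    near: h; apply: H; rewrite divr_gt0// ltr_wpDl.
  rewrite /= -[X in `|X|]/(f (h + x) - (f x + lincomb g h)).
  rewrite opprD addrA [h + x]addrC; apply: (le_trans (fC h h1)).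
  rewrite expr2 mulrA ler_wpM2r//.
  apply: (@le_trans _ _ ((`|C| + 1) * `|h|)).
    by rewrite ler_wpM2r// (le_trans (ler_norm C))// lerDl.
  by rewrite mulrC -ler_pdivlMr// ltr_wpDl.
have Ed : 'd f x = lincomb g :> (rn -> R).
  by apply: (diff_unique (df := lincomb g)) => //; exact: continuous_lincomb.
have df : differentiable f x.
  apply/diff_locallyP; rewrite Ed; split; first exact: continuous_lincomb.
  exact: E.
split => // i; rewrite /pderiv deriveE// Ed /lincomb (bigD1 i)//= big1 ?addr0.
  by rewrite mxE !eqxx mul1r.
by move=> j ji; rewrite mxE (negPf ji) andbF mul0r.
Unshelve. all: by end_near. Qed.

Lemma is_derive_line f x h : (forall y, differentiable f y) ->
  forall t : R, is_derive t (1 : R) (fun t : R => f (x + t *: h)) (lincomb (grad f (x + t *: h)) h).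
Proof.
move=> df t; have dd := @diff_derivable _ _ _ f (x + t *: h) h (df _).
have E : (fun s : R => s^-1 *: (((fun t => f (x + t *: h)) \o shift t) (s *: 1) - f (x + t *: h)))
   = (fun s => s^-1 *: ((f \o shift (x + t *: h)) (s *: h) - f (x + t *: h))).
  apply/funext => s /=; congr (_ *: (f _ - _)).
  by rewrite scaler1 scalerDl addrCA.
apply: DeriveDef; first by rewrite /derivable E.
by rewrite /derive E -/(derive f (x + t *: h) h) deriveE// diff_pderiv.
Qed.

Lemma taylor2_rV f x h (M : R) : (forall y, differentiable f y) ->
  (forall i y, differentiable (pderiv i f) y) ->
  (forall i j (t : R), `|t| <= 1 -> `|pderiv i (pderiv j f) (x + t *: h)| <= M) ->
  `|f (x + h) - f x - lincomb (grad f x) h| <= n%:R * n%:R * M * `|h| ^+ 2.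
Proof.
move=> df ddf fM.
have d2 (t : R) : is_derive t (1 : R) (fun t : R => lincomb (grad f (x + t *: h)) h)
    (\sum_j h ord0 j * lincomb (fun i => pderiv i (pderiv j f) (x + t *: h)) h).
  rewrite /lincomb.
  rewrite (_ : (fun t : R => _) = \sum_j (fun t => h ord0 j * pderiv j f (x + t *: h))); last first.
    by apply/funext => s; rewrite fct_sumE.
  apply: is_derive_sum => j.
  have := is_derive_line x h (ddf j) t => H.
  exact: is_deriveZ.
have := @taylor2 _ _ _ _ 0 1 (n%:R * n%:R * M * `|h| ^+ 2) (is_derive_line x h df) d2.
rewrite !subr0 expr1n mulr1 mul1r scale1r scale0r addr0; apply => t t1.
rewrite subr0 normr1 in t1.
have := @lincomb_le (fun j => lincomb (fun i => pderiv i (pderiv j f) (x + t *: h)) h) h (n%:R * M * `|h|).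
rewrite (_ : n%:R * (n%:R * M * `|h|) * `|h| = n%:R * n%:R * M * `|h| ^+ 2); last by ring.
by apply => j; apply: lincomb_le => i; exact: fM.
Qed.

End frechet.

(** * Schwartz functions *)

Section weights.
Context {R : realType} (n : nat).
Local Notation rn := 'rV[R]_n.
Implicit Types (f : rn -> R) (x y : rn).

Lemma wnum_ge1 x : 1 <= 1 + `|x|. Proof. by rewrite lerDl. Qed.
Lemma wnum_gt0 x : 0 < 1 + `|x|. Proof. exact: lt_le_trans (wnum_ge1 x). Qed.

Lemma wnumX_gt0 x k : 0 < (1 + `|x|) ^+ k. Proof. by rewrite exprn_gt0// wnum_gt0. Qed.

Lemma wnum_add x y : 1 + `|x + y| <= (1 + `|x|) * (1 + `|y|).
Proof. by have := ler_normD x y; have := normr_ge0 x; have := normr_ge0 y; nra. Qed.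

Lemma wnum_scale (s : R) x : 1 + `|s *: x| <= (1 + `|s|) * (1 + `|x|).
Proof. by rewrite normrZ; have := normr_ge0 x; have := normr_ge0 s; nra. Qed.

Lemma wtE k x : wt k x * (1 + `|x|) ^+ k = 1.
Proof. by rewrite /wt mulVf// gt_eqF// wnumX_gt0. Qed.

Definition decw (k : nat) (M : R) f := forall x, (1 + `|x|) ^+ k * `|f x| <= M.

Lemma decwP k M f : decw k M f <-> forall x, `|f x| <= M * wt k x.
Proof.
split=> H x; have := H x.
  by rewrite -ler_pdivlMl ?wnumX_gt0// mulrC.
by rewrite /wt ler_pdivlMr ?wnumX_gt0// mulrC.
Qed.

Lemma decw_ge0 k M f : decw k M f -> 0 <= M.
Proof. by move/(_ 0); apply: le_trans; rewrite mulr_ge0// exprn_ge0// ltW// wnum_gt0. Qed.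

Lemma decw_le k k' M f : (k <= k')%N -> decw k' M f -> decw k M f.
Proof.
move=> kk fM x; apply: le_trans (fM x); rewrite ler_wpM2r//.
by rewrite ler_weXn2l// wnum_ge1.
Qed.

Lemma decw_bound k M f x : decw k M f -> `|f x| <= M.
Proof. by move=> /(decw_le (leq0n k))/(_ x); rewrite expr0 mul1r. Qed.

Definition decay f := forall k, exists M, decw k M f.

Lemma decwD k M N f g : decw k M f -> decw k N g -> decw k (M + N) (fun x => f x + g x).
Proof.
move=> fM gN x; apply: (le_trans (ler_wpM2l (ltW (wnumX_gt0 x k)) (ler_normD _ _))).
by rewrite mulrDr lerD.
Qed.

Lemma decwZ k M f (a : R) : decw k M f -> decw k (`|a| * M) (fun x => a * f x).
Proof. by move=> fM x; rewrite normrM mulrCA ler_wpM2l. Qed.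

Lemma decay_lin (a : R) f g : decay f -> decay g -> decay (fun x => a * f x + g x).
Proof.
move=> df dg k; have [M fM] := df k; have [N gN] := dg k.
by exists (`|a| * M + N); apply: decwD => //; exact: decwZ.
Qed.

Lemma decay_coord (j : 'I_n) f : decay f -> decay (fun x => x ord0 j * f x).
Proof.
move=> df k; have [M fM] := df k.+1; exists M => x; apply: le_trans (fM x).
rewrite exprSr -mulrA; apply: ler_wpM2l; first by rewrite ltW// wnumX_gt0.
rewrite normrM; apply: ler_wpM2r => //.
by rewrite (le_trans (rV_coord_le x j))// lerDr.
Qed.

Lemma decay_intg f k : measurable_fun setT f -> decay f ->
  intg (lebesgue_rV n) (fun x => (1 + `|x|) ^+ k * f x).
Proof.
move=> mf df; have [M fM] := df (2 * n + k)%N.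
apply: intg_le (intgZl M (@intg_wt R n _ (leqnn _))) _.
  apply: measurable_funM => //.
  have mn : measurable_fun setT (fun x : rn => 1 + `|x|).
    apply: measurable_funD => //; apply: continuous_measurable_rV; exact: norm_continuous.
  exact: measurable_funX.
move=> x; rewrite normrM ger0_norm ?exprn_ge0 ?addr_ge0//.
have := fM x; rewrite exprD -mulrA -[_ <= M]ler_pdivlMl ?wnumX_gt0// => /le_trans; apply.
by rewrite /wt mulrC.
Qed.

End weights.

Section schwartz_space.
Context {R : realType} (n : nat).
Local Notation rn := 'rV[R]_n.
Local Notation mu := (@lebesgue_rV R n).
Implicit Types (f g phi : rn -> R) (x y h : rn).

Lemma norm_le_enorm x : `|x| <= enorm x.
Proof.
apply/rV_normP => [|i]; first exact: sqrtr_ge0.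
rewrite /enorm -sqrtr_sqr ler_wsqrtr// /dotp (bigD1 i)//= -expr2 lerDl sumr_ge0// => j _.
by rewrite -expr2 sqr_ge0.
Qed.

Lemma dotp_le x y : `|dotp x y| <= n%:R * (`|x| * `|y|).
Proof.
apply: (le_trans (ler_norm_sum _ _ _)); rewrite mulr_natl -[n in _ *+ n]card_ord -sumr_const.
by apply: ler_sum => i _; rewrite normrM ler_pM// rV_coord_le.
Qed.

Lemma enorm_sqr x : enorm x ^+ 2 = dotp x x.
Proof. by rewrite sqr_sqrtr// sumr_ge0// => i _; rewrite -expr2 sqr_ge0. Qed.

Lemma enorm_le x : enorm x <= n%:R * `|x|.
Proof.
rewrite -[X in _ <= X]ger0_norm ?mulr_ge0// -sqrtr_sqr ler_wsqrtr// exprMn.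
apply: (le_trans (ler_norm _)); apply: (le_trans (dotp_le x x)); rewrite -expr2.
rewrite ler_wpM2r ?sqr_ge0// -natrX ler_nat -mulnn.
by case: (n) => // m; rewrite leq_pmulr.
Qed.

Lemma wenorm_le x k : (1 + enorm x) ^+ k <= (1 + n%:R) ^+ k * (1 + `|x|) ^+ k.
Proof.
rewrite -exprMn lerXn2r ?nnegrE ?addr_ge0 ?mulr_ge0 ?sqrtr_ge0 ?addr_ge0//.
have := enorm_le x; have : 0 <= n%:R :> R by []; have := normr_ge0 x; nra.
Qed.

Lemma wnorm_le x k : (1 + `|x|) ^+ k <= (1 + enorm x) ^+ k.
Proof. by rewrite lerXn2r ?nnegrE ?addr_ge0 ?sqrtr_ge0// lerD2l norm_le_enorm. Qed.

Lemma schwartzP phi : schwartz phi <-> forall l,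
  (forall x, differentiable (pderivs l phi) x) /\ decay (pderivs l phi).
Proof.
split => H l; have [d b] := H l; split => // k; have [M bM] := b k.
  exists M => x; apply: le_trans (bM x); rewrite ler_wpM2r//; exact: wnorm_le.
exists ((1 + n%:R) ^+ k * M) => x; apply: (@le_trans _ _ ((1 + n%:R) ^+ k * (1 + `|x|) ^+ k * `|pderivs l phi x|)).
  by rewrite ler_wpM2r//; exact: wenorm_le.
by rewrite -mulrA ler_wpM2l// exprn_ge0// addr_ge0.
Qed.

Lemma schwartz_diff phi x : schwartz phi -> differentiable phi x.
Proof. by move=> /schwartzP/(_ [::])[]. Qed.

Lemma schwartz_decay phi : schwartz phi -> decay phi.
Proof. by move=> /schwartzP/(_ [::])[]. Qed.

Lemma pderivs_cat l l' phi : pderivs (l ++ l') phi = pderivs l (pderivs l' phi).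
Proof. by rewrite /pderivs foldr_cat. Qed.

Lemma schwartz_pderivs l phi : schwartz phi -> schwartz (pderivs l phi).
Proof. by move=> sphi l'; rewrite -pderivs_cat; exact: sphi. Qed.

Lemma schwartz_pderiv i phi : schwartz phi -> schwartz (pderiv i phi).
Proof. exact: (@schwartz_pderivs [:: i]). Qed.

Lemma schwartz_continuous phi : schwartz phi -> continuous phi.
Proof. by move=> sphi x; apply: differentiable_continuous; exact: schwartz_diff. Qed.

Lemma schwartz_measurable phi : schwartz phi -> measurable_fun setT phi.
Proof. by move=> sphi; apply: continuous_measurable_rV; exact: schwartz_continuous. Qed.

(** Coinduction: being Schwartz is the largest property that is stable under partial derivatives and
    implies differentiability and decay. An invariant class then replaces formulas for iterated
    derivatives. *)
Lemma schwartz_coind (P : (rn -> R) -> Prop) :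
  (forall f, P f -> (forall x, differentiable f x) /\ decay f) ->
  (forall f i, P f -> P (pderiv i f)) -> forall f, P f -> schwartz f.
Proof.
move=> H1 H2 f Pf; apply/schwartzP => l; apply: H1.
by elim: l => //= i l; exact: H2.
Qed.

Lemma pderiv_lin i (a : R) f g x : differentiable f x -> differentiable g x ->
  pderiv i (fun x => a * f x + g x) x = a * pderiv i f x + pderiv i g x.
Proof.
move=> df dg; rewrite /pderiv.
have daf : derivable (a *: f) x (delta_mx ord0 i) by apply: derivableZ; exact: diff_derivable.
rewrite (_ : (fun x => a * f x + g x) = (a *: f) + g); last by apply/funext.
rewrite deriveD//; last exact: diff_derivable.
by rewrite deriveZ//; exact: diff_derivable.
Qed.

Lemma differentiable_lin (a : R) f g x : differentiable f x -> differentiable g x ->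
  differentiable (fun x => a * f x + g x) x.
Proof.
by move=> df dg; apply: differentiableD => //; exact: (@differentiableZ _ _ _ f a x).
Qed.

Lemma pderivM i f g x : differentiable f x -> differentiable g x ->
  pderiv i (fun x => f x * g x) x = f x * pderiv i g x + g x * pderiv i f x.
Proof. by move=> df dg; rewrite /pderiv (@deriveM _ _ f g)//; exact: diff_derivable. Qed.

Lemma pderiv_coord i j x : pderiv i (fun x => x ord0 j) x = (i == j)%:R.
Proof.
have E : (fun x : rn => x ord0 j) = lincomb (fun k => (k == j)%:R).
  apply/funext => y; rewrite /lincomb (bigD1 j)//= eqxx mulr1 big1 ?addr0// => k kj.
  by rewrite (negPf kj) mulr0.
rewrite E; suff [_ ->//] : differentiable (lincomb (fun k => (k == j)%:R)) x /\
  forall i, pderiv i (lincomb (fun k => (k == j)%:R)) x = (fun k => (k == j)%:R) i.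
apply: (@differentiable_quad _ _ _ _ _ 0) => h _.
by rewrite linearD addrAC addrK subrr normr0 mul0r.
Qed.

Lemma schwartz_ext f g : f =1 g -> schwartz f -> schwartz g.
Proof. by move/funext => ->. Qed.

Lemma schwartz_lin (a : R) f g : schwartz f -> schwartz g ->
  schwartz (fun x => a * f x + g x).
Proof.
move=> sf sg.
suff H : forall w : rn -> R, (exists u v, [/\ schwartz u, schwartz v & w = (fun x => a * u x + v x)]) ->
  schwartz w by apply: H; exists f, g.
apply: schwartz_coind.
- move=> _ [u [v [su sv ->]]]; split; last by apply: decay_lin; exact: schwartz_decay.
  by move=> x; apply: differentiable_lin; exact: schwartz_diff.
- move=> _ i [u [v [su sv ->]]]; exists (pderiv i u), (pderiv i v); split; try exact: schwartz_pderiv.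
  by apply/funext => x; rewrite pderiv_lin//; exact: schwartz_diff.
Qed.

Lemma pderivs_lin l (a : R) f g : schwartz f -> schwartz g ->
  pderivs l (fun x => a * f x + g x) = (fun x => a * pderivs l f x + pderivs l g x).
Proof.
move=> sf sg; elim: l => //= i l ->; apply/funext => x.
by rewrite pderiv_lin//; apply: schwartz_diff; exact: schwartz_pderivs.
Qed.

Lemma pderiv_cst i (c : R) x : pderiv i (fun _ : rn => c) x = 0.
Proof. exact: derive_cst. Qed.

Lemma schwartz0 : schwartz (fun _ : rn => 0 : R).
Proof.
suff H : forall w : rn -> R, w = (fun _ : rn => 0 : R) -> schwartz w by exact: H.
apply: schwartz_coind => [_ ->|_ i ->].
- split; first by move=> x; exact: differentiable_cst.
  by move=> k; exists 0 => x; rewrite normr0 mulr0.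
- by apply/funext => x; rewrite pderiv_cst.
Qed.

Lemma pderivs0 l x : pderivs l (fun _ : rn => 0 : R) x = 0.
Proof.
suff -> : pderivs l (fun _ : rn => 0 : R) = (fun _ => 0) by [].
by elim: l => //= i l ->; apply/funext => y; rewrite pderiv_cst.
Qed.

Lemma schwartzZ (a : R) f : schwartz f -> schwartz (fun x => a * f x).
Proof.
move=> sf; have := schwartz_lin a sf schwartz0.
by apply: schwartz_ext => x; rewrite addr0.
Qed.

Lemma schwartzN f : schwartz f -> schwartz (fun x => - f x).
Proof.
move=> sf; have := schwartzZ (-1) sf.
by apply: schwartz_ext => x; rewrite mulN1r.
Qed.

Lemma schwartzD f g : schwartz f -> schwartz g -> schwartz (fun x => f x + g x).
Proof.
move=> sf sg; have := schwartz_lin 1 sf sg.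
by apply: schwartz_ext => x; rewrite mul1r.
Qed.

Lemma pderivsZ l (a : R) f : schwartz f -> pderivs l (fun x => a * f x) = (fun x => a * pderivs l f x).
Proof.
move=> sf; have := pderivs_lin l a sf schwartz0.
rewrite (_ : (fun x => a * f x + 0) = (fun x => a * f x)); last by apply/funext => x; rewrite addr0.
by move=> ->; apply/funext => x; rewrite pderivs0 addr0.
Qed.

(** Closure of a class under multiplication by coordinates and linear combinations. Derivatives of a
    Gaussian leave the span of Gaussians but stay in this closure. *)
Inductive gen_coord (B : (rn -> R) -> Prop) : (rn -> R) -> Prop :=
| Gen_base f of B f : gen_coord B f
| Gen_coord j f of gen_coord B f : gen_coord B (fun x => x ord0 j * f x)
| Gen_lin (a : R) f g of gen_coord B f & gen_coord B g : gen_coord B (fun x => a * f x + g x).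

Lemma differentiable_coordM j f x : differentiable f x ->
  differentiable (fun x => x ord0 j * f x) x.
Proof.
move=> df; apply: (@differentiableM _ _ (fun x : rn => x ord0 j) f) => //.
exact: differentiable_coord.
Qed.

Lemma gen_coord_diff B f : (forall f, B f -> (forall x, differentiable f x) /\ decay f) ->
  gen_coord B f -> (forall x, differentiable f x) /\ decay f.
Proof.
move=> HB; elim=> [g /HB//|j g _ [dg bg]|a u v _ [du bu] _ [dv bv]]; split.
- by move=> x; exact: differentiable_coordM.
- exact: decay_coord.
- by move=> x; exact: differentiable_lin.
- exact: decay_lin.
Qed.

Lemma gen_coord_schwartz (B : (rn -> R) -> Prop) :
  (forall f, B f -> (forall x, differentiable f x) /\ decay f) ->
  (forall f i, B f -> gen_coord B (pderiv i f)) ->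
  forall f, gen_coord B f -> schwartz f.
Proof.
move=> H1 H2; apply: schwartz_coind; first by move=> f; exact: gen_coord_diff.
move=> f i; elim=> [g Bg|j g Bg IH|a u v Bu IHu Bv IHv].
- exact: H2.
- have [dg _] := gen_coord_diff H1 Bg.
  rewrite (_ : pderiv i _ = (fun x => (i == j)%:R * g x + x ord0 j * pderiv i g x)).
    by apply: Gen_lin => //; exact: Gen_coord.
  apply/funext => x; rewrite (@pderivM i (fun x : rn => x ord0 j) g)//; last exact: differentiable_coord.
  by rewrite pderiv_coord addrC mulrC.
- have [du _] := gen_coord_diff H1 Bu; have [dv _] := gen_coord_diff H1 Bv.
  rewrite (_ : pderiv i _ = (fun x => a * pderiv i u x + pderiv i v x)); first exact: Gen_lin.
  by apply/funext => x; rewrite pderiv_lin.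
Qed.

Lemma schwartz_coord j f : schwartz f -> schwartz (fun x => x ord0 j * f x).
Proof.
move=> sf; suff H : forall g, gen_coord (@schwartz R n) g -> schwartz g.
  by apply: H; apply: Gen_coord; exact: Gen_base.
apply: gen_coord_schwartz.
- by move=> g sg; split; [move=> x; exact: schwartz_diff|exact: schwartz_decay].
- by move=> g i sg; apply: Gen_base; exact: schwartz_pderiv.
Qed.

Lemma differentiable_affine (c : R) v f x : (forall y, differentiable f y) ->
  differentiable (fun x => f (c *: x + v)) x.
Proof.
move=> df.
have da : differentiable (fun x : rn => c *: x + v) x.
  by apply: differentiableD => //; exact: differentiableZ.
exact: (@differentiable_comp _ _ _ _ (fun x : rn => c *: x + v) f).
Qed.

Lemma pderiv_affine i (c : R) v f x : (forall y, differentiable f y) ->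
  pderiv i (fun x => f (c *: x + v)) x = c * pderiv i f (c *: x + v).
Proof.
move=> df; transitivity ('D_(c *: delta_mx ord0 i) f (c *: x + v)).
  rewrite /pderiv /derive.
  suff -> : (fun t : R => t^-1 *: (((fun x : rn => f (c *: x + v)) \o shift x) (t *: delta_mx ord0 i)
      - f (c *: x + v))) = (fun t : R => t^-1 *: ((f \o shift (c *: x + v))
      (t *: (c *: delta_mx ord0 i)) - f (c *: x + v))) by [].
  apply/funext => t /=; congr (_ *: (f _ - _)).
  by rewrite scalerDr !scalerA mulrC addrA.
by rewrite deriveE// linearZ /pderiv deriveE.
Qed.

Lemma schwartz_affine (c : R) v f : c != 0 -> schwartz f -> schwartz (fun x => f (c *: x + v)).
Proof.
move=> c0 sf.
suff H : forall w : rn -> R, (exists2 u, schwartz u & w = (fun x => u (c *: x + v))) -> schwartz w.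
  by apply: H; exists f.
apply: schwartz_coind => [_ [u su ->]|_ i [u su ->]].
  split; first by move=> x; apply: differentiable_affine => y; exact: schwartz_diff.
  move=> k; have [M uM] := schwartz_decay su k.
  exists (((1 + `|c^-1|) * (1 + `|v|)) ^+ k * M) => x.
  apply: le_trans (ler_wpM2l _ (uM (c *: x + v))); last first.
    by rewrite exprn_ge0// mulr_ge0// addr_ge0.
  rewrite mulrA -exprMn ler_wpM2r// lerXn2r ?nnegrE ?mulr_ge0 ?addr_ge0//.
  rewrite -[X in 1 + `|X| <= _](scalerK c0) -[X in `|_^-1 *: X|](addrK v).
  apply: (le_trans (wnum_scale _ _)); rewrite -mulrA ler_wpM2l ?addr_ge0//.
  by apply: (le_trans (wnum_add _ _)); rewrite normrN mulrC.
exists (fun x => c * pderiv i u x); first exact/schwartzZ/schwartz_pderiv.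
apply/funext => x; by rewrite pderiv_affine// => y; exact: schwartz_diff.
Qed.

End schwartz_space.

Section schwartz_more.
Context {R : realType} (n : nat).
Local Notation rn := 'rV[R]_n.
Local Notation mu := (@lebesgue_rV R n).
Implicit Types (f g phi : rn -> R) (x : rn).
Local Notation eb := (@ebase R n).

Lemma pderivs_affine l (c : R) v phi : schwartz phi ->
  pderivs l (fun x => phi (c *: x + v)) = (fun x => c ^+ size l * pderivs l phi (c *: x + v)).
Proof.
move=> sphi; elim: l => [|i l IH] /=.
  by apply/funext => x; rewrite expr0 mul1r.
rewrite IH; apply/funext => x; have sl := schwartz_pderivs l sphi.
transitivity (c ^+ size l * pderiv i (fun x => pderivs l phi (c *: x + v)) x).
  have := @pderiv_lin R n i (c ^+ size l) (fun x => pderivs l phi (c *: x + v)) (fun _ => 0) x.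
  rewrite pderiv_cst addr0 => <-//.
  - by congr (pderiv i _ x); apply/funext => z; rewrite addr0.
  - by apply: differentiable_affine => y; exact: schwartz_diff.
by rewrite pderiv_affine ?exprSr ?mulrA// => y; exact: schwartz_diff.
Qed.

Lemma schwartz_intg phi : schwartz phi -> intg mu phi.
Proof.
move=> sphi; have := decay_intg 0 (schwartz_measurable sphi) (schwartz_decay sphi).
by apply: intg_eq => x; rewrite expr0 mul1r.
Qed.

Lemma schwartz_bounded phi : schwartz phi -> exists M, forall x, `|phi x| <= M.
Proof. by move=> /schwartz_decay/(_ 0%N)[M H]; exists M => x; exact: decw_bound H. Qed.

Section family.
Context d {Y : measurableType d} (nu : {measure set Y -> \bar R}).
Variable Phi : Y -> rn -> R.
Hypothesis sPhi : forall y, schwartz (Phi y).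
Hypothesis mPhi : forall l x, measurable_fun setT (fun y => pderivs l (Phi y) x).
Hypothesis bPhi : forall l k, exists2 b, intg nu b &
  forall x y, (1 + `|x|) ^+ k * `|pderivs l (Phi y) x| <= b y.

Lemma intg_family l x : intg nu (fun y => pderivs l (Phi y) x).
Proof.
have [b bi H] := bPhi l 0; apply: intg_le bi _; first exact: mPhi.
by move=> y; have := H x y; rewrite expr0 mul1r.
Qed.

Let F l x := \int[nu]_y pderivs l (Phi y) x.

(** Differentiation under the integral. The Taylor remainder of each [Phi y] is at most [|h|^2]
    times a bound on its second derivatives, and the sum of the given majorants is one integrable
    bound for all pairs of indices. *)
Lemma family_diff l x : differentiable (F l) x /\ (forall i, pderiv i (F l) x = F (i :: l) x).
Proof.
have [b bi bH] : exists2 b, intg nu b &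
    forall i j x y, `|pderiv i (pderiv j (pderivs l (Phi y))) x| <= b y.
  have B i j := bPhi (i :: j :: l) 0.
  exists (fun y => \sum_i \sum_j `|projT1 (cid2 (B i j)) y|).
    apply: intg_sum => i _; apply: intg_sum => j _; apply: intg_norm.
    by case: (cid2 (B i j)).
  move=> i j z y; have H0 k m : 0 <= `|projT1 (cid2 (B k m)) y| by [].
  have S (c : 'I_n -> 'I_n -> R) : (forall i j, 0 <= c i j) -> c i j <= \sum_i \sum_j c i j.
    move=> c0; rewrite (bigD1 i)//= (bigD1 j)//= -addrA lerDl.
    by apply: addr_ge0; apply: sumr_ge0 => k _ //; exact: sumr_ge0.
  apply: (le_trans _ (S (fun i j => `|projT1 (cid2 (B i j)) y|) H0)).
  case: (cid2 (B i j)) => b0 _ /(_ z y)/=; rewrite expr0 mul1r => /le_trans; apply.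
  exact: ler_norm.
apply: (@differentiable_quad _ _ _ _ _ (n%:R * n%:R * \int[nu]_y b y)) => h _.
have il l' z := intg_family l' z.
have E : F l (x + h) - F l x - lincomb (fun i => F (i :: l) x) h =
    \int[nu]_y (pderivs l (Phi y) (x + h) - pderivs l (Phi y) x - lincomb (grad (pderivs l (Phi y)) x) h).
  rewrite RintegralB//; last 2 first.
  - exact: intgB.
  - by apply: intg_sum => i _; apply: intgZl; exact: (il (i :: l)).
  congr (_ - _).
    by rewrite /F RintegralB//; exact: il.
  have /= -> := @Rint_sum _ _ _ nu _ (index_enum 'I_n) xpredT
    (fun i y => h ord0 i * pderivs (i :: l) (Phi y) x) (fun i _ => intgZl _ (il (i :: l) x)).
  by apply: eq_bigr => i _; rewrite RintegralZl//; exact: (il (i :: l)).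
rewrite E -!mulrA [_ * `|h| ^+ 2]mulrC !mulrA.
apply: Rint_norm_le_bound => //.
  by apply: intgB; [exact: intgB|apply: intg_sum => i _; apply: intgZl; exact: (il (i :: l))].
move=> y; have := @taylor2_rV R n (pderivs l (Phi y)) x h (b y).
have -> : n%:R * n%:R * `|h| * `|h| * b y = n%:R * n%:R * b y * `|h| ^+ 2 by ring.
apply.
- by move=> z; apply: schwartz_diff; exact: schwartz_pderivs.
- by move=> i z; apply: schwartz_diff; apply: schwartz_pderiv; exact: schwartz_pderivs.
- by move=> i j t _; exact: bH.
Qed.

Lemma pderivs_family l : pderivs l (fun x => \int[nu]_y Phi y x) = F l.
Proof.
elim: l => // i l /= ->; apply/funext => x; by have [_ ->] := family_diff l x.
Qed.

(** Serves twice: with Lebesgue measure for convolutions, and with the counting measure for series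
    of Schwartz functions. *)
Lemma schwartz_family : schwartz (fun x => \int[nu]_y Phi y x).
Proof.
apply/schwartzP => l; rewrite pderivs_family; split; first by move=> x; have [] := family_diff l x.
move=> k; have [b bi bH] := bPhi l k; exists (\int[nu]_y b y) => x.
rewrite -[X in X * _]ger0_norm ?exprn_ge0 ?addr_ge0// -normrM /F -RintegralZl//; last exact: intg_family.
apply: Rint_norm_le => //; first exact/intgZl/intg_family.
by move=> y; rewrite normrM ger0_norm ?exprn_ge0 ?addr_ge0.
Qed.

End family.

Lemma lincomb_ebase (g : 'I_n -> R) i : lincomb g (eb i) = g i.
Proof.
rewrite /lincomb (bigD1 i)//= big1 ?addr0; first by rewrite mxE !eqxx mul1r.
by move=> j ji; rewrite mxE (negPf ji) andbF mul0r.
Qed.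

Section ibp.
Variables (F : rn -> R) (i : 'I_n) (M : R).
Hypothesis dF : forall x, differentiable F x.
Hypothesis FM : decw (2 * n) M F.
Hypothesis DFM : decw (2 * n) M (pderiv i F).

Let q (m : nat) x := m.+1%:R * (F (x + m.+1%:R^-1 *: eb i) - F x).

Let q_cvg x : q ^~ x @ \oo --> pderiv i F x.
Proof.
have /cvg_ex[/= l Hl] : derivable F x (eb i) by exact: diff_derivable.
have -> : pderiv i F x = l by exact: cvg_lim Hl.
have H : (fun m : nat => m.+1%:R^-1 : R) @ \oo --> 0^'.
  move=> A; rewrite /dnbhs/within/= => /nbhs_ballP[e/= e0 eA].
  have : \forall m \near \oo, m.+1%:R^-1 < e := near_infty_natSinv_lt (PosNum e0).
  apply: filterS => m me; apply: eA; last by rewrite gt_eqF// invr_gt0.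
  by rewrite -ball_normE/= sub0r normrN gtr0_norm ?invr_gt0.
have := cvg_comp _ _ H Hl; apply: cvg_trans; apply: near_eq_cvg; near=> m.
by rewrite /q /= invrK [_ + x]addrC.
Unshelve. all: by end_near. Qed.

Let mF : measurable_fun setT F.
Proof. by apply: continuous_measurable_rV => x; apply: differentiable_continuous. Qed.

Let mq m : measurable_fun setT (q m).
Proof.
apply: measurable_funM => //; apply: measurable_funB => //.
have := measurableT_comp mF (@measurable_affine R n 1 (m.+1%:R^-1 *: eb i)).
by apply: eq_measurable_fun => x _ /=; rewrite scale1r.
Qed.

Lemma measurable_pderiv : measurable_fun setT (pderiv i F).
Proof. by apply: (@measurable_fun_cvg _ _ _ _ q) => // x _; exact: q_cvg. Qed.

Lemma norm_ebase_le : `|eb i| <= 1 :> R.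
Proof.
apply/rV_normP => // j; rewrite mxE eqxx /=.
by case: (_ == _); rewrite ?normr1 ?normr0.
Qed.

(** Difference quotients have integral zero by translation invariance, and they converge to the
    derivative under domination. The factor [2 ^+ (2 * n)] comes from the mean value theorem and
    [1 + |x| <= 2 (1 + |x + c e_i|)] for [|c| <= 1]. *)
Lemma Rint_pderiv0 : \int[mu]_x pderiv i F x = 0.
Proof.
have iF : intg mu F.
  by apply: intg_le (intgZl M (@intg_wt R n _ (leqnn _))) _ => //; apply/decwP.
have [|iD cv] := Rint_cvg q (pderiv i F) (fun x => M * 2 ^+ (2 * n) * wt (2 * n) x) mq measurable_pderiv
  (intgZl _ (@intg_wt R n _ (leqnn _))) _ q_cvg.
  move=> m x; have m0 : (0 : R) < m.+1%:R by [].
  have [c] := MVT_two_sided 0 (m.+1%:R^-1) (is_derive_line x (eb i) dF).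
  rewrite !subr0 scale0r addr0 [`|_^-1|]gtr0_norm ?invr_gt0// => c1 E.
  rewrite /q E mulrCA divff ?mulr1 ?lt0r_neq0//.
  have -> : lincomb (grad F (x + c *: eb i)) (eb i) = pderiv i F (x + c *: eb i).
    by rewrite lincomb_ebase.
  have /decwP/(_ (x + c *: eb i)) := DFM => /le_trans; apply.
  rewrite -mulrA ler_wpM2l ?(decw_ge0 DFM)// /wt ler_pdivlMr ?wnumX_gt0//.
  rewrite mulrC ler_pdivrMr ?wnumX_gt0// -exprMn lerXn2r ?nnegrE ?mulr_ge0 ?addr_ge0//.
  rewrite -{1}(addrK (c *: eb i) x) (le_trans (wnum_add _ _))// mulrC ler_wpM2r ?addr_ge0//.
  rewrite normrN normrZ (_ : 2 = 1 + 1 :> R)// lerD2l.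
  apply: mulr_ile1 => //; last exact: norm_ebase_le.
  by rewrite (le_trans c1)// invf_le1// ler1n.
have q0 m : \int[mu]_x q m x = 0.
  have iFs := intg_shift (m.+1%:R^-1 *: eb i) iF.
  by rewrite /q RintegralZl//; [rewrite RintegralB// Rint_shift// subrr mulr0|exact: intgB].
move: cv; under eq_fun do rewrite q0; move=> cv.
by have := cvg_lim (@Rhausdorff R) cv; rewrite lim_cst// => <-.
Qed.

End ibp.

(** Only boundedness is asked of [g] and its derivative, so that [g] can be a Fourier phase as well
    as a translated test function. *)
Lemma Rint_by_parts i f g (N : R) : schwartz f -> (forall x, differentiable g x) ->
  (forall x, `|g x| <= N) -> (forall x, `|pderiv i g x| <= N) ->
  measurable_fun setT (pderiv i g) /\
  \int[mu]_x (pderiv i f x * g x) = - \int[mu]_x (f x * pderiv i g x).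
Proof.
move=> sf dg gN dgN.
have [M fM] := schwartz_decay sf (2 * n).
have [M' fM'] := schwartz_decay (schwartz_pderiv i sf) (2 * n).
have N0 : 0 <= N by exact: le_trans (gN 0).
have E x : pderiv i (fun x => f x * g x) x = f x * pderiv i g x + g x * pderiv i f x.
  by rewrite pderivM//; exact: schwartz_diff.
have bnd u v K : decw (2 * n) K u -> (forall x, `|v x| <= N) -> decw (2 * n) (K * N) (fun x => u x * v x).
  move=> uK vN x; rewrite normrM mulrA ler_pM// mulr_ge0// exprn_ge0//.
have fg : decw (2 * n) ((M + M') * N) (fun x => f x * g x).
  by apply: bnd gN => x; apply: le_trans (fM x) _; rewrite lerDl (decw_ge0 fM').
have dg' : decw (2 * n) ((M + M') * N) (pderiv i (fun x => f x * g x)).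
  rewrite (funext E) mulrDl; apply: decwD; first exact: bnd.
  rewrite (_ : (fun x => g x * pderiv i f x) = (fun x => pderiv i f x * g x)); first exact: bnd.
  by apply/funext => x; rewrite mulrC.
have dfg x : differentiable (fun x => f x * g x) x.
  by apply: (@differentiableM _ _ f g) => //; exact: schwartz_diff.
have mdg : measurable_fun setT (pderiv i g) by apply: measurable_pderiv.
have mg : measurable_fun setT g by apply: continuous_measurable_rV => x; apply: differentiable_continuous.
split => //; have := Rint_pderiv0 dfg fg dg'; rewrite (funext E).
have i1 : intg mu (fun x => f x * pderiv i g x) by apply: intg_mul_bounded dgN => //; exact: schwartz_intg.
have i2 : intg mu (fun x => pderiv i f x * g x).
  by apply: intg_mul_bounded gN => //; apply: schwartz_intg; exact: schwartz_pderiv.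
under eq_Rintegral do rewrite [g _ * _]mulrC.
by rewrite RintegralD// addrC => /eqP; rewrite addr_eq0 => /eqP.
Qed.

End schwartz_more.

(** * Convolution with dilated kernels *)

Section convolution.
Context {R : realType} (n : nat).
Local Notation rn := 'rV[R]_n.
Local Notation mu := (@lebesgue_rV R n).
Local Notation eb := (@ebase R n).
Implicit Types (f g phi : rn -> R) (x : rn).

Definition kern (k : rn -> R) := measurable_fun setT k /\ decay k.

(* Convolution of phi with the kernel s^-n k(./s), in a form that also makes sense for s = 0. *)
Definition cv (s : R) (k phi : rn -> R) : rn -> R := fun x => \int[mu]_y (k y * phi (x - s *: y)).

Lemma kern_schwartz k : schwartz k -> kern k.
Proof. by move=> sk; split; [exact: schwartz_measurable|exact: schwartz_decay]. Qed.

Lemma kern_coord j k : kern k -> kern (fun y => y ord0 j * k y).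
Proof.
move=> [mk dk]; split; last exact: decay_coord.
by apply: measurable_funM => //; exact: measurable_coor.
Qed.

Lemma measurable_translate (s : R) x phi : measurable_fun setT phi ->
  measurable_fun setT (fun y : rn => phi (x - s *: y)).
Proof.
move=> mphi; have := measurableT_comp mphi (@measurable_affine R n (- s) x).
by apply: eq_measurable_fun => y _ /=; rewrite scaleNr addrC.
Qed.

Lemma wnum_translate (s : R) x (y : rn) (m : nat) :
  (1 + `|x|) ^+ m <= ((1 + `|s|) * (1 + `|y|)) ^+ m * (1 + `|x - s *: y|) ^+ m.
Proof.
rewrite -exprMn lerXn2r ?nnegrE ?mulr_ge0 ?addr_ge0//.
rewrite -{1}(subrK (s *: y) x) mulrC (le_trans (wnum_add _ _))//.
by rewrite ler_wpM2l ?addr_ge0// wnum_scale.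
Qed.

Lemma intg_kern m k : kern k -> intg mu (fun y => (1 + `|y|) ^+ m * `|k y|).
Proof.
move=> [mk dk]; apply: intg_eq (intg_norm (decay_intg m mk dk)) => y.
by rewrite normrM ger0_norm ?exprn_ge0 ?addr_ge0.
Qed.

Lemma kern_intg k : kern k -> intg mu k.
Proof.
move=> [mk dk]; have := decay_intg 0 mk dk.
by apply: intg_eq => x; rewrite expr0 mul1r.
Qed.

Lemma intg_cv s k phi x : kern k -> measurable_fun setT phi -> (exists M, forall x, `|phi x| <= M) ->
  intg mu (fun y => k y * phi (x - s *: y)).
Proof.
move=> kk mphi [M phiM]; apply: (intg_mul_bounded (M := M)) => //.
- exact: kern_intg.
- exact: measurable_translate.
Qed.

Lemma cv_decw (s : R) k phi m (M : R) : kern k -> measurable_fun setT phi -> decw m M phi ->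
  decw m ((1 + `|s|) ^+ m * M * \int[mu]_y ((1 + `|y|) ^+ m * `|k y|)) (cv s k phi).
Proof.
move=> kk mphi phiM x.
have ic : intg mu (fun y => k y * phi (x - s *: y)).
  by apply: intg_cv => //; exists M => z; exact: decw_bound phiM.
rewrite -[X in X * _]ger0_norm ?exprn_ge0 ?addr_ge0// -normrM /cv -RintegralZl//.
apply: Rint_norm_le_bound; [exact: intgZl|exact: intg_kern|].
move=> y; rewrite !normrM [`|_ ^+ m|]ger0_norm ?exprn_ge0 ?addr_ge0//.
apply: (@le_trans _ _ (((1 + `|s|) * (1 + `|y|)) ^+ m * (1 + `|x - s *: y|) ^+ m * (`|k y| * `|phi (x - s *: y)|))).
  by rewrite ler_wpM2r ?mulr_ge0// wnum_translate.
rewrite exprMn; set A := (1 + `|s|) ^+ m; set B := (1 + `|y|) ^+ m; set C := (1 + `|x - _|) ^+ m.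
have -> : A * B * C * (`|k y| * `|phi (x - s *: y)|) =
  A * (C * `|phi (x - s *: y)|) * (B * `|k y|) by ring.
rewrite ler_wpM2r ?mulr_ge0 ?exprn_ge0 ?addr_ge0// ler_wpM2l ?exprn_ge0 ?addr_ge0//.
exact: phiM.
Qed.

Section cv_schwartz.
Variables (s : R) (k phi : rn -> R).
Hypotheses (kk : kern k) (sphi : schwartz phi).

Let Phi (y : rn) (x : rn) : R := k y * phi (x - s *: y).

Let PhiE y l : pderivs l (Phi y) = (fun x => k y * pderivs l phi (x - s *: y)).
Proof.
have st : schwartz (fun x : rn => phi (x - s *: y)).
  have := schwartz_affine (- (s *: y)) (oner_neq0 R) sphi.
  by apply: schwartz_ext => x; rewrite scale1r.
rewrite /Phi pderivsZ//; apply/funext => x; congr (_ * _).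
have := pderivs_affine l 1 (- (s *: y)) sphi.
rewrite (_ : (fun x : rn => phi (1 *: x - s *: y)) = (fun x => phi (x - s *: y))).
  by move=> ->; rewrite expr1n mul1r scale1r.
by apply/funext => z; rewrite scale1r.
Qed.

Let sPhi y : schwartz (Phi y).
Proof.
apply: schwartzZ; have := schwartz_affine (- (s *: y)) (oner_neq0 R) sphi.
by apply: schwartz_ext => x; rewrite scale1r.
Qed.

Let mPhi l x : measurable_fun setT (fun y => pderivs l (Phi y) x).
Proof.
under eq_fun do rewrite PhiE.
apply: measurable_funM; first by case: kk.
by apply: measurable_translate; apply: schwartz_measurable; exact: schwartz_pderivs.
Qed.

Let bPhi l m : exists2 b, intg mu b &
  forall x y, (1 + `|x|) ^+ m * `|pderivs l (Phi y) x| <= b y.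
Proof.
have [M HM] := schwartz_decay (schwartz_pderivs l sphi) m.
exists (fun y => (1 + `|s|) ^+ m * M * ((1 + `|y|) ^+ m * `|k y|)).
  by apply: intgZl; exact: intg_kern.
move=> x y; rewrite PhiE normrM.
apply: (@le_trans _ _ (((1 + `|s|) * (1 + `|y|)) ^+ m * (1 + `|x - s *: y|) ^+ m * (`|k y| * `|pderivs l phi (x - s *: y)|))).
  by rewrite ler_wpM2r ?mulr_ge0// wnum_translate.
rewrite exprMn; set A := (1 + `|s|) ^+ m; set B := (1 + `|y|) ^+ m; set C := (1 + `|x - _|) ^+ m.
have -> : A * B * C * (`|k y| * `|pderivs l phi (x - s *: y)|) =
  A * (C * `|pderivs l phi (x - s *: y)|) * (B * `|k y|) by ring.
rewrite ler_wpM2r ?mulr_ge0 ?exprn_ge0 ?addr_ge0// ler_wpM2l ?exprn_ge0 ?addr_ge0//.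
exact: HM.
Qed.

Lemma schwartz_cv : schwartz (cv s k phi).
Proof. exact: (schwartz_family sPhi mPhi bPhi). Qed.

Lemma pderivs_cv l : pderivs l (cv s k phi) = cv s k (pderivs l phi).
Proof.
rewrite /cv [LHS](pderivs_family sPhi mPhi bPhi); apply/funext => x.
by apply: eq_Rintegral => y _; rewrite PhiE.
Qed.

End cv_schwartz.

Lemma cv_lin_l (s a : R) k k' f : kern k -> kern k' -> schwartz f ->
  cv s (fun y => a * k y + k' y) f = (fun x => a * cv s k f x + cv s k' f x).
Proof.
move=> kk kk' sf; apply/funext => x; rewrite /cv.
have i1 : intg mu (fun y => k y * f (x - s *: y)).
  by apply: intg_cv => //; [exact: schwartz_measurable|exact: schwartz_bounded].
have i2 : intg mu (fun y => k' y * f (x - s *: y)).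
  by apply: intg_cv => //; [exact: schwartz_measurable|exact: schwartz_bounded].
rewrite -RintegralZl// -RintegralD//; last exact: intgZl.
by apply: eq_Rintegral => y _; ring.
Qed.

(* The derivative of [cv s k phi] in s. *)
Definition dcv (s : R) (k phi : rn -> R) : rn -> R :=
  fun x => - \sum_i cv s (fun y => y ord0 i * k y) (pderiv i phi) x.

(** The remainder is bounded in a weighted norm, uniformly for [s] and [h] in a bounded range around
    0, because distributions that vary with time are going to be applied to it. *)
Lemma cv_taylor k phi m (S : R) : kern k -> schwartz phi -> exists C, forall s h,
  `|s| <= S -> `|h| <= S ->
  decw m (C * h ^+ 2) (fun x => cv (s + h) k phi x - cv s k phi x - h * dcv s k phi x).
Proof.
move=> kk sphi.
have [M HM] : exists M, forall i j, decw m M (pderiv i (pderiv j phi)).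
  have B i j : exists M, decw m M (pderiv i (pderiv j phi)).
    by apply: schwartz_decay; do 2 apply: schwartz_pderiv.
  exists (\sum_i \sum_j projT1 (cid (B i j))) => i j.
  have S0 (c : 'I_n -> 'I_n -> R) : (forall i j, 0 <= c i j) -> c i j <= \sum_i \sum_j c i j.
    move=> c0; rewrite (bigD1 i)//= (bigD1 j)//= -addrA lerDl.
    by apply: addr_ge0; apply: sumr_ge0 => ? _ //; exact: sumr_ge0.
  move=> x; apply: (le_trans _ (S0 (fun i j => projT1 (cid (B i j))) _)).
    by case: (cid (B i j)) => M' HM'; exact: (HM' x).
  by move=> i' j'; case: (cid (B i' j')) => M' HM'; exact: decw_ge0 HM'.
(* [1 + S + S] bounds [1 + |s + t h|]. Of the [2 + m] powers of [1 + |y|], two come from [|h y|^2]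
   and [m] from moving the weight from [x] to [x - (s + t h) y]. *)
pose D := n%:R * n%:R * M * (1 + S + S) ^+ m * \int[mu]_y ((1 + `|y|) ^+ (2 + m) * `|k y|).
exists D => s h sS h1 x.
have S0 : 0 <= S by exact: le_trans sS.
have M0 : 0 <= n%:R * n%:R * M.
  have [->|[i0 _]] : n = 0%N \/ exists i0 : 'I_n, True.
  - by case: (n) => [|n']; [left|right; exists ord0].
  - by rewrite !mul0r.
  - by rewrite mulr_ge0// (decw_ge0 (HM i0 i0)).
have sb f : schwartz f -> intg mu (fun y => k y * f (x - s *: y)).
  by move=> sf; apply: intg_cv => //; [exact: schwartz_measurable|exact: schwartz_bounded].
have sb' : intg mu (fun y => k y * phi (x - (s + h) *: y)).
  by apply: intg_cv => //; [exact: schwartz_measurable|exact: schwartz_bounded].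
have sc i : intg mu (fun y => y ord0 i * k y * pderiv i phi (x - s *: y)).
  apply: (@intg_cv s (fun y => y ord0 i * k y)); first exact: kern_coord.
    by apply: schwartz_measurable; exact: schwartz_pderiv.
  by apply: schwartz_bounded; exact: schwartz_pderiv.
have E : cv (s + h) k phi x - cv s k phi x - h * dcv s k phi x =
  \int[mu]_y (k y * (phi (x - s *: y + (- h) *: y) - phi (x - s *: y) - lincomb (grad phi (x - s *: y)) (- h *: y))).
  rewrite /dcv mulrN opprK /cv.
  rewrite -Rint_sum// -RintegralZl//; last exact: intg_sum.
  rewrite -RintegralB//; last exact: sb.
  rewrite -RintegralD//; [|by apply: intgB => //; exact: sb|by apply: intgZl; exact: intg_sum].
  apply: eq_Rintegral => y _; rewrite scalerDl opprD addrA scaleNr.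
  rewrite !mulrBr; congr (_ + _).
  rewrite /lincomb -mulrN -sumrN !mulr_sumr; apply: eq_bigr => i _.
  by rewrite !mxE /grad; ring.
have iE : intg mu (fun y => k y * (phi (x - s *: y + (- h) *: y) - phi (x - s *: y) - lincomb (grad phi (x - s *: y)) (- h *: y))).
  have -> : (fun y => k y * (phi (x - s *: y + (- h) *: y) - phi (x - s *: y) - lincomb (grad phi (x - s *: y)) (- h *: y)))
    = (fun y => (k y * phi (x - (s + h) *: y) - k y * phi (x - s *: y)) +
         h * \sum_i (y ord0 i * k y * pderiv i phi (x - s *: y))).
    apply/funext => y; rewrite scalerDl opprD addrA scaleNr !mulrBr; congr (_ + _).
    rewrite /lincomb -mulrN -sumrN !mulr_sumr; apply: eq_bigr => i _.
    by rewrite !mxE /grad; ring.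
  apply: intgD; first by apply: intgB => //; exact: sb.
  by apply: intgZl; exact: intg_sum.
rewrite E -[X in X * _]ger0_norm ?exprn_ge0 ?addr_ge0// -normrM -RintegralZl//.
rewrite /D -!mulrA [_ * h ^+ 2]mulrC !mulrA.
apply: Rint_norm_le_bound; [exact: intgZl|exact: intg_kern|].
move=> y; rewrite !normrM [`|_ ^+ m|]ger0_norm ?exprn_ge0 ?addr_ge0//.
have := @taylor2_rV R n phi (x - s *: y) (- h *: y) (M * ((1 + S + S) * (1 + `|y|)) ^+ m * wt m x).
set T := `|_ - _ - _| => H.
apply: (@le_trans _ _ ((1 + `|x|) ^+ m * (`|k y| * (n%:R * n%:R * (M * ((1 + S + S) * (1 + `|y|)) ^+ m * wt m x) * `|- h *: y| ^+ 2)))).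
  rewrite ler_wpM2l ?exprn_ge0 ?addr_ge0// ler_wpM2l// H//.
  - by move=> z; exact: schwartz_diff.
  - by move=> i z; apply: schwartz_diff; exact: schwartz_pderiv.
  move=> i j t t1; have := HM i j (x - s *: y + t *: (- h *: y)).
  have -> : x - s *: y + t *: (- h *: y) = x - (s + t * h) *: y.
    by rewrite scalerDl opprD addrA scalerA mulrN scaleNr.
  move=> {}H; rewrite /wt ler_pdivlMr ?wnumX_gt0// mulrC.
  apply: (le_trans (ler_wpM2r _ (wnum_translate (s + t * h) x y m))) => //.
  rewrite -mulrA mulrC [X in _ <= X]mulrC.
  rewrite [X in _ <= X]mulrC; apply: ler_pM => //.
  rewrite lerXn2r ?nnegrE ?mulr_ge0 ?addr_ge0// ler_wpM2r ?addr_ge0//.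
  have : `|s + t * h| <= `|s| + `|t| * `|h| by rewrite -normrM ler_normD.
  have : `|t| * `|h| <= S by apply: le_trans h1; rewrite ler_piMl.
  by move: sS; lra.
have -> : (1 + `|x|) ^+ m * (`|k y| * (n%:R * n%:R * (M * ((1 + S + S) * (1 + `|y|)) ^+ m * wt m x) * `|- h *: y| ^+ 2)) =
   (wt m x * (1 + `|x|) ^+ m) * (n%:R * n%:R * M * (1 + S + S) ^+ m * h ^+ 2 * (`|y| ^+ 2 * (1 + `|y|) ^+ m * `|k y|)).
  by rewrite normrZ normrN !exprMn real_normK ?num_real//; ring.
rewrite wtE mul1r; have -> : n%:R * n%:R * M * (1 + S + S) ^+ m * h * h * ((1 + `|y|) ^+ (2 + m) * `|k y|) =
  n%:R * n%:R * M * (1 + S + S) ^+ m * h ^+ 2 * ((1 + `|y|) ^+ (2 + m) * `|k y|) by ring.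
rewrite ler_wpM2l//.
  by rewrite mulr_ge0 ?sqr_ge0// mulr_ge0// exprn_ge0// !addr_ge0//.
rewrite ler_wpM2r// exprD ler_wpM2r ?exprn_ge0 ?addr_ge0//.
by rewrite lerXn2r ?nnegrE ?addr_ge0// lerDr.
Qed.

Lemma schwartz_dcv s k phi : kern k -> schwartz phi -> schwartz (dcv s k phi).
Proof.
move=> kk sphi; apply: schwartzN.
elim: (index_enum _) => [|i l IH].
  by apply: schwartz_ext (@schwartz0 R n) => x; rewrite big_nil.
apply: schwartz_ext (schwartzD (schwartz_cv s (kern_coord i kk) (schwartz_pderiv i sphi)) IH) => x.
by rewrite big_cons.
Qed.

(** The inner variable is [x - s y], so each derivative moved from the kernel to the function costs
    a factor [s]. At [s = 0] this says that a derivative of the kernel has integral zero. *)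
Lemma pderiv_ibp_cv s i k phi : schwartz k -> schwartz phi ->
  cv s (pderiv i k) phi = (fun x => s * cv s k (pderiv i phi) x).
Proof.
move=> sk sphi; apply/funext => x; rewrite /cv.
have [N1 H1] := schwartz_bounded sphi.
have [N2 H2] := schwartz_bounded (schwartz_pderiv i sphi).
have dphi z : differentiable phi z by exact: schwartz_diff.
have e : (fun y => phi (x - s *: y)) = (fun y => phi (- s *: y + x)).
  by apply/funext => y; rewrite scaleNr addrC.
have e' y : pderiv i (fun y => phi (x - s *: y)) y = - s * pderiv i phi (x - s *: y).
  by rewrite e pderiv_affine// scaleNr addrC.
have [|||_ ->] := @Rint_by_parts R n i k (fun y => phi (x - s *: y)) (N1 + `|s| * N2) sk.
- by move=> y; rewrite e; exact: differentiable_affine.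
- by move=> y; apply: (le_trans (H1 _)); rewrite lerDl mulr_ge0// (le_trans _ (H2 0)).
- move=> y; rewrite e' normrM normrN; apply: (@le_trans _ _ (`|s| * N2)).
    by rewrite ler_wpM2l.
  by rewrite lerDr (le_trans _ (H1 0)).
rewrite -RintegralZl//; last first.
  apply: intg_cv; first exact: kern_schwartz.
    by apply: schwartz_measurable; exact: schwartz_pderiv.
  by apply: schwartz_bounded; exact: schwartz_pderiv.
rewrite -RintN.
  by apply: eq_Rintegral => y _; rewrite e'; ring.
have := intgZl (- s) (@intg_cv s k (pderiv i phi) x (kern_schwartz sk) _ _).
move=> H; apply: intg_eq (H _ _) => [y||].
- by rewrite e'; ring.
- by apply: schwartz_measurable; exact: schwartz_pderiv.
- by apply: schwartz_bounded; exact: schwartz_pderiv.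
Qed.

End convolution.

(** * Tempered distributions *)

Section tempered_distributions.
Context {R : realType} (n : nat).
Local Notation rn := 'rV[R]_n.
Implicit Types (f g phi : rn -> R) (T : (rn -> R) -> R).

Definition schwartz_le (N k : nat) (M : R) phi :=
  forall l : seq 'I_n, (size l <= N)%N -> decw k M (pderivs l phi).

(** Lists of bounded length over ['I_n] are finite in number, so their bounds have a common upper
    bound. *)
Lemma uniform_bound (P : seq 'I_n -> R -> Prop) :
  (forall l M M', M <= M' -> P l M -> P l M') -> (forall l, exists M, P l M) ->
  forall N, exists M, forall l, (size l <= N)%N -> P l M.
Proof.
move=> Pmono Pex N; elim: N P Pmono Pex => [|N IH] P Pmono Pex.
  by have [M PM] := Pex [::]; exists M => -[].
have [M0 PM0] := Pex [::].
have [||M PM] := IH (fun l M => forall i, P (i :: l) M).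
- by move=> l M M' MM' PM i; exact: Pmono (PM i).
- move=> l; exists (\sum_i `|projT1 (cid (Pex (i :: l)))|) => i.
  apply: (Pmono _ (projT1 (cid (Pex (i :: l))))); last exact: (projT2 (cid (Pex (i :: l)))).
  by rewrite (bigD1 i)//= (le_trans (ler_norm _))// lerDl sumr_ge0.
exists (Num.max M0 M) => -[_|i l lN].
  by apply: Pmono PM0; rewrite le_max lexx.
by apply: Pmono (PM l _ i) => //; rewrite le_max lexx orbT.
Qed.

Lemma temp_lin T (a : R) f g : tempered T -> schwartz f -> schwartz g ->
  T (fun x => a * f x + g x) = a * T f + T g.
Proof. by move=> [TL _]; exact: TL. Qed.

Lemma temp0 T : tempered T -> T (fun _ => 0) = 0.
Proof.
move=> tT; have := temp_lin 1 tT (@schwartz0 R n) (@schwartz0 R n).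
rewrite (_ : (fun x : rn => 1 * 0 + 0) = (fun _ => 0 : R)); last by apply/funext => x; rewrite mulr0 addr0.
by rewrite mul1r => /eqP; rewrite -subr_eq subrr eq_sym => /eqP.
Qed.

Lemma tempZ T (a : R) f : tempered T -> schwartz f -> T (fun x => a * f x) = a * T f.
Proof.
move=> tT sf; rewrite -[RHS]addr0 -(temp0 tT) -temp_lin//; last exact: schwartz0.
by congr T; apply/funext => x; rewrite addr0.
Qed.

Lemma tempD T f g : tempered T -> schwartz f -> schwartz g ->
  T (fun x => f x + g x) = T f + T g.
Proof.
move=> tT sf sg; rewrite -[T f]mul1r -temp_lin//.
by congr T; apply/funext => x; rewrite mul1r.
Qed.

Lemma tempN T f : tempered T -> schwartz f -> T (fun x => - f x) = - T f.
Proof.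
move=> tT sf; rewrite -mulN1r -tempZ//.
by congr T; apply/funext => x; rewrite mulN1r.
Qed.

Lemma schwartz_sum (I : Type) (r : seq I) (F : I -> rn -> R) :
  (forall i, schwartz (F i)) -> schwartz (fun x => \sum_(i <- r) F i x).
Proof.
move=> sF; elim: r => [|i r IH].
  by apply: schwartz_ext (@schwartz0 R n) => x; rewrite big_nil.
by apply: schwartz_ext (schwartzD (sF i) IH) => x; rewrite big_cons.
Qed.

(** Rewrites continuity with the sup-norm weight [1 + |x|], at the cost of a power of [1 + n]. *)
Lemma temp_bound T : tempered T -> exists N k C, 0 <= C /\
  forall phi M, schwartz phi -> schwartz_le N k M phi -> `|T phi| <= C * M.
Proof.
move=> [_ [N [k [C H]]]]; exists N, k, (`|C| * (1 + n%:R) ^+ k).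
split; first by rewrite mulr_ge0// exprn_ge0// addr_ge0.
move=> phi M sphi HM; have M0 : 0 <= M by exact: decw_ge0 (HM [::] isT).
rewrite -mulrA; apply: (@le_trans _ _ (C * ((1 + n%:R) ^+ k * M))); last first.
  by rewrite ler_wpM2r ?ler_norm// mulr_ge0// exprn_ge0// addr_ge0.
apply: H => // l lN x.
apply: (le_trans (ler_wpM2r _ (wenorm_le x k))) => //.
by rewrite -mulrA ler_wpM2l ?exprn_ge0 ?addr_ge0//; exact: HM.
Qed.

(** A bounded subset of the Schwartz space, given as an indexed family. *)
Definition unif_schwartz (S : Type) (Phi : S -> rn -> R) :=
  (forall s, schwartz (Phi s)) /\
  (forall l k, exists M, forall s, decw k M (pderivs l (Phi s))).

Lemma unif_schwartz_le S (Phi : S -> rn -> R) N k : unif_schwartz Phi ->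
  exists M, forall s, schwartz_le N k M (Phi s).
Proof.
move=> [_ H].
have [||M HM] := @uniform_bound (fun l M => forall s, decw k M (pderivs l (Phi s))) _ _ N.
- by move=> l M M' MM' HM s x; exact: le_trans (HM s x) MM'.
- by move=> l; exact: H.
by exists M => s l lN; exact: HM.
Qed.

Lemma unif_temp_bound S (Phi : S -> rn -> R) T : tempered T -> unif_schwartz Phi ->
  exists M, forall s, `|T (Phi s)| <= M.
Proof.
move=> tT uP; have [N [k [C [C0 H]]]] := temp_bound tT.
have [M HM] := unif_schwartz_le N k uP.
by exists (C * M) => s; apply: H; [case: uP|exact: HM].
Qed.

(** * Gliding hump and Banach-Steinhaus *)

Section gliding_hump.
Variable psi : nat -> rn -> R.
Hypothesis upsi : unif_schwartz psi.

(** Since [4^-i <= 2^-L 2^-i] for [i >= L], the tails of the series tend to 0 in every seminorm. The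
    weights after the [J]-th sum to only a third of it, which lets one term dominate. *)
Let w (i : nat) : R := 4%:R^-1 ^+ i.
Let dw (i : nat) : R := 2%:R^-1 ^+ i.

Let w_ge0 i : 0 <= w i. Proof. by rewrite exprn_ge0. Qed.

Let intg_dw : intg counting dw.
Proof.
apply/intg_ltyP => //; rewrite ge0_integral_count//.
apply: (@le_lt_trans _ _ (2%:E : \bar R)); last by rewrite ltry.
under eq_eseriesr => i _.
  rewrite ger0_norm ?exprn_ge0// (_ : dw i = 2 / (2 ^ i.+1)%:R); last first.
    by rewrite natrX exprS invfM mulrA mulfV// mul1r /dw exprVn.
  over.
exact: epsilon_trick0.
Qed.

Let tail (L : nat) x := \int[counting]_i ((L <= i)%N%:R * w i * psi i x).

Let Psi L (i : nat) x := (L <= i)%N%:R * w i * psi i x.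

Let sPsi L i : schwartz (Psi L i).
Proof. by apply: schwartzZ; case: upsi. Qed.

Let bPsi L l k M : (forall s, decw k M (pderivs l (psi s))) ->
  forall x i, (1 + `|x|) ^+ k * `|pderivs l (Psi L i) x| <= dw L * M * dw i.
Proof.
move=> HM x i; have M0 : 0 <= M by exact: decw_ge0 (HM 0%N).
rewrite pderivsZ; last by case: upsi.
case: (leqP L i) => Li; last first.
  by rewrite !mul0r normr0 mulr0 !mulr_ge0 ?exprn_ge0.
rewrite mul1r normrM ger0_norm// mulrCA.
apply: (@le_trans _ _ (w i * M)); first by rewrite ler_wpM2l//; exact: HM.
rewrite mulrAC ler_wpM2r// /w (_ : 4%:R^-1 = 2%:R^-1 * 2%:R^-1 :> R); last by field.
rewrite exprMn ler_wpM2r ?exprn_ge0//.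
by rewrite ler_wiXn2l ?invr_ge0 ?invf_le1// ler1n.
Qed.

Let mPsi L l x : measurable_fun setT (fun i => pderivs l (Psi L i) x).
Proof. by []. Qed.

Let bbPsi L l k : exists2 b, intg counting b &
  forall x i, (1 + `|x|) ^+ k * `|pderivs l (Psi L i) x| <= b i.
Proof.
have [M HM] := upsi.2 l k; exists (fun i => dw L * M * dw i); first exact: intgZl.
exact: bPsi.
Qed.

Lemma schwartz_tail L : schwartz (tail L).
Proof. exact: (schwartz_family (sPsi L) (mPsi L) (bbPsi L)). Qed.

Let tail_le L N k M : (forall s, schwartz_le N k M (psi s)) ->
  schwartz_le N k (dw L * M * \int[counting]_i dw i) (tail L).
Proof.
move=> HM l lN x; rewrite [pderivs l _](pderivs_family (sPsi L) (mPsi L) (bbPsi L)).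
have il := intg_family (mPsi L) (bbPsi L) l x.
rewrite -[X in X * _]ger0_norm ?exprn_ge0 ?addr_ge0// -normrM -[X in `|X|]RintegralZl//.
apply: Rint_norm_le_bound => //; first exact: intgZl.
move=> i; rewrite normrM [`|_ ^+ k|]ger0_norm ?exprn_ge0 ?addr_ge0//.
by apply: bPsi => s; exact: HM.
Qed.

Let tailS L x : tail L x = w L * psi L x + tail L.+1 x.
Proof.
have i0 L' : intg counting (fun i => Psi L' i x) := intg_family (mPsi L') (bbPsi L') [::] x.
have e : (fun i => Psi L i x) = (fun i => w L * psi L x * \1_[set L] i + Psi L.+1 i x).
  apply/funext => i; rewrite /Psi indicE; have [Li|Li|->] := ltngtP L i.
  - by rewrite memNset ?mulr0 ?add0r// => /= H; rewrite H ltnn in Li.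
  - by rewrite memNset ?mulr0 ?add0r// => /= H; rewrite H ltnn in Li.
  - by rewrite mem_set// mul1r mulr1 !mul0r addr0.
have i1 : intg counting (\1_[set L] : nat -> R).
  apply/intg_ltyP => //; under eq_integral do rewrite ger0_norm//.
  by rewrite integral_indic//= setIT /counting asboolT// ltry.
transitivity (\int[counting]_i (w L * psi L x * \1_[set L] i + Psi L.+1 i x)).
  by apply: eq_Rintegral => i _; exact: (congr1 (fun F => F i) e).
rewrite RintegralD; [|by []|exact: intgZl|exact: i0].
rewrite RintegralZl//; congr (_ + _).
rewrite /Rintegral integral_indic//= setIT /counting asboolT//=.
by rewrite fset_set1 finmap.cardfs1 mulr1.
Qed.

Variable T : (rn -> R) -> R.
Hypothesis tT : tempered T.

(** With [a = |T (psi J)|], the terms after the [J]-th contribute at most [2 a (w J) / 3]. A third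
    of the [J]-th term survives and is bounded by the whole series plus the partial sum, hence the
    factor 3. *)
Lemma hump (J : nat) (P : R) : `|\sum_(i < J) w i * T (psi i)| <= P ->
  (forall i, `|T (psi i)| <= 2 * `|T (psi J)|) ->
  w J * `|T (psi J)| <= 3 * (`|T (tail 0)| + P).
Proof.
move=> HP H2; have sp i : schwartz (psi i) by case: upsi.
have E L : T (tail L) = w L * T (psi L) + T (tail L.+1).
  by rewrite -tempZ// -tempD//; [congr T; apply/funext => x; rewrite tailS|exact: schwartzZ|exact: schwartz_tail].
have E0 L : T (tail 0) = \sum_(i < L) w i * T (psi i) + T (tail L).
  elim: L => [|L IH]; first by rewrite big_ord0 add0r.
  by rewrite IH E big_ord_recr/= addrA.
(* In this form the geometric bound on finite pieces of the tail telescopes. *)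
have wS L : w L = 4%:R / 3%:R * w L - 4%:R / 3%:R * w L.+1.
  by rewrite /w exprS; field.
set a := `|T (psi J)|.
have EJ m : `|T (tail J.+1) - T (tail (J.+1 + m)%N)| <= 2 * a * (4%:R / 3%:R * (w J.+1 - w (J.+1 + m)%N)).
  elim: m => [|m IH]; first by rewrite addn0 !subrr normr0 !mulr0.
  rewrite addnS.
  have -> : T (tail J.+1) - T (tail (J.+1 + m).+1) = (T (tail J.+1) - T (tail (J.+1 + m)%N)) +
     w (J.+1 + m)%N * T (psi (J.+1 + m)%N) by rewrite (E (J.+1 + m)%N); ring.
  apply: (le_trans (ler_normD _ _)).
  have -> : 2 * a * (4%:R / 3%:R * (w J.+1 - w (J.+1 + m).+1)) =
      2 * a * (4%:R / 3%:R * (w J.+1 - w (J.+1 + m)%N)) + w (J.+1 + m)%N * (2 * a).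
    by rewrite [in w (J.+1 + m)%N * _]wS; ring.
  by rewrite lerD// normrM ger0_norm// ler_wpM2l.
have [N [k [C [C0 HC]]]] := temp_bound tT.
have [M HM] := unif_schwartz_le N k upsi.
have M0 : 0 <= M by exact: decw_ge0 (HM 0%N [::] isT).
set I0 := \int[counting]_i dw i.
have I00 : 0 <= I0 by apply: Rintegral_ge0 => i _; rewrite exprn_ge0.
(* The bounds on finite pieces pass to the whole tail, because [T] is continuous and the later tails
   tend to 0 in the seminorm that controls [T]. *)
have EJ2 : `|T (tail J.+1)| <= 2 * a * (4%:R / 3%:R * w J.+1).
  apply/ler_addgt0Pr => e e0.
  have [m me] : exists m, C * (dw (J.+1 + m)%N * M * I0) <= e.
    have D0 : 0 <= C * M * I0 by rewrite !mulr_ge0.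
    have [m Hm] : exists m : nat, C * M * I0 / e <= m%:R.
      by exists (Num.truncn (C * M * I0 / e)).+1; apply/ltW/truncnS_gt.
    exists m; rewrite (_ : C * _ = C * M * I0 * dw (J.+1 + m)%N); last by ring.
    have : m%:R <= (2 ^ (J.+1 + m))%:R :> R.
      by rewrite ler_nat (leq_trans (ltnW (ltn_expl m (ltnSn 1))))// leq_exp2l// leq_addl.
    move=> m2; rewrite /dw exprVn -natrX ler_pdivrMr ?ltr0n ?expn_gt0//.
    by rewrite -ler_pdivrMl// mulrC (le_trans Hm).
  have -> : T (tail J.+1) = (T (tail J.+1) - T (tail (J.+1 + m)%N)) + T (tail (J.+1 + m)%N) by rewrite subrK.
  apply: (le_trans (ler_normD _ _)); apply: lerD.
    apply: (le_trans (EJ m)); apply: ler_wpM2l; first by rewrite mulr_ge0// normr_ge0.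
    by apply: ler_wpM2l => //; rewrite gerBl.
  by apply: le_trans me; apply: HC; [exact: schwartz_tail|exact: tail_le].
have := E0 J.+1; rewrite big_ord_recr/= => E1.
have : `|w J * T (psi J)| <= `|T (tail 0)| + P + 2 * a * (4%:R / 3%:R * w J.+1).
  have -> : w J * T (psi J) = T (tail 0) - \sum_(i < J) w i * T (psi i) - T (tail J.+1).
    by rewrite E1; ring.
  apply: (le_trans (ler_normB _ _)); apply: lerD => //.
  by apply: (le_trans (ler_normB _ _)); exact: lerD.
rewrite normrM ger0_norm// -/a.
have -> : 2 * a * (4%:R / 3%:R * w J.+1) = 2%:R / 3%:R * (w J * a) by rewrite /w exprS; field.
lra.
Qed.

End gliding_hump.

(* Banach-Steinhaus: the test function witnessing unboundedness is a series of
   members of the family with weights 4^-i, picked by a gliding hump. *)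
Lemma equicontinuous (J S : Type) (w : J -> (rn -> R) -> R) (Phi : S -> rn -> R) :
  (forall j, tempered (w j)) ->
  (forall phi, schwartz phi -> exists M, forall j, `|w j phi| <= M) ->
  unif_schwartz Phi -> exists M, forall j s, `|w j (Phi s)| <= M.
Proof.
move=> tw wb uP; apply: contrapT => nM.
(* A single [w j] is bounded on the family. So for a [j] at which [K] is exceeded, some member comes
   within a factor 2 of the supremum over the family, as [hump] demands. *)
have pick K : exists js : J * S, K <= `|w js.1 (Phi js.2)| /\
    forall s, `|w js.1 (Phi s)| <= 2 * `|w js.1 (Phi js.2)|.
  have [j [s0 Hs0]] : exists j s, `|K| + `|K| < `|w j (Phi s)|.
    apply: contrapT => nH; apply: nM; exists (`|K| + `|K|) => j s.
    by rewrite leNgt; apply/negP => H; apply: nH; exists j, s.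
  pose A := [set `|w j (Phi s)| | s in [set: S]].
  have [M HM] := unif_temp_bound (tw j) uP.
  have A0 : A !=set0 by exists `|w j (Phi s0)|, s0.
  have ubA : has_ubound A by exists M => _ [s _ <-].
  have supA : 0 < sup A.
    apply: lt_le_trans (ub_le_sup ubA _); last by exists s0.
    by apply: le_lt_trans Hs0; rewrite addr_ge0.
  have [_ [s _ <-] Hs] := sup_adherent (divr_gt0 supA (ltr0Sn R 1)) (conj A0 ubA).
  exists (j, s) => /=.
  have H : sup A < 2 * `|w j (Phi s)| by lra.
  split; last by move=> s'; rewrite (le_trans _ (ltW H))//; apply: (ub_le_sup ubA); exists s'.
  have : `|K| + `|K| < 2 * `|w j (Phi s)|.
    apply: lt_trans H; apply: lt_le_trans Hs0 (ub_le_sup ubA _); by exists s0.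
  by have := ler_norm K; lra.
pose pk K := projT1 (cid (pick K)).
have pkP K : K <= `|w (pk K).1 (Phi (pk K).2)| /\
    forall s, `|w (pk K).1 (Phi s)| <= 2 * `|w (pk K).1 (Phi (pk K).2)|.
  by rewrite /pk; case: (cid (pick K)).
pose bd phi : R := if pselect (schwartz phi) is left sp then projT1 (cid (wb phi sp)) else 0.
have bdP phi j : schwartz phi -> `|w j phi| <= bd phi.
  move=> sp; rewrite /bd; case: pselect => // sp'; case: (cid (wb phi sp')) => M /=; exact.
(* Multiplied by [4^-i], the threshold becomes [3 (i + 1 + P i)], where [P i] bounds the
   contribution of the earlier terms for all [j] at once. By [hump] the [i]-th chosen functional is
   then at least [i + 1] in absolute value on the series, against the pointwise bound. *)
pose thr (i : nat) (P : R) : R := 3 * 4%:R ^+ i * (i%:R + 1 + P).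
pose P := fix P (i : nat) : R := if i is i'.+1 then
  P i' + 4%:R^-1 ^+ i' * bd (Phi (pk (thr i' (P i'))).2) else 0.
pose psi i := Phi (pk (thr i (P i))).2.
pose jj i := (pk (thr i (P i))).1.
have up : unif_schwartz psi.
  case: uP => sP bP; split; first by move=> i; exact: sP.
  by move=> l k; have [M HM] := bP l k; exists M => i; exact: HM.
have sp i : schwartz (psi i) by case: up.
have PP i (j : J) : `|\sum_(l < i) 4%:R^-1 ^+ l * w j (psi l)| <= P i.
  elim: i => [|i IH]; first by rewrite big_ord0 normr0.
  rewrite big_ord_recr/= (le_trans (ler_normD _ _))// lerD// normrM ger0_norm ?exprn_ge0//.
  by rewrite ler_wpM2l ?exprn_ge0//; exact: bdP.
have stail := schwartz_tail up 0.
have [M HM] := wb _ stail.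
have [i iM] : exists i : nat, M < i%:R + 1.
  by exists (Num.truncn M); rewrite natr1; exact: truncnS_gt.
have [H1 H2] := pkP (thr i (P i)).
have := hump up (tw (jj i)) (PP i (jj i)) (fun l => H2 _).
have := HM (jj i).
set t := `|w (jj i) _| => tM.
have : 4%:R^-1 ^+ i * (3 * 4%:R ^+ i * (i%:R + 1 + P i)) <= 4%:R^-1 ^+ i * `|w (jj i) (psi i)|.
  by rewrite ler_wpM2l ?exprn_ge0.
rewrite (_ : 4%:R^-1 ^+ i * (3 * 4%:R ^+ i * (i%:R + 1 + P i)) = 3 * (i%:R + 1 + P i)); last first.
  by rewrite exprVn mulrA [_^-1 * _]mulrCA mulVf ?mulr1// expf_neq0.
by move: iM tM; lra.
Qed.

End tempered_distributions.

(** * Gaussians *)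

Section derive_rules.
Context {R : realType}.
Implicit Types (f g : R -> R) (t a b : R).

Lemma isd_eq f t a b : is_derive t (1 : R) f a -> a = b -> is_derive t (1 : R) f b.
Proof. by move=> df <-. Qed.

Lemma isdD f g t a b : is_derive t (1 : R) f a -> is_derive t (1 : R) g b ->
  is_derive t (1 : R) (fun x => f x + g x) (a + b).
Proof. by move=> df dg; exact: is_deriveD. Qed.

Lemma isdM f g t a b : is_derive t (1 : R) f a -> is_derive t (1 : R) g b ->
  is_derive t (1 : R) (fun x => f x * g x) (f t * b + g t * a).
Proof. by move=> df dg; exact: is_deriveM. Qed.

Lemma isdZ f t (c : R) a : is_derive t (1 : R) f a -> is_derive t (1 : R) (fun x => c * f x) (c * a).
Proof. by move=> df; exact: is_deriveZ. Qed.

Lemma isd_id t : is_derive t (1 : R) (fun x => x) 1.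
Proof. exact: is_derive_id. Qed.

Lemma isd_comp f g t a b : is_derive (g t) (1 : R) f a -> is_derive t (1 : R) g b ->
  is_derive t (1 : R) (fun x => f (g x)) (a * b).
Proof. exact: is_derive1_comp. Qed.

Lemma isd_scale f t (c : R) a : is_derive (c * t) (1 : R) f a ->
  is_derive t (1 : R) (fun x => f (c * x)) (c * a).
Proof.
move=> df; apply: isd_eq (isd_comp df (isdZ c (isd_id t))) _.
by rewrite mulr1 mulrC.
Qed.

Lemma isd_scaler f t (c : R) a : is_derive (t * c) (1 : R) f a ->
  is_derive t (1 : R) (fun x => f (x * c)) (c * a).
Proof.
rewrite mulrC => df; have := isd_scale df.
by rewrite (_ : (fun x => f (c * x)) = (fun x => f (x * c)))//; apply/funext => x; rewrite mulrC.
Qed.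

End derive_rules.

Section parametric_integrals.
Context {R : realType} d {Y : measurableType d} (nu : {measure set Y -> \bar R}).

Lemma is_derive_Rint (f : R -> Y -> R) (f1 c : Y -> R) (t : R) :
  (forall u, intg nu (f u)) -> intg nu f1 -> intg nu c ->
  (forall h y, `|f (t + h) y - f t y - h * f1 y| <= h ^+ 2 * c y) ->
  is_derive t (1 : R) (fun u => \int[nu]_y f u y) (\int[nu]_y f1 y).
Proof.
move=> fi f1i ci H; apply: (is_derive_quad (C := \int[nu]_y c y)) => h _.
rewrite -[h * _]RintegralZl// -RintegralB; [|by []|exact: fi|exact: fi].
rewrite -RintegralB; [|by []|exact: intgB|exact: intgZl].
rewrite mulrC; apply: Rint_norm_le_bound => //.
by apply: intgB; [exact: intgB|exact: intgZl].
Qed.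

End parametric_integrals.

Section trigonometric_taylor.
Context {R : realType}.

Lemma is_derive_cosM (a t : R) : is_derive t (1 : R) (fun t => cos (t * a)) (- a * sin (t * a)).
Proof. by apply: isd_eq (isd_scaler (is_derive_cos _)) _; rewrite mulrN mulNr. Qed.

Lemma is_derive_sinM (a t : R) : is_derive t (1 : R) (fun t => sin (t * a)) (a * cos (t * a)).
Proof. exact: (isd_scaler (is_derive_sin _)). Qed.

Lemma cos_taylor (a t h : R) :
  `|cos ((t + h) * a) - cos (t * a) - h * (- a * sin (t * a))| <= h ^+ 2 * a ^+ 2.
Proof.
have d2 (u : R) : is_derive u (1 : R) (fun t => - a * sin (t * a)) (- a * (a * cos (u * a))).
  by apply: is_deriveZ; exact: is_derive_sinM.
have := @taylor2 R _ _ _ t (t + h) (a ^+ 2) (is_derive_cosM a) d2.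
rewrite [t + h - t]addrAC subrr add0r [h ^+ 2 * _]mulrC; apply => u _.
rewrite !normrM normrN mulrA -expr2 real_normK ?num_real//.
by rewrite ler_piMr ?sqr_ge0// cos_max.
Qed.

Lemma sin_taylor (a t h : R) :
  `|sin ((t + h) * a) - sin (t * a) - h * (a * cos (t * a))| <= h ^+ 2 * a ^+ 2.
Proof.
have d2 (u : R) : is_derive u (1 : R) (fun t => a * cos (t * a)) (a * (- a * sin (u * a))).
  by apply: is_deriveZ; exact: is_derive_cosM.
have := @taylor2 R _ _ _ t (t + h) (a ^+ 2) (is_derive_sinM a) d2.
rewrite [t + h - t]addrAC subrr add0r [h ^+ 2 * _]mulrC; apply => u _.
rewrite !normrM normrN mulrA -expr2 real_normK ?num_real//.
by rewrite ler_piMr ?sqr_ge0// sin_max.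
Qed.

End trigonometric_taylor.

Section gaussians.
Context {R : realType} (n : nat).
Local Notation rn := 'rV[R]_n.
Local Notation mu := (@lebesgue_rV R n).
Implicit Types (f g phi : rn -> R) (x : rn).

Definition rho (y : rn) : R := dotp y y.

Lemma rhoE (y : rn) : rho y = \sum_i y ord0 i ^+ 2.
Proof. by apply: eq_bigr => i _; rewrite expr2. Qed.

Lemma rho_ge0 y : 0 <= rho y.
Proof. by rewrite rhoE sumr_ge0// => i _; exact: sqr_ge0. Qed.

Lemma rho_scale (c : R) y : rho (c *: y) = c ^+ 2 * rho y.
Proof. by rewrite !rhoE mulr_sumr; apply: eq_bigr => i _; rewrite mxE exprMn. Qed.

Lemma rho_ge_norm y : `|y| ^+ 2 <= rho y.
Proof.
by rewrite /rho -enorm_sqr lerXn2r ?nnegrE ?sqrtr_ge0// norm_le_enorm.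
Qed.

Lemma rho_le y : rho y <= n%:R * `|y| ^+ 2.
Proof. by apply: (le_trans (ler_norm _)); apply: (le_trans (dotp_le y y)); rewrite expr2. Qed.

Lemma rho_diff x : differentiable rho x /\ (forall i, pderiv i rho x = 2 * x ord0 i).
Proof.
apply: (@differentiable_quad _ _ _ _ (fun i => 2 * x ord0 i) n%:R) => h _.
rewrite (_ : rho (x + h) - rho x - _ = rho h); first by rewrite ger0_norm ?rho_ge0// rho_le.
rewrite !rhoE /lincomb -!sumrB; apply: eq_bigr => i _; rewrite mxE; ring.
Qed.

Lemma pderiv_comp1 (F : R -> R) (l : R) f x : is_derive (f x) (1 : R) F l -> differentiable f x ->
  differentiable (F \o f) x /\ (forall i, pderiv i (F \o f) x = l * pderiv i f x).
Proof.
move=> dF df; have dF' : differentiable F (f x) by apply/derivable1_diffP; case: dF.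
have dFf : differentiable (F \o f) x by exact: differentiable_comp.
have E : 'd F (f x) 1 = l by rewrite -deriveE//; case: dF.
split => // i; rewrite /pderiv deriveE// diff_comp//= -[X in 'd F _ X]mulr1.
by rewrite -[_ * 1]/(_ *: (1 : R)) linearZ/= E deriveE// /GRing.scale/= mulrC.
Qed.

(* [gE + i gS] is exp(-(a - i b)|y|^2). *)
Definition gE (a b : R) (y : rn) : R := expR (- a * rho y) * cos (b * rho y).
Definition gS (a b : R) (y : rn) : R := expR (- a * rho y) * sin (b * rho y).

Section fixed_ab.
Variables (a b : R).
Hypothesis a0 : 0 < a.

Lemma gE_pderiv x : differentiable (gE a b) x /\
  (forall i, pderiv i (gE a b) x = - 2 * x ord0 i * (a * gE a b x + b * gS a b x)).
Proof.
have [dr pr] := rho_diff x.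
have d (r : R) : is_derive r (1 : R) (fun r => expR (- a * r) * cos (b * r))
    (- a * expR (- a * r) * cos (b * r) - b * expR (- a * r) * sin (b * r)).
  apply: isd_eq (isdM (isd_scale (is_derive_expR _)) (isd_scale (is_derive_cos _))) _; ring.
have [h1 h2] := pderiv_comp1 (d (rho x)) dr; split; first exact: h1.
by move=> i; rewrite [LHS]h2 pr /gE /gS; ring.
Qed.

Lemma gS_pderiv x : differentiable (gS a b) x /\
  (forall i, pderiv i (gS a b) x = - 2 * x ord0 i * (a * gS a b x - b * gE a b x)).
Proof.
have [dr pr] := rho_diff x.
have d (r : R) : is_derive r (1 : R) (fun r => expR (- a * r) * sin (b * r))
    (- a * expR (- a * r) * sin (b * r) + b * expR (- a * r) * cos (b * r)).
  apply: isd_eq (isdM (isd_scale (is_derive_expR _)) (isd_scale (is_derive_sin _))) _; ring.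
have [h1 h2] := pderiv_comp1 (d (rho x)) dr; split; first exact: h1.
by move=> i; rewrite [LHS]h2 pr /gE /gS; ring.
Qed.

(** With [t = |y|], use [1 + t <= exp t] and complete the square: the maximum of [k t - a t^2] is
    [k^2 / (4 a)]. *)
Lemma expR_rho_decw k y : (1 + `|y|) ^+ k * expR (- a * rho y) <= expR (k%:R ^+ 2 / (4%:R * a)).
Proof.
apply: (@le_trans _ _ (expR (`|y|) ^+ k * expR (- a * rho y))).
  by rewrite ler_wpM2r ?expR_ge0// lerXn2r ?nnegrE ?expR_ge0 ?addr_ge0// expR_ge1Dx.
rewrite -expRM_natl -expRD ler_expR.
have := rho_ge_norm y; have : 0 <= (k%:R / (2 * a) - `|y|) ^+ 2 by exact: sqr_ge0.
set t := `|y|; set K := k%:R : R => H1 H2.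
have : 0 <= a * (K / (2 * a) - t) ^+ 2 by rewrite mulr_ge0// ltW.
have -> : a * (K / (2 * a) - t) ^+ 2 = K ^+ 2 / (4%:R * a) - K * t + a * t ^+ 2.
  by field; exact: lt0r_neq0.
have := ler_wpM2l (ltW a0) H2; lra.
Qed.

Lemma gE_le y : `|gE a b y| <= expR (- a * rho y).
Proof. by rewrite normrM ger0_norm ?expR_ge0// ler_piMr ?expR_ge0// cos_max. Qed.

Lemma gS_le y : `|gS a b y| <= expR (- a * rho y).
Proof. by rewrite normrM ger0_norm ?expR_ge0// ler_piMr ?expR_ge0// sin_max. Qed.

Lemma gE_decay : decay (gE a b).
Proof.
move=> k; exists (expR (k%:R ^+ 2 / (4%:R * a))) => y.
apply: le_trans (expR_rho_decw k y); rewrite ler_wpM2l ?exprn_ge0 ?addr_ge0//; exact: gE_le.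
Qed.

Lemma gS_decay : decay (gS a b).
Proof.
move=> k; exists (expR (k%:R ^+ 2 / (4%:R * a))) => y.
apply: le_trans (expR_rho_decw k y); rewrite ler_wpM2l ?exprn_ge0 ?addr_ge0//; exact: gS_le.
Qed.

Let B f := exists c d : R, f = (fun y => c * gE a b y + d * gS a b y).

Let B_schwartz f : B f -> schwartz f.
Proof.
move=> Bf; suff H : forall g, gen_coord B g -> schwartz g by apply: H; exact: Gen_base.
apply: gen_coord_schwartz => [_ [c [e ->]]|_ i [c [e ->]]].
  split; last first.
    apply: decay_lin; first exact: gE_decay.
    have := decay_lin e gS_decay gS_decay => _.
    by move=> k; have [M HM] := gS_decay k; exists (`|e| * M); exact: decwZ.
  move=> x; apply: differentiable_lin; first by have [] := gE_pderiv x.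
  by apply: (@differentiableZ _ _ _ (gS a b) e x); have [] := gS_pderiv x.
rewrite (_ : pderiv i _ = (fun y => y ord0 i * ((- 2 * (c * a - e * b)) * gE a b y +
    (- 2 * (c * b + e * a)) * gS a b y))).
  by apply: Gen_coord; apply: Gen_base; do 2 eexists.
apply/funext => x; have [d1 p1] := gE_pderiv x; have [d2 p2] := gS_pderiv x.
rewrite pderiv_lin//; last exact: (@differentiableZ _ _ _ (gS a b) e x).
have -> : pderiv i (fun y => e * gS a b y) x = e * pderiv i (gS a b) x.
  have := @pderiv_lin R n i e (gS a b) (fun _ => 0) x d2 (differentiable_cst _ _).
  by rewrite pderiv_cst addr0 => <-; congr (pderiv i _ x); apply/funext => z; rewrite addr0.
by rewrite p1 p2; ring.
Qed.

Lemma gE_schwartz : schwartz (gE a b).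
Proof. by apply: B_schwartz; exists 1, 0; apply/funext => y; rewrite mul1r mul0r addr0. Qed.

Lemma gS_schwartz : schwartz (gS a b).
Proof. by apply: B_schwartz; exists 0, 1; apply/funext => y; rewrite mul1r mul0r add0r. Qed.

Lemma Rint_pderiv_schwartz i f : schwartz f -> \int[mu]_x pderiv i f x = 0.
Proof.
move=> sf; have [M HM] := schwartz_decay sf (2 * n).
have [M' HM'] := schwartz_decay (schwartz_pderiv i sf) (2 * n).
apply: (@Rint_pderiv0 R n f i (M + M')).
- by move=> x; exact: schwartz_diff.
- by move=> x; apply: (le_trans (HM x)); rewrite lerDl (decw_ge0 HM').
- by move=> x; apply: (le_trans (HM' x)); rewrite lerDr (decw_ge0 HM).
Qed.

Lemma schwartz_rhoM f : schwartz f -> schwartz (fun y => rho y * f y).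
Proof.
move=> sf; have := @schwartz_sum R n _ (index_enum 'I_n) (fun i y => y ord0 i * (y ord0 i * f y)).
have H i : schwartz (fun y : rn => y ord0 i * (y ord0 i * f y)) by do 2 apply: schwartz_coord.
move=> /(_ H); apply: schwartz_ext => y; rewrite rhoE mulr_suml.
by apply: eq_bigr => i _; rewrite expr2 mulrA.
Qed.

Let UU := \int[mu]_y (rho y * gE a b y).
Let VV := \int[mu]_y (rho y * gS a b y).

(** The divergence of [y f(y)] integrates to zero, so [n] times the integral of [f] is minus that of
    [y . grad f], here a combination of [UU] and [VV]. *)
Let div_int f (c d : R) : schwartz f ->
  (forall i y, pderiv i f y = - 2 * y ord0 i * (c * gE a b y + d * gS a b y)) ->
  n%:R * \int[mu]_y f y = 2 * c * UU + 2 * d * VV.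
Proof.
move=> sf pf.
have sc i : schwartz (fun y => y ord0 i * f y) by exact: schwartz_coord.
have E i y : pderiv i (fun y => y ord0 i * f y) y = f y - 2 * (y ord0 i ^+ 2 * (c * gE a b y + d * gS a b y)).
  rewrite (@pderivM R n i (fun y : rn => y ord0 i) f); [|exact: differentiable_coord|exact: schwartz_diff].
  by rewrite pderiv_coord eqxx pf/=; ring.
have : \sum_i \int[mu]_y pderiv i (fun y => y ord0 i * f y) y = 0.
  by rewrite big1// => i _; exact: Rint_pderiv_schwartz.
have si i : intg mu (pderiv i (fun y => y ord0 i * f y)) by apply: schwartz_intg; exact: schwartz_pderiv.
rewrite -Rint_sum//.
have iU : intg mu (fun y => rho y * gE a b y) by apply: schwartz_intg; apply: schwartz_rhoM; exact: gE_schwartz.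
have iV : intg mu (fun y => rho y * gS a b y) by apply: schwartz_intg; apply: schwartz_rhoM; exact: gS_schwartz.
have sfi := schwartz_intg sf.
have -> : \int[mu]_x (\sum_i pderiv i (fun y => y ord0 i * f y) x) =
   \int[mu]_y (n%:R * f y - (2 * c * (rho y * gE a b y) + 2 * d * (rho y * gS a b y))).
  apply: eq_Rintegral => y _; under eq_bigr do rewrite E.
  rewrite sumrB sumr_const card_ord -mulr_natl -mulr_sumr -mulr_suml -rhoE; ring.
rewrite RintegralB//; [|exact: intgZl|by apply: intgD; exact: intgZl].
rewrite RintegralD//; [|exact: intgZl|exact: intgZl].
by rewrite !RintegralZl// => /eqP; rewrite subr_eq0 => /eqP.
Qed.

Lemma gE_virial : n%:R * \int[mu]_y gE a b y = 2 * a * UU + 2 * b * VV.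
Proof.
by apply: div_int; [exact: gE_schwartz|move=> i y; have [_ ->] := gE_pderiv y].
Qed.

Lemma gS_virial : n%:R * \int[mu]_y gS a b y = 2 * (- b) * UU + 2 * a * VV.
Proof.
apply: div_int; [exact: gS_schwartz|move=> i y; have [_ ->] := gS_pderiv y]; ring.
Qed.

End fixed_ab.

Lemma gE_derive_b (a b : R) : 0 < a -> is_derive b (1 : R) (fun b => \int[mu]_y gE a b y)
  (- \int[mu]_y (rho y * gS a b y)).
Proof.
move=> a0; rewrite -RintN; last by apply: schwartz_intg; apply: schwartz_rhoM; exact: gS_schwartz.
apply: (@is_derive_Rint _ _ _ _ _ _ (fun y => rho y * (rho y * gE a 0 y))).
- by move=> u; apply: schwartz_intg; exact: gE_schwartz.
- by apply: intgN; apply: schwartz_intg; apply: schwartz_rhoM; exact: gS_schwartz.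
- by apply: schwartz_intg; do 2 apply: schwartz_rhoM; exact: gE_schwartz.
move=> h y; rewrite /gE /gS mul0r cos0 mulr1.
set e := expR _; have e0 : 0 <= e by exact: expR_ge0.
have -> : e * cos ((b + h) * rho y) - e * cos (b * rho y) - h * - (rho y * (e * sin (b * rho y))) =
  e * (cos ((b + h) * rho y) - cos (b * rho y) - h * (- rho y * sin (b * rho y))) by ring.
rewrite normrM ger0_norm//.
have -> : h ^+ 2 * (rho y * (rho y * e)) = e * (h ^+ 2 * rho y ^+ 2) by ring.
by rewrite ler_wpM2l// cos_taylor.
Qed.

Lemma gS_derive_b (a b : R) : 0 < a -> is_derive b (1 : R) (fun b => \int[mu]_y gS a b y)
  (\int[mu]_y (rho y * gE a b y)).
Proof.
move=> a0.
apply: (@is_derive_Rint _ _ _ _ _ _ (fun y => rho y * (rho y * gE a 0 y))).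
- by move=> u; apply: schwartz_intg; exact: gS_schwartz.
- by apply: schwartz_intg; apply: schwartz_rhoM; exact: gE_schwartz.
- by apply: schwartz_intg; do 2 apply: schwartz_rhoM; exact: gE_schwartz.
move=> h y; rewrite /gE /gS mul0r cos0 mulr1.
set e := expR _; have e0 : 0 <= e by exact: expR_ge0.
have -> : e * sin ((b + h) * rho y) - e * sin (b * rho y) - h * (rho y * (e * cos (b * rho y))) =
  e * (sin ((b + h) * rho y) - sin (b * rho y) - h * (rho y * cos (b * rho y))) by ring.
rewrite normrM ger0_norm//.
have -> : h ^+ 2 * (rho y * (rho y * e)) = e * (h ^+ 2 * rho y ^+ 2) by ring.
by rewrite ler_wpM2l// sin_taylor.
Qed.

Lemma Rint_gauss1 : \int[mu]_y gE 1 0 y = Num.sqrt pi ^+ n.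
Proof.
have mg := @measurable_gauss_fun R; have g0 := @gauss_fun_ge0 R.
have := @ge0_integral_rV_prod R n gauss_fun mg g0 (@integrableT_gauss R).
rewrite [X in X ^+ n](_ : _ = Num.sqrt pi); last by rewrite /Rintegral integralT_gauss.
move=> E; rewrite -[RHS]/(fine (Num.sqrt pi ^+ n)%:E) -E /Rintegral; congr fine; apply: eq_integral => y _.
congr EFin; rewrite /gE mul0r cos0 mulr1 mulN1r rhoE -sumrN expR_sum.
by apply: eq_bigr => i _.
Qed.

Lemma Rint_gauss (a : R) : 0 < a -> \int[mu]_y gE a 0 y = (Num.sqrt (pi / a)) ^+ n.
Proof.
move=> a0; have sa : Num.sqrt a != 0 by rewrite gt_eqF// sqrtr_gt0.
have := @Rint_affine R n (Num.sqrt a) 0 (gE 1 0) sa (schwartz_intg (gE_schwartz 0 ltr01)).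
rewrite Rint_gauss1 ger0_norm ?sqrtr_ge0//.
under [in RHS]eq_Rintegral => y _.
  rewrite addr0 (_ : gE 1 0 _ = gE a 0 y); first over.
  by rewrite /gE rho_scale sqr_sqrtr ?ltW// !mul0r mulN1r mulNr.
move=> E; rewrite sqrtrM ?pi_ge0// exprMn sqrtrV ?ltW// E mulrAC exprVn mulfV ?mul1r//.
by rewrite expf_neq0.
Qed.

(* The virial identities show that exp(b n / a) (X^2 + Y^2) is nondecreasing in b, where X + iY is
   the integral of exp(-(a - i b)|y|^2). *)
Lemma gauss_nondegenerate (a b : R) : 0 < a -> 0 <= b ->
  0 < (\int[mu]_y gE a b y) ^+ 2 + (\int[mu]_y gS a b y) ^+ 2.
Proof.
move=> a0 b0.
pose X b := \int[mu]_y gE a b y; pose Y b := \int[mu]_y gS a b y.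
pose U b := \int[mu]_y (rho y * gE a b y); pose V b := \int[mu]_y (rho y * gS a b y).
pose k := n%:R / a.
pose P (b : R) := expR (b * k) * (X b ^+ 2 + Y b ^+ 2).
have dP (t : R) : is_derive t (1 : R) P (expR (t * k) * (k * (X t ^+ 2 + Y t ^+ 2) + 2 * (Y t * U t - X t * V t))).
  have dX := gE_derive_b t a0; have dY := gS_derive_b t a0.
  have dX2 := isdM dX dX; have dY2 := isdM dY dY.
  have := isdM (isd_scaler (f := expR) (c := k) (is_derive_expR (t * k))) (isdD dX2 dY2).
  rewrite (_ : (fun x : R => _) = P); last by apply/funext => u; rewrite /P !expr2.
  by move=> H; apply: isd_eq H _; rewrite /X /Y /U /V; ring.
have P0 (t : R) : 0 <= t -> 0 <= expR (t * k) * (k * (X t ^+ 2 + Y t ^+ 2) + 2 * (Y t * U t - X t * V t)).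
  move=> t0; rewrite mulr_ge0 ?expR_ge0//.
  have [n0|npos] := posnP n.
    have r0 y : rho y = 0 by rewrite rhoE big1// => i; have := ltn_ord i; rewrite [X in (_ < X)%N]n0.
    have U0 : U t = 0 by rewrite /U /Rintegral integral0_eq// => y _; rewrite r0 mul0r.
    have V0 : V t = 0 by rewrite /V /Rintegral integral0_eq// => y _; rewrite r0 mul0r.
    by rewrite U0 V0 !mulr0 subrr mulr0 addr0 mulr_ge0 ?divr_ge0 ?addr_ge0 ?sqr_ge0// ltW.
  have e1 : n%:R * X t = 2 * a * U t + 2 * t * V t := gE_virial t a0.
  have e2 : n%:R * Y t = 2 * (- t) * U t + 2 * a * V t := gS_virial t a0.
  have n1 : 0 < n%:R :> R by rewrite ltr0n.
  rewrite -(pmulr_rge0 _ n1) -(pmulr_rge0 _ n1) -(pmulr_rge0 _ a0).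
  have -> : a * (n%:R * (n%:R * (k * (X t ^+ 2 + Y t ^+ 2) + 2 * (Y t * U t - X t * V t)))) =
     n%:R * (((n%:R * X t) ^+ 2 + (n%:R * Y t) ^+ 2) + 2 * a * ((n%:R * Y t) * U t - (n%:R * X t) * V t)).
    by rewrite /k; field; exact: lt0r_neq0.
  rewrite e1 e2 mulr_ge0//.
  (* The squares sum to [4 (a^2 + t^2) (U^2 + V^2)] and the mixed term is [- 4 a t (U^2 + V^2)], so
     the sign is that of [a^2 + t^2 - a t]. *)
  have -> : (2 * a * U t + 2 * t * V t) ^+ 2 + (2 * (- t) * U t + 2 * a * V t) ^+ 2 +
      2 * a * ((2 * (- t) * U t + 2 * a * V t) * U t - (2 * a * U t + 2 * t * V t) * V t) =
     4%:R * (U t ^+ 2 + V t ^+ 2) * (a ^+ 2 + t ^+ 2 - a * t) by ring.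
  rewrite mulr_ge0//; first by rewrite mulr_ge0// addr_ge0// sqr_ge0.
  have at0 : 0 <= a * t by rewrite mulr_ge0// ltW.
  by have := sqr_ge0 (a - t); nra.
have P00 : 0 < P 0.
  rewrite /P mul0r expR0 mul1r ltr_pwDl ?sqr_ge0// exprn_gt0// /X Rint_gauss//.
  by rewrite exprn_gt0// sqrtr_gt0 divr_gt0// pi_gt0.
have : P 0 <= P b.
  have cP := is_derive_continuous dP.
  have [c] : exists2 c, c \in `[0, b] & P b - P 0 = _ := MVT_segment b0 (fun u _ => dP u) (continuous_subspaceT cP).
  rewrite in_itv/= => /andP[c0 _] E; rewrite -subr_ge0 E subr0 mulr_ge0//; exact: P0.
by move=> /(lt_le_trans P00); rewrite /P pmulr_rgt0// expR_gt0.
Qed.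

End gaussians.

(** * Fourier transform and |D|^s *)

Section parametric_measurability.
Context {R : realType} d1 d2 {T1 : measurableType d1} {T2 : measurableType d2}.
Variable m2 : {sigma_finite_measure set T2 -> \bar R}.

(** Tonelli gives measurability for nonnegative integrands, whence the decomposition
    [f = (|f| + f) - |f|]. *)
Lemma measurable_Rint_intg (f : T1 -> T2 -> R) :
  measurable_fun setT (fun z : T1 * T2 => f z.1 z.2) -> (forall x, intg m2 (f x)) ->
  measurable_fun setT (fun x => \int[m2]_y f x y).
Proof.
move=> mf if_.
have M (g : T1 -> T2 -> R) : measurable_fun setT (fun z : T1 * T2 => g z.1 z.2) -> (forall x y, 0 <= g x y) ->
    measurable_fun setT (fun x => \int[m2]_y g x y).
  move=> mg g0; have mG : measurable_fun setT (fun z : T1 * T2 => (g z.1 z.2)%:E) by apply/measurable_EFinP.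
  have G0 (z : T1 * T2) : (0 <= (g z.1 z.2)%:E)%E by rewrite lee_fin.
  have H := @measurable_fun_fubini_tonelli_F _ _ _ _ R m2 _ mG G0.
  exact: measurableT_comp (@fine_measurable R setT measurableT) H.
have mn : measurable_fun setT (fun z : T1 * T2 => `|f z.1 z.2|) by exact: measurableT_comp.
have M1 := M (fun x y => `|f x y|) mn (fun x y => normr_ge0 _).
have M2 : measurable_fun setT (fun x => \int[m2]_y (`|f x y| + f x y)).
  apply: (M (fun x y => `|f x y| + f x y)); first exact: measurable_funD.
  by move=> x y; rewrite -lerBlDr sub0r -normrN ler_norm.
rewrite (_ : (fun x => _) = (fun x => \int[m2]_y (`|f x y| + f x y) - \int[m2]_y `|f x y|)).
  exact: measurable_funB.
apply/funext => x; have E := RintegralD measurableT (intg_norm (if_ x)) (if_ x).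
by apply/esym/eqP; rewrite subr_eq addrC; apply/eqP; exact: E.
Qed.

Lemma measurable_Rint (f : T1 -> T2 -> R) (g : T2 -> R) :
  measurable_fun setT (fun z : T1 * T2 => f z.1 z.2) -> intg m2 g ->
  (forall x y, `|f x y| <= g y) -> measurable_fun setT (fun x => \int[m2]_y f x y).
Proof.
move=> mf ig fg; apply: measurable_Rint_intg => // x; apply: intg_le ig (fg x).
exact: (measurableT_comp mf (pair1_measurable x)).
Qed.

End parametric_measurability.

Section dotp_theory.
Context {R : realType} (n : nat).
Local Notation rn := 'rV[R]_n.
Implicit Types (x y z : rn).

Lemma dotpC x y : dotp x y = dotp y x.
Proof. by apply: eq_bigr => i _; rewrite mulrC. Qed.

Lemma dotpDr x y z : dotp x (y + z) = dotp x y + dotp x z.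
Proof. by rewrite -big_split/=; apply: eq_bigr => i _; rewrite mxE mulrDr. Qed.

Lemma dotpZr (c : R) x y : dotp x (c *: y) = c * dotp x y.
Proof. by rewrite mulr_sumr; apply: eq_bigr => i _; rewrite mxE mulrCA. Qed.

Lemma dotpNr x y : dotp x (- y) = - dotp x y.
Proof. by rewrite -scaleN1r dotpZr mulN1r. Qed.

Lemma dotpBr x y z : dotp x (y - z) = dotp x y - dotp x z.
Proof. by rewrite dotpDr dotpNr. Qed.

Lemma dotpZl (c : R) x y : dotp (c *: x) y = c * dotp x y.
Proof. by rewrite dotpC dotpZr dotpC. Qed.

Lemma measurable_dotp d (T : measurableType d) (f g : T -> rn) :
  measurable_fun setT f -> measurable_fun setT g ->
  measurable_fun setT (fun t => dotp (f t) (g t)).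
Proof.
move=> mf mg; apply: measurable_sum => i; apply: measurable_funM.
  exact: measurableT_comp (measurable_coor i) mf.
exact: measurableT_comp (measurable_coor i) mg.
Qed.

Lemma measurable_rho : measurable_fun setT (@rho R n).
Proof. exact: measurable_dotp (@measurable_id _ _ _) (@measurable_id _ _ _). Qed.

Lemma measurable_powR_enorm (s : R) : measurable_fun setT (fun x : rn => enorm x `^ s).
Proof.
apply: (measurableT_comp (measurable_powR s)).
by apply: (measurableT_comp (continuous_measurable_fun (@sqrt_continuous R))); exact: measurable_rho.
Qed.

Lemma powR_enorm_le (s : R) : 0 <= s ->
  exists (N : nat) (C : R), forall x, `|enorm x `^ s| <= C * (1 + `|x|) ^+ N.
Proof.
move=> s0; pose N := (Num.truncn s).+1; exists N, ((1 + n%:R) ^+ N) => x.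
have sN : s <= N%:R by rewrite ltW// truncnS_gt.
rewrite ger0_norm ?powR_ge0// -exprMn.
set B := (1 + n%:R) * (1 + `|x|).
have B1 : 1 <= B.
  by rewrite -[1]mulr1 /B ler_pM// ?lerDl//.
have eB : enorm x <= B.
  apply: (le_trans (enorm_le x)); rewrite /B ler_pM// ?ler0n// ?lerDr// lerDr//.
rewrite -powR_mulrn ?(le_trans _ B1)//.
apply: (@le_trans _ _ (B `^ s)); last by rewrite ler_powR.
by apply: ge0_ler_powR => //; rewrite nnegrE ?sqrtr_ge0// (le_trans _ B1).
Qed.

Lemma powR_enorm2 x : enorm x `^ 2 = rho x.
Proof. by rewrite powR_mulrn ?sqrtr_ge0// enorm_sqr. Qed.

Lemma phase_diff (xi x y : rn) : differentiable (fun y => dotp xi (x - y)) y /\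
  (forall i, pderiv i (fun y => dotp xi (x - y)) y = - xi ord0 i).
Proof.
apply: (@differentiable_quad _ _ _ _ (fun i => - xi ord0 i) 0) => h _.
rewrite mul0r normr_le0 subr_eq0; apply/eqP.
rewrite opprD addrA [dotp xi (x - y - h)]dotpBr addrAC subrr add0r dotpC -dotpNr.
by apply: eq_bigr => i _; rewrite mxE.
Qed.

End dotp_theory.

Section fourier_kernels.
Context {R : realType} (n : nat).
Local Notation rn := 'rV[R]_n.
Local Notation mu := (@lebesgue_rV R n).
Implicit Types (phi : rn -> R) (x xi : rn).

(** [Fc] and [Fs] are the real and imaginary parts of [e^(i x . xi)] times the Fourier transform of
    [phi] at [xi]. With the point [x] inside the phase, the inverse transform becomes a real
    integral of [Fc]. *)
Definition Fc phi x xi := \int[mu]_y (phi y * cos (dotp xi (x - y))).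
Definition Fs phi x xi := \int[mu]_y (phi y * sin (dotp xi (x - y))).

Lemma measurable_cosf d (T : measurableType d) (f : T -> R) :
  measurable_fun setT f -> measurable_fun setT (fun t => cos (f t)).
Proof. by move=> mf; exact: (measurableT_comp (continuous_measurable_fun (@continuous_cos R)) mf). Qed.

Lemma measurable_sinf d (T : measurableType d) (f : T -> R) :
  measurable_fun setT f -> measurable_fun setT (fun t => sin (f t)).
Proof. by move=> mf; exact: (measurableT_comp (continuous_measurable_fun (@continuous_sin R)) mf). Qed.

Lemma measurable_phase d (T : measurableType d) (f g h : T -> rn) :
  measurable_fun setT f -> measurable_fun setT g -> measurable_fun setT h ->
  measurable_fun setT (fun t => dotp (f t) (g t - h t)).
Proof. by move=> mf mg mh; apply: measurable_dotp => //; exact: measurable_funB_rV. Qed.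

Lemma intg_Fc phi x xi : intg mu phi -> intg mu (fun y => phi y * cos (dotp xi (x - y))).
Proof.
move=> sphi; apply: (@intg_mul_bounded _ _ _ _ _ _ 1) => //.
  by apply: measurable_cosf; apply: measurable_phase => //; exact: measurable_id.
by move=> y; exact: cos_max.
Qed.

Lemma intg_Fs phi x xi : intg mu phi -> intg mu (fun y => phi y * sin (dotp xi (x - y))).
Proof.
move=> sphi; apply: (@intg_mul_bounded _ _ _ _ _ _ 1) => //.
  by apply: measurable_sinf; apply: measurable_phase => //; exact: measurable_id.
by move=> y; exact: sin_max.
Qed.

Lemma Fc_pderiv i phi x xi : schwartz phi -> Fc (pderiv i phi) x xi = - (xi ord0 i * Fs phi x xi).
Proof.
move=> sphi; pose g y := cos (dotp xi (x - y)).
have H y : differentiable g y /\ (forall i, pderiv i g y = xi ord0 i * sin (dotp xi (x - y))).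
  have [d p] := phase_diff xi x y.
  have [d1 p1] := pderiv_comp1 (f := fun y : rn => dotp xi (x - y)) (is_derive_cos (dotp xi (x - y))) d.
  by split => [|j]; [exact: d1|rewrite [LHS]p1 p; ring].
have [|||_ IBP] := @Rint_by_parts R n i phi g (1 + `|xi ord0 i|) sphi.
- by move=> y; have [] := H y.
- by move=> y; apply: (le_trans (cos_max _)); rewrite lerDl.
- move=> y; have [_ ->] := H y; rewrite normrM.
  by apply: (@le_trans _ _ `|xi ord0 i|); rewrite ?lerDr// ler_piMr// sin_max.
rewrite /Fc IBP; congr (- _); rewrite /Fs -RintegralZl//; last by apply: intg_Fs; exact: schwartz_intg.
by apply: eq_Rintegral => y _; have [_ ->] := H y; ring.
Qed.

Lemma Fs_pderiv i phi x xi : schwartz phi -> Fs (pderiv i phi) x xi = xi ord0 i * Fc phi x xi.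
Proof.
move=> sphi; pose g y := sin (dotp xi (x - y)).
have H y : differentiable g y /\ (forall i, pderiv i g y = - xi ord0 i * cos (dotp xi (x - y))).
  have [d p] := phase_diff xi x y.
  have [d1 p1] := pderiv_comp1 (f := fun y : rn => dotp xi (x - y)) (is_derive_sin (dotp xi (x - y))) d.
  by split => [|j]; [exact: d1|rewrite [LHS]p1 p; ring].
have [|||_ IBP] := @Rint_by_parts R n i phi g (1 + `|xi ord0 i|) sphi.
- by move=> y; have [] := H y.
- by move=> y; apply: (le_trans (sin_max _)); rewrite lerDl.
- move=> y; have [_ ->] := H y; rewrite normrM normrN.
  by apply: (@le_trans _ _ `|xi ord0 i|); rewrite ?lerDr// ler_piMr// cos_max.
rewrite /Fs IBP -RintN; last first.
  apply: (@intg_eq _ _ _ _ (fun y => - xi ord0 i * (phi y * cos (dotp xi (x - y))))).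
    by move=> y; have [_ ->] := H y; ring.
  by apply: intgZl; apply: intg_Fc; exact: schwartz_intg.
rewrite /Fc -RintegralZl//; last by apply: intg_Fc; exact: schwartz_intg.
by apply: eq_Rintegral => y _; have [_ ->] := H y; ring.
Qed.

Definition nlap phi : rn -> R := fun x => - laplacian phi x.

Lemma schwartz_laplacian phi : schwartz phi -> schwartz (laplacian phi).
Proof. by move=> sphi; apply: schwartz_sum => i; do 2 apply: schwartz_pderiv. Qed.

Lemma schwartz_nlap phi : schwartz phi -> schwartz (nlap phi).
Proof. by move=> sphi; apply: schwartzN; exact: schwartz_laplacian. Qed.

Lemma Fc_nlap phi x xi : schwartz phi -> Fc (nlap phi) x xi = rho xi * Fc phi x xi.
Proof.
move=> sphi.
have s2 i : schwartz (pderiv i (pderiv i phi)) by do 2 apply: schwartz_pderiv.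
have E i : xi ord0 i ^+ 2 * Fc phi x xi = \int[mu]_y (- (pderiv i (pderiv i phi) y * cos (dotp xi (x - y)))).
  rewrite RintN; last by apply: intg_Fc; exact: schwartz_intg.
  rewrite -[X in _ = - X]/(Fc (pderiv i (pderiv i phi)) x xi) Fc_pderiv; last exact: schwartz_pderiv.
  by rewrite Fs_pderiv// opprK mulrA expr2.
rewrite rhoE mulr_suml (eq_bigr _ (fun i _ => E i)) -Rint_sum; last first.
  by move=> i _; apply: intgN; apply: intg_Fc; exact: schwartz_intg.
by apply: eq_Rintegral => y _; rewrite /nlap mulNr mulr_suml sumrN.
Qed.

Lemma FcD phi psi x xi : intg mu phi -> intg mu psi ->
  Fc (fun y => phi y + psi y) x xi = Fc phi x xi + Fc psi x xi.
Proof.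
move=> i1 i2; rewrite /Fc -RintegralD//; [|exact: intg_Fc|exact: intg_Fc].
by apply: eq_Rintegral => y _; rewrite mulrDl.
Qed.

Lemma FcZ c phi x xi : intg mu phi -> Fc (fun y => c * phi y) x xi = c * Fc phi x xi.
Proof.
move=> i1; rewrite /Fc -RintegralZl//; last exact: intg_Fc.
by apply: eq_Rintegral => y _; rewrite mulrA.
Qed.

Lemma Fc_le phi x xi : intg mu phi -> `|Fc phi x xi| <= \int[mu]_y `|phi y|.
Proof.
move=> ip; apply: Rint_norm_le; [exact: intg_Fc|exact: intg_norm|move=> y].
by rewrite normrM ler_piMr// cos_max.
Qed.

(** Replacing [phi] by [phi - Delta phi] multiplies the transform by [1 + |xi|^2]; each replacement
    gains two powers of decay. The bound is uniform in [x], which enters only through the phase. *)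
Lemma Fc_decay N phi : schwartz phi -> exists M, forall x xi, `|Fc phi x xi| <= M * wt (2 * N) xi.
Proof.
elim: N phi => [|N IH] phi sphi.
  exists (\int[mu]_y `|phi y|) => x xi; rewrite /wt muln0 expr0 invr1 mulr1.
  by apply: Fc_le; exact: schwartz_intg.
have snp := schwartz_nlap sphi.
have [M HM] := IH _ (schwartzD sphi snp); exists (2 * M) => x xi.
have := HM x xi; rewrite FcD; [|exact: schwartz_intg|exact: schwartz_intg].
rewrite Fc_nlap// -[X in X + _]mul1r -mulrDl normrM ger0_norm ?addr_ge0 ?rho_ge0// => H.
have W : wt (2 * N) xi = (1 + `|xi|) ^+ 2 * wt (2 * N.+1) xi.
  by rewrite /wt mulnS exprD invfM mulrA divff ?mul1r// lt0r_neq0// wnumX_gt0.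
have L : (1 + `|xi|) ^+ 2 <= 2 * (1 + rho xi).
  have := rho_ge_norm xi; have := sqr_ge0 (1 - `|xi|); nra.
have M0 : 0 <= M.
  have := HM x xi; move=> /(le_trans (normr_ge0 _)); rewrite pmulr_lge0//; exact: wt_gt0.
have r0 : 0 < 1 + rho xi by rewrite ltr_pwDl// rho_ge0.
rewrite -(ler_pM2l r0); apply: (le_trans H); rewrite W.
have -> : (1 + rho xi) * (2 * M * wt (2 * N.+1) xi) = M * ((2 * (1 + rho xi)) * wt (2 * N.+1) xi) by ring.
by rewrite ler_wpM2l// ler_wpM2r// wt_ge0.
Qed.

Lemma measurable_Fc d (T : measurableType d) (f g : T -> rn) phi : intg mu phi ->
  measurable_fun setT f -> measurable_fun setT g ->
  measurable_fun setT (fun t => Fc phi (f t) (g t)).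
Proof.
move=> ip mf mg; apply: (@measurable_Rint _ _ _ _ _ _ _ (fun y => `|phi y|)).
- apply: measurable_funM.
    exact: measurableT_comp (intg_measurable ip) measurable_snd.
  apply: measurable_cosf; apply: measurable_phase; [| |exact: measurable_snd].
    exact: measurableT_comp mg measurable_fst.
  exact: measurableT_comp mf measurable_fst.
- exact: intg_norm.
- by move=> t y; rewrite normrM ler_piMr// cos_max.
Qed.

Lemma absD_symbol_le (s : R) phi : 0 <= s -> schwartz phi ->
  exists M, forall x xi, `|enorm xi `^ s * Fc phi x xi| <= M * wt (2 * n) xi.
Proof.
move=> s0 sphi; have [N [C HC]] := @powR_enorm_le R n s s0.
have [M HM] := Fc_decay (N + n) sphi; exists (C * M) => x xi; rewrite normrM.
apply: (@le_trans _ _ ((C * (1 + `|xi|) ^+ N) * (M * wt (2 * (N + n)) xi))).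
  by rewrite ler_pM.
have C0 : 0 <= C by have := le_trans (normr_ge0 _) (HC 0); rewrite normr0 addr0 expr1n mulr1.
have M0 : 0 <= M.
  by have := le_trans (normr_ge0 _) (HM 0 0); rewrite pmulr_lge0// wt_gt0.
rewrite mulrACA ler_wpM2l ?mulr_ge0//.
rewrite mulnDr /wt exprD invfM mulrA ler_piMl// ?invr_ge0 ?exprn_ge0 ?addr_ge0//.
rewrite ler_pdivrMr ?wnumX_gt0// mul1r ler_weXn2l ?wnum_ge1// mul2n -addnn leq_addr//.
Qed.

Lemma intg_absD (s : R) phi x : 0 <= s -> schwartz phi ->
  intg mu (fun xi => enorm xi `^ s * Fc phi x xi).
Proof.
move=> s0 sphi; have [M HM] := absD_symbol_le s0 sphi.
apply: (@intg_le _ _ _ _ _ (fun xi => M * wt (2 * n) xi)) => //.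
  apply: measurable_funM; first exact: measurable_powR_enorm.
  by apply: measurable_Fc => //; exact: schwartz_intg.
by apply: intgZl; exact: intg_wt.
Qed.

Lemma absDE (s : R) phi x : schwartz phi ->
  absD s phi x = (2 * pi) ^- n * \int[mu]_xi (enorm xi `^ s * Fc phi x xi).
Proof.
move=> sphi; rewrite /absD /inv_fourier /cintegral /=; rewrite mul0r subr0; congr (_ * _).
have si := schwartz_intg sphi.
apply: eq_Rintegral => xi _.
have E1 : \int[mu]_y complex.Re (expi (- dotp y xi) * (phi y)%:C%C) = Fc phi 0 xi.
  apply: eq_Rintegral => y _ /=.
  by rewrite mulr0 subr0 mulrC sub0r dotpNr [dotp xi y]dotpC.
have E2 : \int[mu]_y complex.Im (expi (- dotp y xi) * (phi y)%:C%C) = Fs phi 0 xi.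
  apply: eq_Rintegral => y _ /=.
  by rewrite mulr0 add0r mulrC sub0r dotpNr [dotp xi y]dotpC.
rewrite E1 E2 /= !mul0r subr0 addr0.
rewrite mulrCA [X in _ - X]mulrCA -mulrBr; congr (_ * _).
rewrite /Fc /Fs -!RintegralZl//; [|exact: intg_Fs|exact: intg_Fc].
rewrite -RintegralB//; [|by apply: intgZl; exact: intg_Fc|by apply: intgZl; exact: intg_Fs].
apply: eq_Rintegral => y _; rewrite sub0r dotpNr dotpBr cosB cosN sinN [dotp x xi]dotpC; ring.
Qed.

End fourier_kernels.

Section gaussian_fourier.
Context {R : realType} (n : nat).
Local Notation rn := 'rV[R]_n.
Local Notation mu := (@lebesgue_rV R n).
Implicit Types (phi : rn -> R).

Lemma schwartz_dotpM (z : rn) phi : schwartz phi -> schwartz (fun y => dotp z y * phi y).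
Proof.
move=> sphi; have H i : schwartz (fun y : rn => z ord0 i * (y ord0 i * phi y)).
  by apply: schwartzZ; exact: schwartz_coord.
have := @schwartz_sum R n _ (index_enum 'I_n) _ H.
apply: schwartz_ext => y; rewrite mulr_suml.
by apply: eq_bigr => i _; rewrite mulrA.
Qed.

(** Along the ray [t z] integration by parts gives [j'(t) = - (t rho(z) / (2 a)) j(t)]. The function
    [P] is [j] times the integrating factor, hence constant, and [j 0] is the Gaussian integral. *)
Lemma Fc_gauss (a : R) (z : rn) : 0 < a ->
  Fc (gE a 0) 0 z = Num.sqrt (pi / a) ^+ n * expR (- (rho z / (4%:R * a))).
Proof.
move=> a0; have sg := @gE_schwartz R n a 0 a0.
pose j (s : R) := Fc (gE a 0) 0 (s *: z).
have dj (t : R) : is_derive t (1 : R) j (- (t * rho z / (2 * a)) * j t).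
  pose f1 (y : rn) := - (dotp z (- y)) * gE a 0 y * sin (t * dotp z (- y)).
  have if1 : intg mu f1.
    apply: (@intg_mul_bounded _ _ _ mu (fun y => - (dotp z (- y)) * gE a 0 y) (fun y => sin (t * dotp z (- y))) 1).
    - apply: (@intg_eq _ _ _ _ (fun y => dotp z y * gE a 0 y)).
        by move=> y; rewrite dotpNr opprK.
      by apply: schwartz_intg; exact: schwartz_dotpM.
    - apply: measurable_sinf; apply: measurable_funM => //; apply: measurable_dotp => //.
      rewrite (_ : -%R = (fun y : rn => 0 - y)); last by apply/funext => y; rewrite sub0r.
      by apply: measurable_funB_rV => //; exact: measurable_id.
    - by move=> y; exact: sin_max.
  have -> : j = (fun s => \int[mu]_y (gE a 0 y * cos (s * dotp z (- y)))).
    by apply/funext => s; apply: eq_Rintegral => y _; rewrite sub0r dotpZl.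
  apply: isd_eq (@is_derive_Rint _ _ _ mu (fun s y => gE a 0 y * cos (s * dotp z (- y))) f1
    (fun y => dotp z y * (dotp z y * gE a 0 y)) t _ if1 _ _) _.
  - move=> u; apply: (@intg_eq _ _ _ _ (fun y => gE a 0 y * cos (dotp (u *: z) (0 - y)))).
      by move=> y; rewrite sub0r dotpZl.
    by apply: intg_Fc; exact: schwartz_intg.
  - by apply: schwartz_intg; do 2 apply: schwartz_dotpM.
  - move=> h y; rewrite /f1.
    set e := gE a 0 y; set b := dotp z (- y).
    have e0 : 0 <= e by rewrite /e /gE mul0r cos0 mulr1 expR_ge0.
    have -> : e * cos ((t + h) * b) - e * cos (t * b) - h * (- b * e * sin (t * b)) =
      e * (cos ((t + h) * b) - cos (t * b) - h * (- b * sin (t * b))) by ring.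
    rewrite normrM ger0_norm//.
    have -> : h ^+ 2 * (dotp z y * (dotp z y * e)) = e * (h ^+ 2 * b ^+ 2) by rewrite /b dotpNr; ring.
    by rewrite ler_wpM2l// cos_taylor.
  have E i : \int[mu]_y (z ord0 i * (y ord0 i * gE a 0 y * sin (dotp (t *: z) (0 - y)))) =
      - (t * (z ord0 i) ^+ 2 / (2 * a)) * j t.
    have := @Fs_pderiv R n i _ 0 (t *: z) sg.
    rewrite mxE -/(j t) => H.
    have -> : - (t * z ord0 i ^+ 2 / (2 * a)) * j t = - (z ord0 i / (2 * a)) * (t * z ord0 i * j t).
      by field; exact: lt0r_neq0.
    rewrite -H /Fs -RintegralZl//; last first.
      by apply: intg_Fs; apply: schwartz_intg; exact: schwartz_pderiv.
    apply: eq_Rintegral => y _; have [_ ->] := @gE_pderiv R n a 0 y.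
    by rewrite mul0r addr0; field; exact: lt0r_neq0.
  transitivity (\sum_i \int[mu]_y (z ord0 i * (y ord0 i * gE a 0 y * sin (dotp (t *: z) (0 - y))))).
    rewrite -Rint_sum; last first.
      move=> i _; apply: intgZl; apply: intg_Fs; apply: schwartz_intg.
      exact: schwartz_coord.
    apply: eq_Rintegral => y _; rewrite /f1 sub0r dotpZl dotpNr opprK.
    by rewrite /dotp !mulr_suml; apply: eq_bigr => i _; ring.
  rewrite (eq_bigr _ (fun i _ => E i)) -mulr_suml sumrN -mulr_suml -mulr_sumr -rhoE; congr (_ * _).
  by apply: eq_Rintegral => y _; rewrite sub0r dotpZl.
pose P (t : R) := expR (t ^+ 2 * (rho z / (4%:R * a))) * j t.
have dP (t : R) : is_derive t (1 : R) P 0.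
  have d1 : is_derive t (1 : R) (fun t => t ^+ 2 * (rho z / (4%:R * a))) (t * (rho z / (2 * a))).
    have := isdZ (rho z / (4%:R * a)) (isdM (isd_id t) (isd_id t)).
    rewrite (_ : (fun x : R => _) = (fun t => t ^+ 2 * (rho z / (4%:R * a)))); last first.
      by apply/funext => u; rewrite mulrC expr2.
    by move=> H; apply: isd_eq H _; field; exact: lt0r_neq0.
  have := isdM (isd_comp (is_derive_expR _) d1) (dj t).
  by move=> H; apply: isd_eq H _; field; exact: lt0r_neq0.
have P01 : P 1 = P 0.
  have cP := is_derive_continuous dP.
  have [c _] := MVT_segment (@ler01 R) (fun u _ => dP u) (continuous_subspaceT cP).
  by rewrite mul0r => /eqP; rewrite subr_eq0 => /eqP.
have j0 : j 0 = Num.sqrt (pi / a) ^+ n.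
  rewrite /j -Rint_gauss// /Fc; apply: eq_Rintegral => y _.
  by rewrite scale0r dotpC dotpC dotpZl_0 || rewrite dotpZl mul0r cos0 mulr1.
move: P01; rewrite /P expr1n mul1r expr0n/= mul0r expR0 mul1r j0 /j scale1r => <-.
by rewrite mulrC mulrA -expRD addNr expR0 mul1r.
Qed.

(** The heat kernel at time 1, so that [cv s heat] is the heat flow at time [s^2]. *)
Definition heat (y : rn) : R := (2 * Num.sqrt pi) ^- n * gE (4%:R^-1) 0 y.

Lemma quarter_gt0 : 0 < (4%:R^-1 : R). Proof. by rewrite invr_gt0. Qed.

Lemma schwartz_heat : schwartz heat.
Proof. by apply: schwartzZ; apply: gE_schwartz; exact: quarter_gt0. Qed.

Lemma Rint_heat : \int[mu]_y heat y = 1.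
Proof.
rewrite RintegralZl//; last by apply: schwartz_intg; apply: gE_schwartz; exact: quarter_gt0.
rewrite Rint_gauss ?quarter_gt0// invrK sqrtrM ?pi_ge0//.
rewrite (_ : 4%:R = 2 ^+ 2 :> R); last by rewrite -natrX.
by rewrite sqrtr_sqr ger0_norm// [_ * 2]mulrC mulVf// expf_neq0// mulf_neq0// gt_eqF// sqrtr_gt0 pi_gt0.
Qed.

(** Fubini exchanges the integrals, [Fc_gauss] evaluates the one over [xi], and a reflection
    followed by a dilation produces the heat kernel. *)
Lemma heat_fourier (s : R) phi x : 0 < s -> schwartz phi ->
  (2 * pi) ^- n * \int[mu]_xi (gE (s ^+ 2) 0 xi * Fc phi x xi) = cv s heat phi x.
Proof.
move=> s0 sphi; have s20 : 0 < s ^+ 2 by rewrite exprn_gt0.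
have ig := schwartz_intg (@gE_schwartz R n (s ^+ 2) 0 s20).
have ip := schwartz_intg sphi.
pose f xi y := gE (s ^+ 2) 0 xi * (phi y * cos (dotp xi (x - y))).
have iy xi : intg mu (f xi) by apply: intgZl; exact: intg_Fc.
have ixi y : intg mu (f ^~ y).
  apply: (@intg_eq _ _ _ _ (fun xi => phi y * (gE (s ^+ 2) 0 xi * cos (dotp (x - y) (0 - xi))))).
    by move=> xi; rewrite sub0r dotpNr cosN dotpC /f; ring.
  by apply: intgZl; exact: intg_Fc.
have mf : measurable_fun setT (fun z : rn * rn => f z.1 z.2).
  apply: measurable_funM; first exact: measurableT_comp (intg_measurable ig) measurable_fst.
  apply: measurable_funM; first exact: measurableT_comp (intg_measurable ip) measurable_snd.
  by apply: measurable_cosf; apply: measurable_phase; [exact: measurable_fst|exact: measurable_cst|exact: measurable_snd].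
have if_ : intg (mu \x mu)%E (fun z => f z.1 z.2).
  apply: (@intg_prodP _ _ _ _ _ mu mu f (fun xi => `|gE (s ^+ 2) 0 xi| * \int[mu]_y `|phi y|)) => //.
    move=> xi; rewrite -RintegralZl//; last exact: intg_norm.
    apply: (le_trans (ler_norm _)); apply: Rint_norm_le; first by apply: intg_norm; exact: iy.
      by apply: intgZl; exact: intg_norm.
    move=> y; rewrite normr_id !normrM ler_wpM2l// ler_piMr// cos_max//.
  by apply: intgZr; exact: intg_norm.
have -> : \int[mu]_xi (gE (s ^+ 2) 0 xi * Fc phi x xi) = \int[mu]_xi \int[mu]_y f xi y.
  apply: eq_Rintegral => xi _; have := RintZl (gE (s ^+ 2) 0 xi) (intg_Fc x xi ip).
  exact: esym.
have -> : \int[mu]_xi \int[mu]_y f xi y = \int[mu]_y \int[mu]_xi f xi y.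
  by case: (RFubini if_ iy ixi).
have -> : \int[mu]_y \int[mu]_xi f xi y =
   \int[mu]_y (phi y * (Num.sqrt (pi / s ^+ 2) ^+ n * expR (- (rho (x - y) / (4%:R * s ^+ 2))))).
  apply: eq_Rintegral => y _; rewrite -Fc_gauss// /Fc -RintegralZl//; last exact: intg_Fc.
  by apply: eq_Rintegral => xi _; rewrite sub0r dotpNr cosN [dotp (x - y) _]dotpC /f; ring.
pose g y := phi (x - y) * expR (- (rho y / (4%:R * s ^+ 2))).
have ge y : expR (- (rho y / (4%:R * s ^+ 2))) = gE ((4%:R * s ^+ 2)^-1) 0 y.
  by rewrite /gE mul0r cos0 mulr1 mulNr mulrC.
have q0 : 0 < (4%:R * s ^+ 2)^-1 by rewrite invr_gt0 mulr_gt0.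
have ig' : intg mu g.
  apply: (@intg_eq _ _ _ _ (fun y => gE ((4%:R * s ^+ 2)^-1) 0 y * phi (x - 1 *: y))).
    by move=> y; rewrite /g ge mulrC scale1r.
  apply: intg_cv; [|exact: schwartz_measurable|exact: schwartz_bounded].
  by apply: kern_schwartz; exact: gE_schwartz.
rewrite -[X in _ * X]/(\int[mu]_y (fun y => phi y * (Num.sqrt (pi / s ^+ 2) ^+ n * expR (- (rho (x - y) / (4%:R * s ^+ 2))))) y).
have -> : \int[mu]_y (fun y => phi y * (Num.sqrt (pi / s ^+ 2) ^+ n * expR (- (rho (x - y) / (4%:R * s ^+ 2))))) y =
   Num.sqrt (pi / s ^+ 2) ^+ n * \int[mu]_y g y.
  rewrite -(Rint_reflect x ig') -RintegralZl//; last exact: intg_reflect.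
  by apply: eq_Rintegral => y _; rewrite /g subKr; ring.
rewrite (@Rint_affine R n s 0 g) ?gt_eqF// ger0_norm ?ltW// /cv.
have ic : intg mu (fun y => gE 4%:R^-1 0 y * phi (x - s *: y)).
  apply: intg_cv; [|exact: schwartz_measurable|exact: schwartz_bounded].
  by apply: kern_schwartz; apply: gE_schwartz; exact: quarter_gt0.
have -> : \int[mu]_y (heat y * phi (x - s *: y)) =
    (2 * Num.sqrt pi) ^- n * \int[mu]_y (gE 4%:R^-1 0 y * phi (x - s *: y)).
  by rewrite -RintegralZl//; apply: eq_Rintegral => y _; rewrite /heat mulrA.
rewrite !mulrA; congr (_ * _).
  rewrite sqrtrM ?pi_ge0// sqrtrV ?sqr_ge0// sqrtr_sqr ger0_norm ?ltW//.
  rewrite -!exprVn -!exprMn; congr (_ ^+ n).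
  rewrite -{1}(sqr_sqrtr (@pi_ge0 R)); set r := Num.sqrt pi.
  have r0 : r != 0 by rewrite gt_eqF// sqrtr_gt0 pi_gt0.
  by field; rewrite r0 gt_eqF.
apply: eq_Rintegral => y _; rewrite addr0 /g /gE mul0r cos0 mulr1 rho_scale mulrC.
by congr (expR _ * _); field; rewrite gt_eqF.
Qed.

Lemma cv_limit0 phi x : schwartz phi ->
  cv m.+1%:R^-1 heat phi x @[m --> \oo] --> phi x.
Proof.
move=> sphi; have [M HM] := schwartz_bounded sphi.
have ih := schwartz_intg schwartz_heat.
have E : phi x = \int[mu]_y (heat y * phi x).
  by rewrite RintegralZr// Rint_heat mul1r.
rewrite [X in _ --> X]E.
have [|||||_ //] := Rint_cvg (mu := mu) (fun m y => heat y * phi (x - m.+1%:R^-1 *: y)) (fun y => heat y * phi x)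
  (fun y => `|heat y| * M).
- move=> m; apply: measurable_funM; first exact: intg_measurable ih.
  by apply: measurable_translate; exact: schwartz_measurable.
- by apply: measurable_funM => //; exact: intg_measurable ih.
- by apply: intgZr; exact: intg_norm.
- by move=> m y; rewrite normrM ler_wpM2l.
move=> y; apply: cvgM; first exact: cvg_cst.
apply: (@cvg_comp _ _ _ (fun m : nat => x - m.+1%:R^-1 *: y) phi _ (nbhs x)); last exact: schwartz_continuous.
suff : (x - m.+1%:R^-1 *: y) @[m --> \oo] --> x - 0 *: y by rewrite scale0r subr0.
apply: cvgB; first exact: cvg_cst.
by apply: cvgZl; exact: cvg_harmonic.
Qed.

(** Gaussian summation: as the scale in [heat_fourier] tends to 0, the multiplier tends to 1 under
    domination and the heat flow tends to [phi x]. *)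
Lemma fourier_inversion phi x : schwartz phi ->
  (2 * pi) ^- n * \int[mu]_xi Fc phi x xi = phi x.
Proof.
move=> sphi.
have [M HM] := @absD_symbol_le R n 0 phi (lexx _) sphi.
have F0 xi : enorm xi `^ 0 * Fc phi x xi = Fc phi x xi by rewrite powRr0 mul1r.
have iF : intg mu (Fc phi x) by apply: intg_eq F0 _; exact: intg_absD.
have := @Rint_cvg _ _ _ mu (fun m xi => gE (m.+1%:R^-1 ^+ 2) 0 xi * Fc phi x xi) (Fc phi x)
  (fun xi => `|Fc phi x xi|) _ (intg_measurable iF) (intg_norm iF).
have h1 m : measurable_fun setT (fun xi : rn => gE (m.+1%:R^-1 ^+ 2) 0 xi * Fc phi x xi).
  apply: measurable_funM; last exact: intg_measurable iF.
  by apply: schwartz_measurable; apply: gE_schwartz; rewrite exprn_gt0.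
have gle (m : nat) (xi : rn) : `|gE (m.+1%:R^-1 ^+ 2) 0 xi| <= 1 :> R.
  apply: (le_trans (gE_le _ _ _)); rewrite -expR0 ler_expR mulNr oppr_le0 mulr_ge0 ?sqr_ge0// rho_ge0//.
move=> /(_ h1) H; have {H} [||_ H] := H.
- by move=> m xi; rewrite normrM ler_piMl.
- move=> xi; rewrite -[X in _ --> X]mul1r; apply: cvgM; last exact: cvg_cst.
  have c : continuous (fun t : R => expR (- t ^+ 2 * rho xi)).
    move=> t; apply: continuous_comp; last exact: continuous_expR.
    by apply: cvgM; [apply: cvgN; apply: exprn_continuous|exact: cvg_cst].
  have := c 0; rewrite /continuous_at expr0n/= oppr0 mul0r expR0 => c0.
  have := cvg_comp _ _ (@cvg_harmonic R) c0; apply: cvg_trans.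
  rewrite (_ : (fun _ => _) = (fun t : R => expR (- t ^+ 2 * rho xi)) \o harmonic)//.
  by apply/funext => m; rewrite /gE mul0r cos0 mulr1.
have H' : (2 * pi) ^- n * \int[mu]_xi (gE (m.+1%:R^-1 ^+ 2) 0 xi * Fc phi x xi) @[m --> \oo]
   --> (2 * pi) ^- n * \int[mu]_xi Fc phi x xi by apply: cvgM; [exact: cvg_cst|exact: H].
have := cv_limit0 (x := x) sphi.
rewrite (_ : (fun m => cv m.+1%:R^-1 heat phi x) =
   (fun m => (2 * pi) ^- n * \int[mu]_xi (gE (m.+1%:R^-1 ^+ 2) 0 xi * Fc phi x xi))).
  by move=> H2; exact: (cvg_unique _ H' H2).
by apply/funext => m; rewrite heat_fourier.
Qed.

Lemma absD0 phi : schwartz phi -> absD 0 phi = phi.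
Proof.
move=> sphi; apply/funext => x; rewrite absDE// -[RHS]fourier_inversion//; congr (_ * _).
by apply: eq_Rintegral => xi _; rewrite powRr0 mul1r.
Qed.

Lemma absD_2 phi : schwartz phi -> absD 2 phi = nlap phi.
Proof.
move=> sphi; apply/funext => x; rewrite absDE// -[RHS]fourier_inversion//; last exact: schwartz_nlap.
congr (_ * _); apply: eq_Rintegral => xi _.
by rewrite powR_enorm2 Fc_nlap.
Qed.

End gaussian_fourier.

(** * Boundedness, homogeneity and symmetry of |D|^s *)

Section absD_properties.
Context {R : realType} (n : nat).
Local Notation rn := 'rV[R]_n.
Local Notation mu := (@lebesgue_rV R n).
Implicit Types (phi kappa : rn -> R).

Lemma absD_bounded (s : R) phi : 0 <= s -> schwartz phi -> exists M, forall x, `|absD s phi x| <= M.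
Proof.
move=> s0 sphi; have [M HM] := @absD_symbol_le R n s phi s0 sphi.
exists ((2 * pi) ^- n * \int[mu]_xi (M * wt (2 * n) xi)) => x; rewrite absDE// normrM.
have p0 : 0 <= (2 * pi : R) ^- n by rewrite invr_ge0 exprn_ge0// mulr_ge0// pi_ge0.
rewrite ger0_norm//; apply: ler_wpM2l => //; apply: Rint_norm_le => //; first exact: intg_absD.
by apply: intgZl; exact: intg_wt.
Qed.

Lemma absD_scale (s c : R) phi x : 0 <= s -> 0 < c -> schwartz phi ->
  absD s (fun y => phi (c *: y)) x = c `^ s * absD s phi (c *: x).
Proof.
move=> s0 c0 sphi; have cn0 : c != 0 by rewrite gt_eqF.
have sphic : schwartz (fun y => phi (c *: y)).
  by apply: schwartz_ext (schwartz_affine 0 cn0 sphi) => y; rewrite addr0.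
have H xi : Fc (fun y => phi (c *: y)) x (c *: xi) = c ^- n * Fc phi (c *: x) xi.
  rewrite /Fc (@Rint_affine R n c 0 (fun y => phi y * cos (dotp xi (c *: x - y))))//; last first.
    by apply: intg_Fc; exact: schwartz_intg.
  rewrite ger0_norm ?ltW// mulrA mulVf ?expf_neq0// mul1r; apply: eq_Rintegral => y _.
  by rewrite addr0 dotpZl -scalerBr dotpZr.
rewrite !absDE//.
have enormZ xi : enorm (c *: xi) = c * enorm xi.
  by rewrite /enorm -!/(rho _) rho_scale sqrtrM ?sqr_ge0// sqrtr_sqr ger0_norm ?ltW.
pose G xi := enorm xi `^ s * Fc (fun y => phi (c *: y)) x xi.
have iG : intg mu G by exact: intg_absD.
suff E : \int[mu]_xi G xi = c `^ s * \int[mu]_xi (enorm xi `^ s * Fc phi (c *: x) xi).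
  by rewrite -/(\int[mu]_xi G xi) E mulrCA.
rewrite (Rint_affine 0 cn0 iG) -(RintZl _ (intg_affine 0 cn0 iG)).
rewrite -(RintZl _ (intg_absD (c *: x) s0 sphi)).
apply: eq_Rintegral => xi _; rewrite /G addr0 H enormZ (ger0_norm (ltW c0)) powRM ?sqrtr_ge0 ?(ltW c0)//.
by field; rewrite expf_neq0.
Qed.

Lemma Fc_symmetric phi kappa (y xi : rn) : schwartz phi -> schwartz kappa ->
  \int[mu]_x (kappa (x - y) * Fc phi x xi) = \int[mu]_w (phi w * Fc kappa (w - y) xi).
Proof.
move=> sphi skap; have ip := schwartz_intg sphi; have ik := schwartz_intg skap.
have ik' : intg mu (fun x => kappa (x - y)) by exact: intg_shift.
pose f x w := kappa (x - y) * (phi w * cos (dotp xi (x - w))).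
have iw x : intg mu (f x) by apply: intgZl; exact: intg_Fc.
have E w x : f x w = phi w * (kappa (x - y) * cos (dotp xi (w - x))).
  by rewrite /f -[w - x]opprB dotpNr cosN; ring.
have ix w : intg mu (f ^~ w).
  apply: (@intg_eq _ _ _ mu (fun x => phi w * (kappa (x - y) * cos (dotp xi (w - x)))) (f ^~ w)).
    by move=> x; rewrite E.
  by apply: intgZl; exact: intg_Fc.
have mf : measurable_fun setT (fun z : rn * rn => f z.1 z.2).
  apply: measurable_funM; first exact: measurableT_comp (intg_measurable ik') measurable_fst.
  apply: measurable_funM; first exact: measurableT_comp (intg_measurable ip) measurable_snd.
  by apply: measurable_cosf; apply: measurable_phase; [exact: measurable_cst|exact: measurable_fst|exact: measurable_snd].
have if_ : intg (mu \x mu)%E (fun z => f z.1 z.2).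
  apply: (@intg_prodP _ _ _ _ _ mu mu f (fun x => `|kappa (x - y)| * \int[mu]_y `|phi y|)) => //.
    move=> x; rewrite -RintZl//; last exact: intg_norm.
    apply: (le_trans (ler_norm _)); apply: Rint_norm_le; first by apply: intg_norm; exact: iw.
      by apply: intgZl; exact: intg_norm.
    move=> w; rewrite normr_id !normrM ler_wpM2l// ler_piMr// cos_max//.
  by apply: intgZr; exact: intg_norm.
have -> : \int[mu]_x (kappa (x - y) * Fc phi x xi) = \int[mu]_x \int[mu]_w f x w.
  by apply: eq_Rintegral => x _; exact: esym (RintZl _ (intg_Fc x xi ip)).
have -> : \int[mu]_x \int[mu]_w f x w = \int[mu]_w \int[mu]_x f x w.
  by case: (RFubini if_ iw ix).
apply: eq_Rintegral => w _.
have -> : \int[mu]_x f x w = phi w * \int[mu]_x (kappa (x - y) * cos (dotp xi (w - x))).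
  by rewrite -RintZl; [apply: eq_Rintegral => x _; rewrite E|exact: intg_Fc].
congr (_ * _).
rewrite -(Rint_shift y (intg_Fc w xi ik')); apply: eq_Rintegral => x _.
by rewrite addrK opprD addrA addrAC.
Qed.

(** Moves [|D|^s] from a test function to a convolution kernel. By [W] each side is an integral over
    [xi] of [|xi|^s] times a pairing, and the pairings agree by [Fc_symmetric]. *)
Lemma absD_symmetric (s : R) phi kappa (y : rn) : 0 <= s -> schwartz phi -> schwartz kappa ->
  \int[mu]_x (kappa (x - y) * absD s phi x) = \int[mu]_w (phi w * absD s kappa (w - y)).
Proof.
move=> s0 sphi skap.
have W (f g : rn -> R) (v : rn) : schwartz f -> schwartz g ->
    \int[mu]_x (g x * absD s f (x + v)) =
    (2 * pi) ^- n * \int[mu]_xi (enorm xi `^ s * \int[mu]_x (g x * Fc f (x + v) xi)).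
  move=> sf sg; have ig := schwartz_intg sg.
  pose F x xi := g x * (enorm xi `^ s * Fc f (x + v) xi).
  have [M HM] := @absD_symbol_le R n s f s0 sf.
  have M0 : 0 <= M by have := le_trans (normr_ge0 _) (HM 0 0); rewrite pmulr_lge0// wt_gt0.
  have mff xi : measurable_fun setT (fun x : rn => Fc f (x + v) xi).
    apply: measurable_Fc; [exact: schwartz_intg| |exact: measurable_cst].
    by apply: measurable_funD_rV; [exact: measurable_id|exact: measurable_cst].
  have igF xi : intg mu (fun x => g x * Fc f (x + v) xi).
    apply: (@intg_mul_bounded _ _ _ mu g _ (\int[mu]_y `|f y|)) => // x.
    by apply: Fc_le; exact: schwartz_intg.
  have ixi x : intg mu (F x) by apply: intgZl; exact: intg_absD.
  have ix xi : intg mu (F ^~ xi).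
    apply: (@intg_eq _ _ _ _ (fun x => enorm xi `^ s * (g x * Fc f (x + v) xi))).
      by move=> x; rewrite /F mulrCA.
    exact: intgZl.
  have mF : measurable_fun setT (fun z : rn * rn => F z.1 z.2).
    apply: measurable_funM; first exact: measurableT_comp (intg_measurable ig) measurable_fst.
    apply: measurable_funM; first exact: measurableT_comp (@measurable_powR_enorm R n s) measurable_snd.
    apply: measurable_Fc; [exact: schwartz_intg| |exact: measurable_snd].
    by apply: measurable_funD_rV; [exact: measurable_fst|exact: measurable_cst].
  have iF : intg (mu \x mu)%E (fun z => F z.1 z.2).
    apply: (@intg_prodP _ _ _ _ _ mu mu F (fun x => `|g x| * \int[mu]_y (M * wt (2 * n) y))) => //.
      move=> x; rewrite -RintZl; last by apply: intgZl; exact: intg_wt.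
      apply: (le_trans (ler_norm _)); apply: Rint_norm_le; first by apply: intg_norm; exact: ixi.
        by apply: intgZl; apply: intgZl; exact: intg_wt.
      by move=> xi; rewrite normr_id normrM ler_wpM2l.
    by apply: intgZr; exact: intg_norm.
  have -> : \int[mu]_x (g x * absD s f (x + v)) = (2 * pi) ^- n * \int[mu]_x \int[mu]_xi F x xi.
    have [i1 _ _] := RFubini iF ixi ix.
    rewrite -RintZl//; apply: eq_Rintegral => x _; rewrite absDE// mulrCA; congr (_ * _).
    exact: esym (RintZl _ (intg_absD (x + v) s0 sf)).
  congr (_ * _); have -> : \int[mu]_x \int[mu]_xi F x xi = \int[mu]_xi \int[mu]_x F x xi.
    by case: (RFubini iF ixi ix).
  by apply: eq_Rintegral => xi _; rewrite -RintZl//; apply: eq_Rintegral => x _; rewrite /F mulrCA.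
have skap' : schwartz (fun x => kappa (x - y)).
  by apply: schwartz_ext (schwartz_affine (- y) (oner_neq0 _) skap) => x; rewrite scale1r.
transitivity (\int[mu]_x (kappa (x - y) * absD s phi (x + 0))).
  by apply: eq_Rintegral => x _; rewrite addr0.
apply: (etrans (W _ _ 0 sphi skap')); apply: (etrans _ (esym (W _ _ (- y) skap sphi))).
apply: (congr1 (GRing.mul _)); apply: eq_Rintegral => xi _; apply: (congr1 (GRing.mul _)).
apply: (etrans _ (Fc_symmetric y xi sphi skap)).
by apply: eq_Rintegral => x _; rewrite addr0.
Qed.

End absD_properties.

(** * Integrability of |D|^s phi *)

Section subordination_weight.
Context {R : realType}.
Local Notation lam := (@lebesgue_measure R).
Implicit Types (a v : R).

Lemma expR_abs_le a v : 0 < a -> expR (- (a * `|v|)) <= (1 + 4%:R / a ^+ 2) * (1 + v ^+ 2)^-1.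
Proof.
move=> a0; have v2 : 0 < 1 + v ^+ 2 by rewrite ltr_pwDl// sqr_ge0.
rewrite ler_pdivlMr// expRN mulrC ler_pdivrMr ?expR_gt0//.
have h : (1 + a * `|v| / 2) ^+ 2 <= expR (a * `|v|).
  have -> : expR (a * `|v|) = expR (a * `|v| / 2) ^+ 2.
    by rewrite -expRM_natl; congr expR; field.
  have t0 : 0 <= a * `|v| / 2 by rewrite divr_ge0// mulr_ge0// ltW.
  move: t0; set t := _ / 2 => t0.
  by apply: lerXn2r; rewrite ?nnegrE ?expR_ge0 ?expR_ge1Dx// addr_ge0.
have a2 : 0 < a ^+ 2 by rewrite exprn_gt0.
have q : 0 <= 4%:R / a ^+ 2 by rewrite divr_ge0// ltW.
apply: (@le_trans _ _ ((1 + 4%:R / a ^+ 2) * (1 + a * `|v| / 2) ^+ 2)); last first.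
  by rewrite ler_wpM2l// addr_ge0.
have vv : `|v| ^+ 2 = v ^+ 2 by rewrite real_normK ?num_real.
have -> : (1 + 4%:R / a ^+ 2) * (1 + a * `|v| / 2) ^+ 2 =
   (1 + a * `|v| + a ^+ 2 * `|v| ^+ 2 / 4%:R) + (4%:R / a ^+ 2 * (1 + a * `|v|) + `|v| ^+ 2).
  by field; rewrite gt_eqF.
rewrite vv.
have : 0 <= a * `|v| by rewrite mulr_ge0// ltW.
have : 0 <= a ^+ 2 * v ^+ 2 by rewrite mulr_ge0 ?sqr_ge0.
have : 0 <= 4%:R / a ^+ 2 * (1 + a * `|v|) by rewrite mulr_ge0// addr_ge0// mulr_ge0// ltW.
move: (v ^+ 2) (a ^+ 2 * v ^+ 2) (a * `|v|) (4%:R / a ^+ 2 * _) => p q' r t; lra.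
Qed.

Lemma intg_expR_abs a : 0 < a -> intg lam (fun v => expR (- (a * `|v|))).
Proof.
move=> a0; apply: (@intg_le _ _ _ lam _ (fun v => (1 + 4%:R / a ^+ 2) * (1 + v ^+ 2)^-1)).
- apply: continuous_measurable_fun => v; apply: continuous_comp; last exact: continuous_expR.
  by apply: cvgN; apply: cvgM; [exact: cvg_cst|exact: norm_continuous].
- by apply: intgZl; exact: intg_oneDsqrV.
- by move=> v; rewrite ger0_norm ?expR_ge0// expR_abs_le.
Qed.

Lemma measurable_expRM a : measurable_fun setT (fun v : R => expR (a * v)).
Proof.
apply: continuous_measurable_fun => v; apply: continuous_comp; last exact: continuous_expR.
by apply: cvgM; [exact: cvg_cst|exact: cvg_id].
Qed.

(** The integrand of the Gamma function in the logarithmic variable [r = e^(2 v)]; the constant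
    [subc a] is [Gamma(a / 2) / 2]. *)
Definition subh a v : R := expR (a * v - expR (2 * v)).
Definition subc a : R := \int[lam]_v subh a v.

Lemma continuous_subh a : continuous (subh a).
Proof.
move=> v; apply: continuous_comp; last exact: continuous_expR.
apply: cvgB; first by apply: cvgM; [exact: cvg_cst|exact: cvg_id].
apply: continuous_comp; last exact: continuous_expR.
by apply: cvgM; [exact: cvg_cst|exact: cvg_id].
Qed.

Lemma intg_subh a : 0 < a -> intg lam (subh a).
Proof.
move=> a0.
(* For [v >= 0], the bound [e^(2 v) >= (1 + v)^2] and the maximum [(a + 1)^2 / 4] of
   [(a + 1) v - v^2] give the constant and the decay [e^(-v)]. For [v < 0] the factor [e^(a v)] is
   enough. *)
apply: (@intg_le _ _ _ lam _ (fun v => expR ((a + 1) ^+ 2 / 4%:R) * (expR (- (1 * `|v|)) + expR (- (a * `|v|))))).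
- by apply: continuous_measurable_fun; exact: continuous_subh.
- by apply: intgZl; apply: intgD; apply: intg_expR_abs.
move=> v; rewrite ger0_norm ?expR_ge0// mulrDr -!expRD.
have [v0|v0] := lerP 0 v.
  rewrite (ger0_norm v0).
  apply: (@le_trans _ _ (expR ((a + 1) ^+ 2 / 4%:R + - (1 * v)))); last by rewrite lerDl expR_ge0.
  rewrite ler_expR.
  have : (1 + v) ^+ 2 <= expR (2 * v).
    by rewrite expRM_natl lerXn2r ?nnegrE ?expR_ge0 ?addr_ge0// expR_ge1Dx.
  have := sqr_ge0 (v - (a + 1) / 2); nra.
rewrite (ltr0_norm v0).
apply: (@le_trans _ _ (expR ((a + 1) ^+ 2 / 4%:R + - (a * - v)))); last by rewrite lerDr expR_ge0.
rewrite ler_expR mulrN opprK; have := expR_ge0 (2 * v).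
have : 0 <= (a + 1) ^+ 2 / 4%:R by rewrite divr_ge0 ?sqr_ge0.
lra.
Qed.

Lemma subc_gt0 a : 0 < a -> 0 < subc a.
Proof.
move=> a0; rewrite -lte_fin /subc (EFin_Rint (intg_subh a0)).
have m : measurable_fun setT (EFin \o subh a).
  by apply/measurable_EFinP; apply: continuous_measurable_fun; exact: continuous_subh.
apply: (@lt_le_trans _ _ (\int[lam]_(v in `[0%R, 1%R]) (expR (- expR 2))%:E)%E).
  have L : lam (`[0%R, 1%R]%classic : set R) = 1%:E.
    by rewrite lebesgue_measure_itv/= lte_fin ltr01 -EFinB subr0.
  by rewrite integral_cst// [X in (_ * X)%E]L mule1 lte_fin expR_gt0.
apply: (@le_trans _ _ (\int[lam]_(v in `[0%R, 1%R]) (subh a v)%:E)%E).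
  apply: ge0_le_integral => //=.
  - exact: measurable_funS measurableT (@subsetT _ _) m.
  move=> v; rewrite in_itv/= => /andP[v0 v1]; rewrite lee_fin ler_expR.
  have : expR (2 * v) <= expR 2 by rewrite ler_expR; lra.
  have : 0 <= a * v by rewrite mulr_ge0// ltW.
  lra.
apply: ge0_subset_integral => //= v _; by rewrite lee_fin expR_ge0.
Qed.

(** A dilation by [e] is a translation of [v] by [ln e], and translation invariance extracts the
    power [e^(-a)]. *)
Lemma sub_shift a (e : R) : 0 < a -> 0 < e ->
  intg lam (fun v => expR (a * v - expR (2 * v) * e ^+ 2)) /\
  \int[lam]_v expR (a * v - expR (2 * v) * e ^+ 2) = e `^ (- a) * subc a.
Proof.
move=> a0 e0.
have E v : expR (a * v - expR (2 * v) * e ^+ 2) = e `^ (- a) * subh a (v + ln e).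
  rewrite /subh /powR gt_eqF// -expRD; congr expR.
  rewrite mulrDr [2 * (_ + _)]mulrDr expRD [expR (2 * ln e)]expRM_natl lnK//; ring.
have m : measurable_fun setT (EFin \o subh a).
  by apply/measurable_EFinP; apply: continuous_measurable_fun; exact: continuous_subh.
have p v : (0 <= (EFin \o subh a) v)%E by rewrite lee_fin expR_ge0.
have H := ge0_integral_affine (ln e) (oner_neq0 R) m p.
rewrite normr1 mul1e in H.
have H1 : (\int[lam]_v (subh a (v + ln e))%:E = \int[lam]_v (subh a v)%:E)%E.
  by rewrite [RHS]H; apply: eq_integral => v _; rewrite /= mul1r.
have i1 : intg lam (fun v => subh a (v + ln e)).
  have ms : measurable_fun setT (fun v => subh a (v + ln e)).
    apply: continuous_measurable_fun => v; apply: continuous_comp; last exact: continuous_subh.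
    by apply: cvgD; [exact: cvg_id|exact: cvg_cst].
  apply: (intg_ltyP lam ms).2.
  rewrite (_ : integral _ _ _ = \int[lam]_v (subh a (v + ln e))%:E)%E; last first.
    by apply: eq_integral => v _; rewrite ger0_norm ?expR_ge0.
  rewrite H1; have <- := EFin_Rint (intg_subh a0); exact: ltry.
split; first by apply: (@intg_eq _ _ _ lam (fun v => e `^ (- a) * subh a (v + ln e)) _ (fun v => esym (E v))); exact: intgZl.
apply: (etrans (eq_Rint lam E)); apply: (etrans (RintZl _ i1)); apply: (congr1 (GRing.mul _)).
by rewrite /subc /Rintegral H1.
Qed.

End subordination_weight.

Section subordination.
Context {R : realType} (n : nat).
Local Notation rn := 'rV[R]_n.
Local Notation mu := (@lebesgue_rV R n).
Local Notation lam := (@lebesgue_measure R).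
Implicit Types (phi : rn -> R).

Lemma schwartz_nlapk k phi : schwartz phi -> schwartz (iter k (@nlap R n) phi).
Proof. by move=> sphi; elim: k => //= k IH; exact: schwartz_nlap. Qed.

Lemma Fc_nlapk k phi (x xi : rn) : schwartz phi ->
  Fc (iter k (@nlap R n) phi) x xi = rho xi ^+ k * Fc phi x xi.
Proof.
move=> sphi; elim: k => [|k IH] /=; first by rewrite mul1r.
by rewrite Fc_nlap ?IH ?exprS ?mulrA//; exact: schwartz_nlapk.
Qed.

Lemma cv_nlap s h phi : schwartz h -> schwartz phi ->
  cv s (nlap h) phi = (fun x => s ^+ 2 * cv s h (nlap phi) x).
Proof.
move=> sh sphi; apply/funext => x.
have sp2 i : schwartz (pderiv i (pderiv i phi)) by do 2 apply: schwartz_pderiv.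
have sh2 i : schwartz (pderiv i (pderiv i h)) by do 2 apply: schwartz_pderiv.
have icv f g : schwartz f -> schwartz g -> intg mu (fun y => f y * g (x - s *: y)).
  by move=> sf sg; apply: intg_cv; [exact: kern_schwartz|exact: schwartz_measurable|exact: schwartz_bounded].
have E i : cv s (pderiv i (pderiv i h)) phi x = s ^+ 2 * cv s h (pderiv i (pderiv i phi)) x.
  by rewrite pderiv_ibp_cv ?pderiv_ibp_cv ?expr2 ?mulrA//; exact: schwartz_pderiv.
transitivity (- \sum_i cv s (pderiv i (pderiv i h)) phi x).
  rewrite -Rint_sum; last by move=> i _; exact: icv.
  rewrite -RintN; last by apply: intg_sum => i _; exact: icv.
  by apply: eq_Rintegral => y _; rewrite /nlap mulNr mulr_suml.
rewrite (eq_bigr _ (fun i _ => E i)) -mulr_sumr -mulrN; congr (_ * _).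
rewrite -Rint_sum; last by move=> i _; exact: icv.
rewrite -RintN; last by apply: intg_sum => i _; exact: icv.
by apply: eq_Rintegral => y _; rewrite /nlap mulrN mulr_sumr.
Qed.

Lemma cv_nlapk k s h phi x : schwartz h -> schwartz phi ->
  cv s (iter k (@nlap R n) h) phi x = s ^+ (2 * k) * cv s h (iter k (@nlap R n) phi) x.
Proof.
move=> sh; elim: k phi x => [|k IH] phi x sphi /=; first by rewrite muln0 mul1r.
rewrite (cv_nlap s (schwartz_nlapk k sh) sphi) (IH _ _ (schwartz_nlap sphi)) -iterSr.
by rewrite mulrA -exprD mulnS.
Qed.

Lemma cv_sup s k phi M x : kern k -> measurable_fun setT phi -> (forall x, `|phi x| <= M) ->
  `|cv s k phi x| <= M * \int[mu]_y `|k y|.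
Proof.
move=> kk mphi HM; apply: Rint_norm_le_bound.
- by apply: intg_cv => //; exists M.
- by apply: intg_norm; exact: kern_intg.
- by move=> y; rewrite normrM mulrC ler_wpM2r.
Qed.

Lemma cv_L1 s k phi : kern k -> schwartz phi ->
  \int[mu]_x `|cv s k phi x| <= (\int[mu]_y `|k y|) * \int[mu]_y `|phi y|.
Proof.
move=> kk sphi; have ik := kern_intg kk; have ip := schwartz_intg sphi.
have bp := schwartz_bounded sphi; have [M HM] := bp.
have mp := schwartz_measurable sphi.
pose f x y := `|k y * phi (x - s *: y)|.
have iy x : intg mu (f x) by apply: intg_norm; exact: intg_cv.
have psh y : intg mu (fun x => `|phi (x - s *: y)|) by apply: intg_norm; exact: intg_shift.
have fE y : f ^~ y = (fun x => `|k y| * `|phi (x - s *: y)|).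
  by apply/funext => x; rewrite /f normrM.
have ix y : intg mu (f ^~ y) by rewrite fE; exact: intgZl.
have fint y : \int[mu]_x f x y = `|k y| * \int[mu]_y `|phi y|.
  rewrite -(Rint_shift (- (s *: y)) (intg_norm ip)) -(RintZl _ (psh y)).
  by apply: eq_Rintegral => x _; rewrite /f normrM.
have mf : measurable_fun setT (fun z : rn * rn => f z.1 z.2).
  apply: measurableT_comp => //; apply: measurable_funM.
    exact: measurableT_comp (intg_measurable ik) measurable_snd.
  apply: (measurableT_comp mp); apply: measurable_funB_rV; first exact: measurable_fst.
  by apply: measurable_funZ_rV; [exact: measurable_cst|exact: measurable_snd].
have if_ : intg (mu \x mu)%E (fun z => f z.2 z.1).
  apply: (@intg_prodP _ _ _ _ _ mu mu (fun y x => f x y) (fun y => `|k y| * \int[mu]_y `|phi y|)).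
  - exact: (measurableT_comp mf (@measurable_swap _ _ _ _)).
  - exact: ix.
  - move=> y; rewrite -fint.
    rewrite (_ : \int[mu]_x `|f x y| = \int[mu]_x f x y)//.
    by apply: eq_Rintegral => x _; rewrite normr_id.
  - by apply: intgZr; exact: intg_norm.
have [_ i2 E] := @RFubini _ _ _ _ _ mu mu (fun y x => f x y) if_ ix iy.
apply: (@le_trans _ _ (\int[mu]_x \int[mu]_y f x y)).
  apply: (le_trans (ler_norm _)); apply: Rint_norm_le.
  - by apply: intg_norm; apply: schwartz_intg; exact: schwartz_cv.
  - exact: i2.
  - move=> x; rewrite normr_id; apply: Rint_norm_le; [exact: intg_cv|exact: iy|by []].
rewrite -E {E} (eq_Rint mu fint) (RintZr _ (intg_norm ik)); exact: lexx.
Qed.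

Variables (s : R) (k : nat).
Hypotheses (s0 : 0 < s) (sk : s < (2 * k)%:R).
Let a := (2 * k)%:R - s.
Let a0 : 0 < a. Proof. by rewrite subr_gt0. Qed.

(** Apply [sub_shift] with [e = |xi|]: the product of [|xi|^(2 k)] and [|xi|^(-a)] is [|xi|^s]. At
    [xi = 0] both sides vanish, since [k] and [s] are positive. *)
Lemma sub_symbol (xi : rn) :
  intg lam (fun v => rho xi ^+ k * expR (a * v - expR (2 * v) * rho xi)) /\
  \int[lam]_v (rho xi ^+ k * expR (a * v - expR (2 * v) * rho xi)) = enorm xi `^ s * subc a.
Proof.
have e0 : 0 <= enorm xi by rewrite sqrtr_ge0.
have k0 : (0 < k)%N by have := lt_trans s0 sk; rewrite ltr0n muln_gt0.
have [z|nz] := eqVneq (enorm xi) 0.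
  have -> : rho xi = 0 by rewrite -[rho xi]enorm_sqr z expr0n.
  rewrite expr0n gtn_eqF//= z powR0 ?gt_eqF// mul0r.
  have E : (fun v => 0 * expR (a * v - expR (2 * v) * 0)) = (fun _ => 0) :> (R -> R).
    by apply/funext => v; rewrite mul0r.
  rewrite E; split; first exact: intg0.
  by rewrite /Rintegral integral0.
have e1 : 0 < enorm xi by rewrite lt_neqAle eq_sym nz.
have [i E] := sub_shift a0 e1.
rewrite /rho -enorm_sqr; split; first exact: intgZl.
rewrite RintZl// E mulrA; congr (_ * _).
rewrite -exprM -powR_mulrn// -powRD; first by congr (_ `^ _); rewrite /a; ring.
by rewrite nz implybT.
Qed.

Variables (phi : rn -> R).
Hypothesis sphi : schwartz phi.
Let psi := iter k (@nlap R n) phi.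
Let S v x := expR (a * v) * cv (expR v) (@heat R n) psi x.

Let spsi : schwartz psi. Proof. exact: schwartz_nlapk. Qed.

(* |xi|^s is a constant times the integral over v of exp((2k - s) v) |xi|^(2k) exp(-e^(2v) |xi|^2),
   so |D|^s phi is a superposition of heat flows of (-Delta)^k phi. *)
Lemma absD_sub x : intg lam (S ^~ x) /\ absD s phi x = (subc a)^-1 * \int[lam]_v S v x.
Proof.
have i0 := intg_absD x (ltW s0) sphi.
pose f xi v := Fc phi x xi * (rho xi ^+ k * expR (a * v - expR (2 * v) * rho xi)).
have iv xi : intg lam (f xi) by apply: intgZl; case: (sub_symbol xi).
have fE xi v : f xi v = expR (a * v) * (gE (expR v ^+ 2) 0 xi * Fc psi x xi).
  rewrite /f Fc_nlapk// /gE mul0r cos0 mulr1 expRD -expRM_natl mulNr; ring.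
have ev v : 0 < expR v ^+ 2 :> R by rewrite exprn_gt0// expR_gt0.
have ipsi : intg mu (Fc psi x).
  apply: (@intg_eq _ _ _ mu (fun xi => enorm xi `^ 0 * Fc psi x xi)); last exact: intg_absD.
  by move=> xi; rewrite powRr0 mul1r.
have igp v : intg mu (fun xi => gE (expR v ^+ 2) 0 xi * Fc psi x xi).
  apply: (@intg_eq _ _ _ mu (fun xi => Fc psi x xi * gE (expR v ^+ 2) 0 xi)); first by move=> xi; rewrite mulrC.
  apply: (@intg_mul_bounded _ _ _ mu _ _ 1) => //.
    by apply: schwartz_measurable; exact: gE_schwartz.
  move=> xi; apply: (le_trans (gE_le _ _ _)).
  by rewrite -expR0 ler_expR mulNr oppr_le0 mulr_ge0 ?sqr_ge0// rho_ge0.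
have ixi v : intg mu (f ^~ v).
  apply: (@intg_eq _ _ _ mu (fun xi => expR (a * v) * (gE (expR v ^+ 2) 0 xi * Fc psi x xi))).
    by move=> xi; rewrite fE.
  exact: intgZl.
have mE := @measurable_expRM R.
have mr := @measurable_rho R n.
have mf : measurable_fun setT (fun z : rn * measurableTypeR R => f z.1 z.2).
  apply: measurable_funM.
    apply: (measurableT_comp (f := Fc phi x)); last exact: measurable_fst.
    by apply: measurable_Fc => //; exact: schwartz_intg.
  apply: measurable_funM.
    by apply: measurable_funX; exact: measurableT_comp mr measurable_fst.
  apply: (measurableT_comp (continuous_measurable_fun (@continuous_expR R))).
  apply: measurable_funB.
    by apply: measurable_funM; [exact: measurable_cst|exact: measurable_snd].
  apply: measurable_funM; last exact: measurableT_comp mr measurable_fst.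
  exact: measurableT_comp (mE 2) measurable_snd.
have if_ : intg (mu \x lam)%E (fun z => f z.1 z.2).
  apply: (@intg_prodP _ _ _ _ _ mu lam f (fun xi => `|enorm xi `^ s * Fc phi x xi| * subc a)) => //.
    move=> xi; have [j J] := sub_symbol xi.
    rewrite normrM (ger0_norm (powR_ge0 _ _)) mulrAC -J mulrC -RintZl//.
    apply: (le_trans (ler_norm _)); apply: Rint_norm_le; [by apply: intg_norm; exact: iv|exact: intgZl|].
    by move=> v; rewrite normr_id normrM [`|_ * expR _|]ger0_norm// mulr_ge0 ?expR_ge0// exprn_ge0// rho_ge0.
  by apply: intgZr; exact: intg_norm.
have SE v : \int[mu]_xi f xi v = (2 * pi) ^+ n * S v x.
  rewrite (eq_Rint mu (fun xi => fE xi v)) RintZl// /S -heat_fourier ?expR_gt0//.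
  by field; rewrite expf_neq0// mulf_neq0// gt_eqF// pi_gt0.
have fint xi : \int[lam]_v f xi v = subc a * (enorm xi `^ s * Fc phi x xi).
  by have [j J] := sub_symbol xi; rewrite RintZl// J; ring.
have [_ i2 E] := RFubini if_ iv ixi.
have pn : (2 * pi : R) ^+ n != 0 by rewrite expf_neq0// mulf_neq0// gt_eqF// pi_gt0.
have iS : intg lam (S ^~ x).
  apply: (@intg_eq _ _ _ lam (fun v => (2 * pi) ^- n * \int[mu]_xi f xi v)); last exact: intgZl.
  by move=> v; rewrite SE mulrA mulVf// mul1r.
split => //; rewrite absDE//.
move: E; rewrite (eq_Rint mu fint) (eq_Rint lam SE).
rewrite (RintZl _ i0) (RintZl _ iS) => E.
apply: (mulfI (lt0r_neq0 (subc_gt0 a0))); rewrite [RHS]mulrA divff ?mul1r ?lt0r_neq0 ?subc_gt0//.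
by rewrite mulrCA E mulrA mulVf// mul1r.
Qed.

(** The weight [e^(a v)] is integrable towards minus infinity. For large [v] it grows, but moving
    [(-Delta)^k] onto the heat kernel gains [e^(-2 k v)] and leaves [e^(-s v)]. As [a] and [s] are
    positive, the L^1 norms of the flows are integrable in [v], and Fubini concludes. *)
Lemma intg_absD_L1 : intg mu (absD s phi).
Proof.
have skh := schwartz_nlapk k (schwartz_heat (R := R) (n := n)).
have kh := kern_schwartz (schwartz_heat (R := R) (n := n)); have kkh := kern_schwartz skh.
have S2 v x : S v x = expR (- (s * v)) * cv (expR v) (iter k (@nlap R n) (@heat R n)) phi x.
  rewrite cv_nlapk//; last exact: schwartz_heat.
  by rewrite /S mulrA -expRM_natl -expRD; congr (expR _ * _); rewrite /a natrM; ring.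
have [M HM] := schwartz_bounded spsi; have [M' HM'] := schwartz_bounded sphi.
pose Ev (v : R) := expR (- (a * `|v|)) + expR (- (s * `|v|)).
have iEv : intg lam Ev by apply: intgD; apply: intg_expR_abs.
(* [N] is either the absolute value at a point or the L^1 norm. Its bound [A] concerns the form of
   the flow used for [v < 0], its bound [B] the form [S2] used for [v >= 0]. *)
have key (N : (rn -> R) -> R) (A B : R) : 0 <= A -> 0 <= B ->
    (forall v, N (cv (expR v) (@heat R n) psi) <= A) ->
    (forall v, N (cv (expR v) (iter k (@nlap R n) (@heat R n)) phi) <= B) ->
    (forall (c : R) f, 0 <= c -> schwartz f -> N (fun x => c * f x) = c * N f) ->
    forall v, N (S v) <= (A + B) * Ev v.
  move=> A0 B0 HA HB HN v; rewrite /Ev mulrDr.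
  have p1 : 0 <= (A + B) * expR (- (a * `|v|)) by rewrite mulr_ge0 ?addr_ge0 ?expR_ge0.
  have p2 : 0 <= (A + B) * expR (- (s * `|v|)) by rewrite mulr_ge0 ?addr_ge0 ?expR_ge0.
  have [v0|v0] := lerP 0 v.
    rewrite (funext (S2 v)) HN ?expR_ge0//; last exact: schwartz_cv.
    apply: (@le_trans _ _ ((A + B) * expR (- (s * `|v|)))); last by rewrite lerDr.
    rewrite ger0_norm// mulrC ler_wpM2r ?expR_ge0// (le_trans (HB v))// lerDr//.
  rewrite HN ?expR_ge0//; last exact: schwartz_cv.
  apply: (@le_trans _ _ ((A + B) * expR (- (a * `|v|)))); last by rewrite lerDl.
  by rewrite ltr0_norm// mulrN opprK mulrC ler_wpM2r ?expR_ge0// (le_trans (HA v))// lerDl.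
have Jge0 f : 0 <= \int[mu]_y `|f y| :> R by apply: Rintegral_ge0 => y _.
have sup x v : `|S v x| <= (M * \int[mu]_y `|heat y| + M' * \int[mu]_y `|iter k (@nlap R n) (@heat R n) y|) * Ev v.
  apply: (key (fun f => `|f x|)).
  - by rewrite mulr_ge0// (le_trans _ (HM 0)).
  - by rewrite mulr_ge0// (le_trans _ (HM' 0)).
  - by move=> w; apply: cv_sup => //; exact: schwartz_measurable.
  - by move=> w; apply: cv_sup => //; exact: schwartz_measurable.
  - by move=> c f c0 _; rewrite normrM ger0_norm.
have L1 v : \int[mu]_x `|S v x| <= ((\int[mu]_y `|heat y|) * (\int[mu]_y `|psi y|) +
    (\int[mu]_y `|iter k (@nlap R n) (@heat R n) y|) * (\int[mu]_y `|phi y|)) * Ev v.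
  apply: (key (fun f => \int[mu]_x `|f x|)).
  - by rewrite mulr_ge0.
  - by rewrite mulr_ge0.
  - by move=> w; exact: cv_L1.
  - by move=> w; exact: cv_L1.
  - move=> c f c0 sf; rewrite -RintZl; last by apply: intg_norm; exact: schwartz_intg.
    by apply: eq_Rintegral => x _; rewrite normrM ger0_norm.
have mE := @measurable_expRM R.
have mS : measurable_fun setT (fun z : measurableTypeR R * rn => S z.1 z.2).
  apply: measurable_funM; first exact: measurableT_comp (mE a) measurable_fst.
  apply: (@measurable_Rint _ _ _ (measurableTypeR R * rn)%type _ mu
    (fun z y => heat y * psi (z.2 - expR z.1 *: y)) (fun y => `|heat y| * M)).
  - apply: measurable_funM.
      by apply: (measurableT_comp (schwartz_measurable (schwartz_heat (R := R) (n := n)))); exact: measurable_snd.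
    apply: (measurableT_comp (schwartz_measurable spsi)); apply: measurable_funB_rV.
      exact: measurableT_comp measurable_snd measurable_fst.
    apply: measurable_funZ_rV; last exact: measurable_snd.
    apply: (measurableT_comp (continuous_measurable_fun (@continuous_expR R))).
    exact: measurableT_comp measurable_fst measurable_fst.
  - by apply: intgZr; apply: intg_norm; exact: kern_intg.
  - by move=> z y; rewrite normrM ler_wpM2l.
have isx v : intg mu (S v) by apply: intgZl; apply: schwartz_intg; exact: schwartz_cv.
have iP := @intg_prodP _ _ _ _ _ lam mu S _ mS isx L1 (intgZl _ iEv).
have isv x : intg lam (S ^~ x) by case: (absD_sub x).
have [_ i2 _] := RFubini iP isx isv.
apply: (@intg_eq _ _ _ mu (fun x => (subc a)^-1 * \int[lam]_v S v x)); last exact: intgZl.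
by move=> x; case: (absD_sub x).
Qed.

End subordination.

Lemma absD_intg {R : realType} n (s : R) (phi : 'rV[R]_n -> R) : 0 <= s -> schwartz phi ->
  intg (lebesgue_rV n) (absD s phi).
Proof.
move=> s0 sphi; have [z|z] := eqVneq s 0; first by rewrite z absD0//; exact: schwartz_intg.
have s1 : 0 < s by rewrite lt_neqAle eq_sym z.
apply: (@intg_absD_L1 R n s (Num.truncn s).+1) => //.
apply: (@lt_le_trans _ _ (Num.truncn s).+1%:R); first exact: truncnS_gt.
by rewrite ler_nat leq_pmull.
Qed.

(** * The equation w_t = z Delta w *)

Section schwartz_commutation.
Context {R : realType} (n : nat).
Local Notation rn := 'rV[R]_n.
Local Notation mu := (@lebesgue_rV R n).
Implicit Types (phi : rn -> R) (T : (rn -> R) -> R).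

(** Both sides have [- xi_i xi_j] times the transform of [phi] as their transform, and Fourier
    inversion recovers them from it. *)
Lemma pderiv_comm i j phi : schwartz phi -> pderiv i (pderiv j phi) = pderiv j (pderiv i phi).
Proof.
move=> sphi; apply/funext => x.
have s2 i' j' : schwartz (pderiv i' (pderiv j' phi)) by do 2 apply: schwartz_pderiv.
have E i' j' xi : Fc (pderiv i' (pderiv j' phi)) x xi = - (xi ord0 i' * xi ord0 j' * Fc phi x xi).
  by rewrite Fc_pderiv ?Fs_pderiv ?mulrA//; exact: schwartz_pderiv.
have H : Fc (pderiv i (pderiv j phi)) x =1 Fc (pderiv j (pderiv i phi)) x.
  move=> xi; apply: (etrans (E i j xi)); apply: (etrans _ (esym (E j i xi))).
  by rewrite (mulrC (xi ord0 i)).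
have I1 := fourier_inversion x (s2 i j); have I2 := fourier_inversion x (s2 j i).
exact: (etrans (esym I1) (etrans (congr1 (GRing.mul _) (eq_Rint mu H)) I2)).
Qed.

Lemma pderivs_pderiv l i phi : schwartz phi -> pderivs l (pderiv i phi) = pderiv i (pderivs l phi).
Proof.
move=> sphi; elim: l => //= j l ->.
by rewrite pderiv_comm//; exact: schwartz_pderivs.
Qed.

Lemma pderivs_sum l (I : Type) (r : seq I) (F : I -> rn -> R) : (forall i, schwartz (F i)) ->
  pderivs l (fun x => \sum_(i <- r) F i x) = (fun x => \sum_(i <- r) pderivs l (F i) x).
Proof.
move=> sF; elim: r => [|i r IH].
  rewrite (_ : (fun x => \sum_(i <- [::]) F i x) = (fun _ : rn => 0)); last by apply/funext => x; rewrite big_nil.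
  by apply/funext => x; rewrite pderivs0 big_nil.
rewrite (_ : (fun x => _) = (fun x => 1 * F i x + \sum_(j <- r) F j x)); last first.
  by apply/funext => x; rewrite big_cons mul1r.
by rewrite pderivs_lin ?IH//; [apply/funext => x; rewrite big_cons mul1r|exact: schwartz_sum].
Qed.

Lemma laplacian_cv s k phi : kern k -> schwartz phi -> laplacian (cv s k phi) = cv s k (laplacian phi).
Proof.
move=> kk sphi; apply/funext => x.
have icv f : schwartz f -> intg mu (fun y => k y * f (x - s *: y)).
  by move=> sf; apply: intg_cv => //; [exact: schwartz_measurable|exact: schwartz_bounded].
rewrite /laplacian.
have E i : pderiv i (pderiv i (cv s k phi)) x = cv s k (pderiv i (pderiv i phi)) x.
  exact: (congr1 (fun f => f x) (pderivs_cv s kk sphi [:: i; i])).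
apply: (etrans (eq_bigr _ (fun i _ => E i))).
have H := @Rint_sum _ _ _ mu 'I_n (index_enum _) xpredT (fun i y => k y * pderiv i (pderiv i phi) (x - s *: y)).
apply: (etrans (esym (H _))); first by move=> i _; apply: icv; do 2 apply: schwartz_pderiv.
by apply: eq_Rint => y; rewrite mulr_sumr.
Qed.

Lemma pderivs_dcv l s k phi : kern k -> schwartz phi ->
  pderivs l (dcv s k phi) = dcv s k (pderivs l phi).
Proof.
move=> kk sphi.
have sc i : schwartz (cv s (fun y => y ord0 i * k y) (pderiv i phi)).
  by apply: schwartz_cv; [exact: kern_coord|exact: schwartz_pderiv].
rewrite (_ : dcv s k phi = (fun x => (-1) * \sum_i cv s (fun y => y ord0 i * k y) (pderiv i phi) x)); last first.
  by apply/funext => x; rewrite mulN1r.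
rewrite pderivsZ ?pderivs_sum//; last exact: schwartz_sum.
apply/funext => x; rewrite mulN1r; congr (- _); apply: eq_bigr => i _.
by rewrite pderivs_cv ?pderivs_pderiv//; [exact: kern_coord|exact: schwartz_pderiv].
Qed.

Lemma decay_cv_unif k phi (S : R) l m : kern k -> schwartz phi ->
  exists M, forall s, `|s| <= S -> decw m M (pderivs l (cv s k phi)).
Proof.
move=> kk sphi; have sl := schwartz_pderivs l sphi; have [M HM] := schwartz_decay sl m.
exists ((1 + S) ^+ m * M * \int[mu]_y ((1 + `|y|) ^+ m * `|k y|)) => s sS.
have H := @cv_decw R n s _ _ _ _ kk (schwartz_measurable sl) HM.
rewrite pderivs_cv// => x; apply: (le_trans (H x)).
have J0 : 0 <= \int[mu]_y ((1 + `|y|) ^+ m * `|k y|).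
  by apply: Rintegral_ge0 => y _; rewrite mulr_ge0// exprn_ge0// addr_ge0.
rewrite ler_wpM2r// ler_wpM2r ?(decw_ge0 HM)// lerXn2r ?nnegrE ?lerD2l// addr_ge0//.
exact: le_trans sS.
Qed.

(** Derivatives commute with [cv] and [dcv], so the remainder is of order [h^2] in every seminorm.
    Divided by [h^2] it forms a bounded family, to which Banach-Steinhaus applies. *)
Lemma decay_cv_rem k phi (S : R) l m : kern k -> schwartz phi ->
  exists C, forall s h, `|s| <= S -> `|h| <= S ->
  decw m (C * h ^+ 2) (pderivs l (fun x => cv (s + h) k phi x - cv s k phi x - h * dcv s k phi x)).
Proof.
move=> kk sphi; have sl := schwartz_pderivs l sphi.
have [C HC] := cv_taylor m S kk sl; exists C => s h sS hS.
have sD := schwartz_dcv s kk sphi; have s1 := schwartz_cv s kk sphi; have s2 := schwartz_cv (s + h) kk sphi.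
have -> : (fun x => cv (s + h) k phi x - cv s k phi x - h * dcv s k phi x) =
   (fun x => - h * dcv s k phi x + (- 1 * cv s k phi x + cv (s + h) k phi x)).
  by apply/funext => x; ring.
rewrite pderivs_lin ?pderivs_lin//; last exact: schwartz_lin.
rewrite pderivs_dcv// !pderivs_cv//.
have := HC s h sS hS; congr decw.
by apply/funext => x; ring.
Qed.

Lemma equicontinuous_on (J S : Type) (DJ : J -> Prop) (DS : S -> Prop)
    (w : J -> (rn -> R) -> R) (Phi : S -> rn -> R) :
  (forall j, DJ j -> tempered (w j)) ->
  (forall phi, schwartz phi -> exists M, forall j, DJ j -> `|w j phi| <= M) ->
  (forall s, DS s -> schwartz (Phi s)) ->
  (forall l k, exists M, forall s, DS s -> decw k M (pderivs l (Phi s))) ->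
  exists M, forall j s, DJ j -> DS s -> `|w j (Phi s)| <= M.
Proof.
move=> tw bw sP bP.
have [|||M HM] := @equicontinuous R n {j | DJ j} {s | DS s} (fun j => w (sval j)) (fun s => Phi (sval s)).
- by case.
- by move=> phi sphi; have [M HM] := bw phi sphi; exists M => -[j Dj]; exact: HM.
- split; first by case.
  by move=> l k; have [M HM] := bP l k; exists M => -[s Ds]; exact: HM.
by exists M => j s Dj Ds; exact: HM (exist _ j Dj) (exist _ s Ds).
Qed.

(* [kR + i kI] is the complex Gaussian exp(-|y|^2 / (4z)) for z = al + i be,
   normalized to have integral 1. *)
Record zkernel (al be : R) (kR kI : rn -> R) : Prop := {
  zk_sR : schwartz kR;
  zk_sI : schwartz kI;
  zk_R : forall (i : 'I_n) (y : rn), y ord0 i * kR y = - 2 * (al * pderiv i kR y - be * pderiv i kI y);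
  zk_I : forall (i : 'I_n) (y : rn), y ord0 i * kI y = - 2 * (al * pderiv i kI y + be * pderiv i kR y);
  zk_1 : \int[mu]_y kR y = 1;
  zk_0 : \int[mu]_y kI y = 0
}.

(** The parameters satisfy [a - i b = 1 / (4 z)]. The Gaussian is divided by its integral [X + i Y],
    that is, multiplied by [(X - i Y) / D], where [D] is nonzero by [gauss_nondegenerate]. *)
Lemma zkernel_exists (al be : R) : 0 < al -> 0 <= be -> exists kR kI, zkernel al be kR kI.
Proof.
move=> al0 be0; pose m := al ^+ 2 + be ^+ 2.
have m0 : 0 < m by rewrite ltr_pwDl ?exprn_gt0// sqr_ge0.
pose a := al / (4%:R * m); pose b := be / (4%:R * m).
have a0 : 0 < a by rewrite divr_gt0// mulr_gt0.
have b0 : 0 <= b by rewrite divr_ge0// mulr_ge0// ltW.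
have sE := @gE_schwartz R n a b a0; have sS := @gS_schwartz R n a b a0.
have D0 := @gauss_nondegenerate R n a b a0 b0.
set X := \int[mu]_y gE a b y in D0; set Y := \int[mu]_y gS a b y in D0.
pose D := X ^+ 2 + Y ^+ 2.
have Dn : D != 0 by rewrite gt_eqF.
pose kR (y : rn) := X / D * gE a b y + Y / D * gS a b y.
pose kI (y : rn) := X / D * gS a b y + - Y / D * gE a b y.
have pE (i : 'I_n) y : pderiv i (gE a b) y = - 2 * y ord0 i * (a * gE a b y + b * gS a b y) by have [_ ->] := gE_pderiv a b y.
have pS (i : 'I_n) y : pderiv i (gS a b) y = - 2 * y ord0 i * (a * gS a b y - b * gE a b y) by have [_ ->] := gS_pderiv a b y.
have zD (f : rn -> R) (c : R) y : schwartz f -> differentiable (fun y => c * f y) y.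
  by move=> sf; apply: schwartz_diff; exact: schwartzZ.
have pZ i (c : R) (f : rn -> R) y : schwartz f -> pderiv i (fun y => c * f y) y = c * pderiv i f y.
  by move=> sf; have := pderivsZ [:: i] c sf => /= ->.
have pR i y : pderiv i kR y = X / D * pderiv i (gE a b) y + Y / D * pderiv i (gS a b) y.
  by rewrite pderiv_lin ?pZ//; [exact: schwartz_diff|exact: zD].
have pI i y : pderiv i kI y = X / D * pderiv i (gS a b) y + - Y / D * pderiv i (gE a b) y.
  by rewrite pderiv_lin ?pZ//; [exact: schwartz_diff|exact: zD].
have mn : al ^+ 2 + be ^+ 2 != 0 by rewrite gt_eqF.
have iE := schwartz_intg sE; have iS := schwartz_intg sS.
exists kR, kI; split.
- by apply: schwartz_lin => //; exact: schwartzZ.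
- by apply: schwartz_lin => //; exact: schwartzZ.
- by move=> i y; rewrite pR pI pE pS /kR /a /b /m; field; rewrite mn Dn.
- by move=> i y; rewrite pR pI pE pS /kI /a /b /m; field; rewrite mn Dn.
- rewrite RintegralD; [|by []|exact: intgZl|exact: intgZl].
  by rewrite (RintZl _ iE) (RintZl _ iS) -/X -/Y /D; field; exact: Dn.
- rewrite RintegralD; [|by []|exact: intgZl|exact: intgZl].
  by rewrite (RintZl _ iE) (RintZl _ iS) -/X -/Y /D; field; exact: Dn.
Qed.

Section zkernel_flow.
Variables (al be : R) (kR kI : rn -> R).
Hypothesis zk : zkernel al be kR kI.

Let kkR : kern kR. Proof. by apply: kern_schwartz; exact: zk_sR zk. Qed.
Let kkI : kern kI. Proof. by apply: kern_schwartz; exact: zk_sI zk. Qed.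

Let cv_comb s (a b : R) (k k' f : rn -> R) x : schwartz k -> schwartz k' -> schwartz f ->
  cv s (fun y => a * k y + b * k' y) f x = a * cv s k f x + b * cv s k' f x.
Proof.
move=> sk sk' sf; have icv g : schwartz g -> intg mu (fun y => g y * f (x - s *: y)).
  move=> sg; apply: intg_cv; [exact: kern_schwartz|exact: schwartz_measurable|exact: schwartz_bounded].
have i1 := icv k sk; have i2 := icv k' sk'.
rewrite /cv -(RintZl a i1) -(RintZl b i2) -RintegralD; [|by []|exact: intgZl|exact: intgZl].
by apply: eq_Rint => y; ring.
Qed.

Let cv_lap s (k f : rn -> R) x : kern k -> schwartz f ->
  \sum_i cv s k (pderiv i (pderiv i f)) x = cv s k (laplacian f) x.
Proof.
move=> kk sf; rewrite -laplacian_cv// /laplacian; apply: eq_bigr => i _.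
by have := pderivs_cv s kk sf [:: i; i] => /= ->.
Qed.

(** Real part of [d/ds (cv s k phi) = 2 s z cv s k (Delta phi)]. The derivative in [s] brings down
    [- y_i], the relation [y_i k = - 2 z d_i k] turns this into a derivative of the kernel, and
    integration by parts gives the factor [s]. *)
Lemma dcv_zR s phi : schwartz phi ->
  dcv s kR phi = (fun x => 2 * s * (al * cv s kR (laplacian phi) x - be * cv s kI (laplacian phi) x)).
Proof.
move=> sphi; apply/funext => x; rewrite /dcv -!cv_lap// !mulr_sumr -sumrB mulr_sumr -sumrN.
apply: eq_bigr => i _; have sd := schwartz_pderiv i sphi.
have -> : (fun y : rn => y ord0 i * kR y) = (fun y => (- 2 * al) * pderiv i kR y + (2 * be) * pderiv i kI y).
  by apply/funext => y; rewrite (zk_R zk); ring.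
rewrite cv_comb//; [|by apply: schwartz_pderiv; exact: zk_sR zk|by apply: schwartz_pderiv; exact: zk_sI zk].
rewrite !pderiv_ibp_cv//; [ring|exact: zk_sI zk|exact: zk_sR zk].
Qed.

Lemma dcv_zI s phi : schwartz phi ->
  dcv s kI phi = (fun x => 2 * s * (al * cv s kI (laplacian phi) x + be * cv s kR (laplacian phi) x)).
Proof.
move=> sphi; apply/funext => x; rewrite /dcv -!cv_lap// !mulr_sumr -big_split/= mulr_sumr -sumrN.
apply: eq_bigr => i _; have sd := schwartz_pderiv i sphi.
have -> : (fun y : rn => y ord0 i * kI y) = (fun y => (- 2 * al) * pderiv i kI y + (- 2 * be) * pderiv i kR y).
  by apply/funext => y; rewrite (zk_I zk); ring.
rewrite cv_comb//; [|by apply: schwartz_pderiv; exact: zk_sI zk|by apply: schwartz_pderiv; exact: zk_sR zk].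
rewrite !pderiv_ibp_cv//; [ring|exact: zk_sR zk|exact: zk_sI zk].
Qed.

Lemma cv0_R (phi : rn -> R) : cv 0 kR phi = phi.
Proof.
apply/funext => x; rewrite /cv (eq_Rint mu (g := fun y => kR y * phi x)); last by move=> y; rewrite scale0r subr0.
by rewrite (RintZr _ (kern_intg kkR)) (zk_1 zk) mul1r.
Qed.

Lemma cv0_I (phi : rn -> R) : cv 0 kI phi = (fun _ => 0).
Proof.
apply/funext => x; rewrite /cv (eq_Rint mu (g := fun y => kI y * phi x)); last by move=> y; rewrite scale0r subr0.
by rewrite (RintZr _ (kern_intg kkI)) (zk_0 zk) mul0r.
Qed.

End zkernel_flow.

End schwartz_commutation.

Section one_sided.
Context {R : realType}.
Implicit Types (f df : R -> R).

(** Hypotheses are confined to [[a, b]] because a solution is differentiable only at positive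
    times. *)
Lemma taylor2_right f df ddf (a b M : R) : a < b ->
  (forall t : R, a <= t <= b -> is_derive t (1 : R) f (df t)) ->
  (forall t : R, a <= t <= b -> is_derive t (1 : R) df (ddf t)) ->
  (forall t, a <= t <= b -> `|ddf t| <= M) ->
  `|f b - f a - (b - a) * df a| <= M * (b - a) ^+ 2.
Proof.
move=> ab fd dfd ddfM.
have cont g dg (c : R) : c <= b -> (forall t : R, a <= t <= b -> is_derive t (1 : R) g (dg t)) ->
    {within `[a, c], continuous g}.
  move=> cb gd; apply: derivable_within_continuous => t; rewrite in_itv/= => /andP[at_ tc].
  by apply: ex_derive; apply: gd; rewrite at_ (le_trans tc).
have [c] : exists2 c, c \in `[a, b] & f b - f a = df c * (b - a).
  apply: MVT_segment; [exact: ltW| |exact: cont (lexx b) fd].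
  by move=> t; rewrite in_itv/= => /andP[at_ tb]; apply: fd; rewrite !ltW.
rewrite in_itv/= => /andP[ac cb] E.
have [c'] : exists2 c', c' \in `[a, c] & df c - df a = ddf c' * (c - a).
  apply: MVT_segment => //; last exact: cont cb dfd.
  by move=> t; rewrite in_itv/= => /andP[at_ tc]; apply: dfd; rewrite !ltW// (lt_le_trans tc).
rewrite in_itv/= => /andP[ac' c'c] E'.
have -> : f b - f a - (b - a) * df a = (b - a) * (df c - df a) by rewrite E; ring.
have ba0 : 0 <= b - a by rewrite subr_ge0 ltW.
rewrite E' !normrM (ger0_norm ba0) [`|c - a|]ger0_norm ?subr_ge0//.
rewrite expr2 [M * _]mulrC -mulrA ler_wpM2l// mulrC ler_pM ?subr_ge0 ?lerD2r//.
by apply: ddfM; rewrite ac' (le_trans c'c).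
Qed.

(** Near 0 the limit bounds [f]; on the rest of [(0, T]] continuity on a compact interval does. This
    supplies the pointwise bounds for Banach-Steinhaus. *)
Lemma bounded_right f (l T : R) : (forall t : R, 0 < t -> derivable f t 1) ->
  f t @[t --> 0^'+] --> l -> exists M, forall t, 0 < t <= T -> `|f t| <= M.
Proof.
move=> fd fl.
have [e /= e0 He] : \forall t \near 0^'+, `|l - f t| <= 1 by move/cvgrPdist_le : fl; apply.
have cf : {within `[e / 2, T], continuous (fun t => `|f t|)}.
  have c : {within `[e / 2, T], continuous f}.
    apply: derivable_within_continuous => t; rewrite in_itv/= => /andP[et _].
    by apply: fd; apply: lt_le_trans et; rewrite divr_gt0.
  by move=> t; apply: continuous_comp; [exact: c|exact: norm_continuous].
have near0 t : 0 < t -> t < e -> `|f t| <= `|l| + 1.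
  move=> t0 te; have /= := He t; rewrite sub0r normrN gtr0_norm// => /(_ te t0) H.
  by rewrite -[f t](subKr l) (le_trans (ler_normB _ _))// lerD2l.
have [eT|eT] := lerP (e / 2) T.
  have [c _ Hc] := EVT_max eT cf.
  exists (`|l| + 1 + `|f c|) => t /andP[t0 tT]; have [te|te] := ltP t e.
    by apply: (le_trans (near0 _ t0 te)); rewrite lerDl.
  apply: (@le_trans _ _ `|f c|); last by rewrite lerDr addr_ge0.
  by apply: Hc; rewrite in_itv/= tT andbT (le_trans _ te)// ler_pdivrMr// mulr_natr mulr2n lerDl ltW.
exists (`|l| + 1) => t /andP[t0 tT]; apply: near0 => //.
by apply: (le_lt_trans tT); apply: (lt_trans eT); rewrite ltr_pdivrMr// mulr_natr mulr2n ltrDl.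
Qed.

End one_sided.

Section evolution_identities.
Context {R : realType}.
Implicit Types (al be h s a b : R).

Lemma evol_ringA al be (x y z u : R) :
  al * x - be * y - (al * z + be * u) = al * (x - z) - be * (y + u).
Proof. ring. Qed.

Lemma evol_ringB al be (x y z u : R) :
  al * x + be * y + (al * z - be * u) = al * (x + z) + be * (y - u).
Proof. ring. Qed.

Lemma evol_ringC al be h s (x y z u v w z' u' : R) :
  x - v - (y - w) - h * (2 * s * (al * (z - z') - be * (u' + u))) =
  x - y - h * (2 * s * (al * z - be * u)) - (v - w - h * (2 * s * (al * z' + be * u'))).
Proof. ring. Qed.

Lemma evol_ringD a b (x y z g : R) :
  x - y = x - z - (b - a) * (2 * a * g) - (y - z - (b - a) * (b + a) * g) + - ((b - a) ^+ 2 * g).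
Proof. ring. Qed.

End evolution_identities.

(** * Representation of solutions by duality *)

Section evolution.
Context {R : realType} (n : nat).
Local Notation rn := 'rV[R]_n.
Local Notation dist := ((rn -> R) -> R).
Implicit Types (phi : rn -> R).

Section uniform_bounds.
Variables (w : R -> dist) (w0 : dist) (T : R).
Hypothesis tw : forall t, 0 < t -> tempered (w t).
Hypothesis dw : forall t phi, 0 < t -> schwartz phi -> derivable (w ^~ phi) t 1.
Hypothesis lw : forall phi, schwartz phi -> w t phi @[t --> 0^'+] --> w0 phi.

Let pw phi : schwartz phi -> exists M, forall t, 0 < t <= T -> `|w t phi| <= M.
Proof. by move=> sphi; apply: bounded_right (lw sphi) => t t0; exact: dw. Qed.

Let tw' t : 0 < t <= T -> tempered (w t).
Proof. by move=> /andP[t0 _]; exact: tw. Qed.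

Lemma evol_bound k phi (S : R) : kern k -> schwartz phi ->
  exists M, forall t s, 0 < t <= T -> `|s| <= S -> `|w t (cv s k phi)| <= M.
Proof.
move=> kk sphi; apply: (@equicontinuous_on _ _ R R (fun t => 0 < t <= T) (fun s => `|s| <= S)) => //.
- by move=> s _; exact: schwartz_cv.
- by move=> l m; exact: decay_cv_unif.
Qed.

(** For [h != 0] the remainders divided by [h^2] form a bounded family, and equicontinuity bounds
    all [w t] on it at once. The expansion in [s] is therefore uniform in the time [t]. *)
Lemma evol_rem k phi (S : R) : kern k -> schwartz phi ->
  exists M, forall t s h, 0 < t <= T -> `|s| <= S -> `|h| <= S ->
   `|w t (cv (s + h) k phi) - w t (cv s k phi) - h * w t (dcv s k phi)| <= M * h ^+ 2.
Proof.
move=> kk sphi.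
pose r s h x := cv (s + h) k phi x - cv s k phi x - h * dcv s k phi x.
have rE s h : r s h = (fun x => - h * dcv s k phi x + (- 1 * cv s k phi x + cv (s + h) k phi x)).
  by apply/funext => x; rewrite /r; ring.
have sc s : schwartz (cv s k phi) by exact: schwartz_cv.
have sd s : schwartz (dcv s k phi) by exact: schwartz_dcv.
have sr s h : schwartz (r s h) by rewrite rE; do 2 apply: schwartz_lin => //.
have [M HM] : exists M, forall t (z : R * R), 0 < t <= T -> (z.2 != 0 /\ `|z.1| <= S /\ `|z.2| <= S) ->
    `|w t (fun x => z.2 ^- 2 * r z.1 z.2 x)| <= M.
  apply: (@equicontinuous_on _ _ R (R * R)%type (fun t => 0 < t <= T)
    (fun z => z.2 != 0 /\ `|z.1| <= S /\ `|z.2| <= S)) => //.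
  - by move=> z _; exact: schwartzZ.
  - move=> l m; have [C HC] := decay_cv_rem S l m kk sphi; exists C => z [z0 [zs zh]] x.
    rewrite pderivsZ// normrM mulrCA.
    have z2 : 0 < z.2 ^+ 2 by rewrite lt_neqAle eq_sym sqrf_eq0 z0 sqr_ge0.
    have z2' : 0 <= z.2 ^- 2 by rewrite invr_ge0 ltW.
    rewrite (ger0_norm z2') ler_pdivrMl// [X in _ <= X]mulrC.
    exact: HC.
exists M => t s h tT sS hS; have [->|h0] := eqVneq h 0.
  by rewrite addr0 subrr mul0r subrr normr0 expr0n mulr0.
have t0 : 0 < t by case/andP: tT.
have := HM t (s, h) tT (conj h0 (conj sS hS)).
rewrite /= (tempZ _ (tw t0) (sr s h)) rE !(temp_lin _ (tw t0))//; last exact: schwartz_lin.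
have h2 : 0 < h ^+ 2 by rewrite lt_neqAle eq_sym sqrf_eq0 h0 sqr_ge0.
have h2' : 0 <= h ^- 2 by rewrite invr_ge0 ltW.
rewrite normrM (ger0_norm h2') mulrC ler_pdivrMr//.
by congr (`|_| <= _); ring.
Qed.

End uniform_bounds.

Variables (al be : R) (kR kI : rn -> R).
Hypothesis zk : zkernel al be kR kI.
Variables (w2 w3 : R -> dist) (w20 w30 : dist).
Hypothesis tw2 : forall t, 0 < t -> tempered (w2 t).
Hypothesis tw3 : forall t, 0 < t -> tempered (w3 t).
Hypothesis dw2 : forall (t : R) phi, 0 < t -> schwartz phi ->
  is_derive t (1 : R) (w2 ^~ phi) (al * w2 t (laplacian phi) - be * w3 t (laplacian phi)).
Hypothesis dw3 : forall (t : R) phi, 0 < t -> schwartz phi ->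
  is_derive t (1 : R) (w3 ^~ phi) (al * w3 t (laplacian phi) + be * w2 t (laplacian phi)).
Hypothesis lw2 : forall phi, schwartz phi -> w2 t phi @[t --> 0^'+] --> w20 phi.
Hypothesis lw3 : forall phi, schwartz phi -> w3 t phi @[t --> 0^'+] --> w30 phi.

(** [A] and [B] are the real and imaginary parts of [w2 + i w3] applied to [f + i g]. *)
Let A t f g := w2 t f - w3 t g.
Let B t f g := w3 t f + w2 t g.

Let dA (t : R) f g : 0 < t -> schwartz f -> schwartz g ->
  is_derive t (1 : R) (fun t => A t f g) (al * A t (laplacian f) (laplacian g) - be * B t (laplacian f) (laplacian g)).
Proof.
move=> t0 sf sg; apply: isd_eq (is_deriveB (dw2 t0 sf) (dw3 t0 sg)) _.
exact: evol_ringA.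
Qed.

Let dB (t : R) f g : 0 < t -> schwartz f -> schwartz g ->
  is_derive t (1 : R) (fun t => B t f g) (al * B t (laplacian f) (laplacian g) + be * A t (laplacian f) (laplacian g)).
Proof.
move=> t0 sf sg; apply: isd_eq (is_deriveD (dw3 t0 sf) (dw2 t0 sg)) _.
exact: evol_ringB.
Qed.

Let kkR : kern kR. Proof. by apply: kern_schwartz; exact: zk_sR zk. Qed.
Let kkI : kern kI. Proof. by apply: kern_schwartz; exact: zk_sI zk. Qed.

Variables (T : R) (phi : rn -> R).
Hypothesis T0 : 0 < T.
Hypothesis sphi : schwartz phi.
Let S := Num.sqrt T.
Let S0 : 0 < S. Proof. by rewrite sqrtr_gt0. Qed.
Let SS : S ^+ 2 = T. Proof. by rewrite sqr_sqrtr// ltW. Qed.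

Let wb k f : kern k -> schwartz f -> exists M, forall t s, 0 < t <= T -> `|s| <= S ->
  `|w2 t (cv s k f)| <= M /\ `|w3 t (cv s k f)| <= M.
Proof.
move=> kk sf.
have [M HM] : exists M, forall t s, 0 < t <= T -> `|s| <= S -> `|w2 t (cv s k f)| <= M.
  by apply: evol_bound => // [t psi t0 sp|]; [apply: ex_derive; exact: dw2|exact: lw2].
have [M' HM'] : exists M, forall t s, 0 < t <= T -> `|s| <= S -> `|w3 t (cv s k f)| <= M.
  by apply: evol_bound => // [t psi t0 sp|]; [apply: ex_derive; exact: dw3|exact: lw3].
have S00 : `|0 : R| <= S by rewrite normr0 ltW.
have TT : 0 < T <= T by rewrite T0 lexx.
have M0 := le_trans (normr_ge0 _) (HM T 0 TT S00); have M0' := le_trans (normr_ge0 _) (HM' T 0 TT S00).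
exists (M + M') => t s tT sS; split.
  by apply: (le_trans (HM t s tT sS)); rewrite lerDl.
by apply: (le_trans (HM' t s tT sS)); rewrite lerDr.
Qed.

(** The index [j] counts the Laplacians on the test function; a derivative in [t] raises it by
    one. *)
Let AA j t s := A t (cv s kR (iter j (@laplacian R n) phi)) (cv s kI (iter j (@laplacian R n) phi)).
Let BB j t s := B t (cv s kR (iter j (@laplacian R n) phi)) (cv s kI (iter j (@laplacian R n) phi)).

Let sj j : schwartz (iter j (@laplacian R n) phi).
Proof. by elim: j => //= j IH; exact: schwartz_laplacian. Qed.

Let dAA j (t s : R) : 0 < t -> is_derive t (1 : R) (fun t => AA j t s) (al * AA j.+1 t s - be * BB j.+1 t s).
Proof.
move=> t0; rewrite /AA /BB !iterS -!laplacian_cv//.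
by apply: dA => //; exact: schwartz_cv.
Qed.

Let dBB j (t s : R) : 0 < t -> is_derive t (1 : R) (fun t => BB j t s) (al * BB j.+1 t s + be * AA j.+1 t s).
Proof.
move=> t0; rewrite /AA /BB !iterS -!laplacian_cv//.
by apply: dB => //; exact: schwartz_cv.
Qed.

Let bAB j : exists M, forall t s, 0 < t <= T -> `|s| <= S -> `|AA j t s| <= M /\ `|BB j t s| <= M.
Proof.
have [M HM] := wb kkR (sj j); have [M' HM'] := wb kkI (sj j).
exists (M + M') => t s tT sS; have [h1 h2] := HM t s tT sS; have [h3 h4] := HM' t s tT sS; split.
  by apply: (le_trans (ler_normB _ _)); rewrite lerD.
by apply: (le_trans (ler_normD _ _)); rewrite lerD.
Qed.

Let remA : exists C, forall t s h, 0 < t <= T -> `|s| <= S -> `|h| <= S ->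
  `|AA 0 t (s + h) - AA 0 t s - h * (2 * s * (al * AA 1 t s - be * BB 1 t s))| <= C * h ^+ 2.
Proof.
have [M HM] : exists M, forall t s h, 0 < t <= T -> `|s| <= S -> `|h| <= S ->
   `|w2 t (cv (s + h) kR phi) - w2 t (cv s kR phi) - h * w2 t (dcv s kR phi)| <= M * h ^+ 2.
  by apply: evol_rem => // [t psi t0 sp|]; [apply: ex_derive; exact: dw2|exact: lw2].
have [M' HM'] : exists M, forall t s h, 0 < t <= T -> `|s| <= S -> `|h| <= S ->
   `|w3 t (cv (s + h) kI phi) - w3 t (cv s kI phi) - h * w3 t (dcv s kI phi)| <= M * h ^+ 2.
  by apply: evol_rem => // [t psi t0 sp|]; [apply: ex_derive; exact: dw3|exact: lw3].
exists (M + M') => t s h tT sS hS; have t0 : 0 < t by case/andP: tT.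
have := HM t s h tT sS hS; have := HM' t s h tT sS hS.
have sl := schwartz_laplacian sphi.
have s1 : schwartz (cv s kR (laplacian phi)) by exact: schwartz_cv.
have s2 : schwartz (cv s kI (laplacian phi)) by exact: schwartz_cv.
have E2 : w2 t (dcv s kR phi) = 2 * s * (al * w2 t (cv s kR (laplacian phi)) - be * w2 t (cv s kI (laplacian phi))).
  have -> : dcv s kR phi = (fun x => (2 * s * al) * cv s kR (laplacian phi) x + (- (2 * s * be)) * cv s kI (laplacian phi) x).
    by rewrite (dcv_zR zk)//; apply/funext => x; ring.
  by rewrite (temp_lin _ (tw2 t0))// ?(tempZ _ (tw2 t0))//; [ring|exact: schwartzZ].
have E3 : w3 t (dcv s kI phi) = 2 * s * (al * w3 t (cv s kI (laplacian phi)) + be * w3 t (cv s kR (laplacian phi))).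
  have -> : dcv s kI phi = (fun x => (2 * s * al) * cv s kI (laplacian phi) x + (2 * s * be) * cv s kR (laplacian phi) x).
    by rewrite (dcv_zI zk)//; apply/funext => x; ring.
  by rewrite (temp_lin _ (tw3 t0))// ?(tempZ _ (tw3 t0))//; [ring|exact: schwartzZ].
rewrite E2 E3 => h3 h2; rewrite [(M + M') * _]mulrDl.
apply: le_trans (lerD h2 h3); apply: le_trans (ler_normB _ _).
rewrite le_eqVlt; apply/orP; left; apply/eqP; apply: (congr1 (fun x => `|x|)).
exact: evol_ringC.
Qed.

(* The real part of w(T - s^2) applied to the convolution of phi with the complex Gaussian of
   variance s^2; formally it does not depend on s, because both factors solve dual heat equations. *)
Let F s := AA 0 (T - s ^+ 2) s.

Let F_cst s : 0 < s -> s < S -> F 0 = F s.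
Proof.
have [C HC] := remA; have [M1 HM1] := bAB 1; have [M2 HM2] := bAB 2.
pose D := (`|al| + `|be|) * M1; pose D2 := (`|al| + `|be|) * ((`|al| + `|be|) * M2).
have S00 : `|0 : R| <= S by rewrite normr0 ltW.
have TT : 0 < T <= T by rewrite T0 lexx.
have M20 : 0 <= M2 by have [+ _] := HM2 T 0 TT S00; exact: le_trans.
have M10 : 0 <= M1 by have [+ _] := HM1 T 0 TT S00; exact: le_trans.
move=> s0 sS; apply: (@quad_cst R F (C + D + D2 * (2 * S) ^+ 2) 0 S) s0 sS => // a b a0 ab bS.
have b0 : 0 < b by exact: le_lt_trans ab.
have aS : a < S by exact: lt_trans bS.
have naS : `|a| <= S by rewrite (ger0_norm a0) ltW.
have h0 : 0 < b - a by rewrite subr_gt0.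
have hS : `|b - a| <= S by rewrite (ger0_norm (ltW h0)); apply: le_trans (ltW bS); rewrite gerBl.
have sq x y : 0 <= x -> x < y -> x ^+ 2 < y ^+ 2 by move=> x0 xy; rewrite ltrXn2r// nnegrE// ltW// (le_lt_trans x0).
have tb : 0 < T - b ^+ 2 by rewrite subr_gt0 -SS sq// ltW.
have tab : T - b ^+ 2 < T - a ^+ 2 by rewrite ltrD2l ltrN2 sq.
have taT : T - a ^+ 2 <= T by rewrite gerBl sqr_ge0.
set u := T - b ^+ 2 in tb tab *; set v := T - a ^+ 2 in tab taT *.
have inT t : u <= t <= v -> 0 < t <= T.
  by move=> /andP[ut tv]; rewrite (lt_le_trans tb)// (le_trans tv).
pose dG t := al * AA 1 t a - be * BB 1 t a.
have lin_le (x y M : R) : `|x| <= M -> `|y| <= M -> 0 <= M -> `|al * x - be * y| <= (`|al| + `|be|) * M.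
  by move=> hx hy hM; apply: (le_trans (ler_normB _ _)); rewrite !normrM mulrDl lerD// ler_wpM2l.
have lin_le' (x y M : R) : `|x| <= M -> `|y| <= M -> 0 <= M -> `|al * x + be * y| <= (`|al| + `|be|) * M.
  by move=> hx hy hM; apply: (le_trans (ler_normD _ _)); rewrite !normrM mulrDl lerD// ler_wpM2l.
have tay : `|AA 0 v a - AA 0 u a - (v - u) * dG u| <= D2 * (v - u) ^+ 2.
  apply: (@taylor2_right R (fun t => AA 0 t a) dG
     (fun t => al * (al * AA 2 t a - be * BB 2 t a) - be * (al * BB 2 t a + be * AA 2 t a))) => // t tuv.
  - by have /andP[t0 _] := inT t tuv; exact: dAA.
  - have /andP[t0 _] := inT t tuv.
    by apply: is_deriveB; apply: is_deriveZ; [exact: dAA|exact: dBB].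
  - have [h1 h2] := HM2 t a (inT t tuv) naS.
    apply: (lin_le); [exact: (lin_le)|exact: (lin_le')|].
    by rewrite mulr_ge0// addr_ge0.
have uT : 0 < u <= T by rewrite inT// lexx ltW.
have rem := HC u a (b - a) uT naS hS.
have [d1 d2] := HM1 u a uT naS.
have dGD : `|dG u| <= D by exact: lin_le.
have vu : v - u = (b - a) * (b + a) by rewrite /u /v; ring.
(* The scale changes from [a] to [b] at time [u], the time from [v] to [u] at scale [a]. Their
   first-order terms carry [2 a (b - a)] and [v - u = (b - a) (b + a)], which differ by [(b - a)^2]
   only. *)
have -> : F b - F a = (AA 0 u (a + (b - a)) - AA 0 u a - (b - a) * (2 * a * dG u))
   - (AA 0 v a - AA 0 u a - (v - u) * dG u) + - ((b - a) ^+ 2 * dG u).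
  have E : a + (b - a) = b by ring.
  rewrite E /F -/u -/v vu; exact: evol_ringD.
have -> : (C + D + D2 * (2 * S) ^+ 2) * (b - a) ^+ 2 =
    C * (b - a) ^+ 2 + D2 * (2 * S) ^+ 2 * (b - a) ^+ 2 + D * (b - a) ^+ 2 by ring.
apply: (le_trans (ler_normD _ _)); apply: lerD; last first.
  by rewrite normrN normrM (ger0_norm (sqr_ge0 _)) mulrC ler_wpM2r ?sqr_ge0.
apply: (le_trans (ler_normB _ _)); apply: lerD => //.
apply: (le_trans tay); rewrite -mulrA; apply: ler_wpM2l.
  by rewrite mulr_ge0 ?addr_ge0// mulr_ge0// addr_ge0.
rewrite vu exprMn mulrC ler_wpM2r ?sqr_ge0//.
rewrite lerXn2r ?nnegrE ?mulr_ge0 ?addr_ge0 ?(ltW S0) ?(ltW b0)//.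
by rewrite mulr_natl mulr2n lerD ?ltW.
Qed.

(** [F 0] is the solution at time [T] tested on [phi]. As the scale tends to [S] the time [T - s^2]
    tends to 0, and [F] tends to the initial value tested on the Gaussian averages. This end is
    reached only as a limit, since the data are attained weakly. *)
Lemma evolution : w2 T phi = w20 (cv S kR phi) - w30 (cv S kI phi).
Proof.
have [C HC] := remA; have [M1 HM1] := bAB 1.
have S00 : `|0 : R| <= S by rewrite normr0 ltW.
have TT : 0 < T <= T by rewrite T0 lexx.
have M10 : 0 <= M1 by have [+ _] := HM1 T 0 TT S00; exact: le_trans.
have sR : schwartz (cv S kR phi) by exact: schwartz_cv.
have sI : schwartz (cv S kI phi) by exact: schwartz_cv.
have lim : AA 0 t S @[t --> 0^'+] --> w20 (cv S kR phi) - w30 (cv S kI phi).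
  by apply: cvgB; [exact: lw2|exact: lw3].
have F0 : F 0 = w2 T phi.
  rewrite /F /AA /A /= expr0n subr0 (cv0_R zk) (cv0_I zk).
  by rewrite (temp0 (tw3 T0)) subr0.
pose K := C * S + 2 * S * ((`|al| + `|be|) * M1).
have C0 : 0 <= C.
  have SSn : `|S| <= S by rewrite (ger0_norm (ltW S0)).
  have := le_trans (normr_ge0 _) (HC T 0 S TT S00 SSn).
  by rewrite pmulr_lge0// exprn_gt0.
have K0 : 0 <= K by rewrite addr_ge0 ?mulr_ge0 ?addr_ge0// ltW.
(* At [t = T - s^2] the test functions in [F s] still depend on [t]. Freezing them at scale [S]
   costs [O(S - s)], and [S - s <= t / S]. *)
have key t : 0 < t -> t < T -> `|F 0 - AA 0 t S| <= K / S * t.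
  move=> t0 tT; pose s := Num.sqrt (T - t).
  have s0 : 0 < s by rewrite sqrtr_gt0 subr_gt0.
  have s2 : s ^+ 2 = T - t by rewrite sqr_sqrtr// subr_ge0 ltW.
  have sS : s < S by rewrite /s /S ltr_sqrt// gtrBl.
  have tT' : 0 < t <= T by rewrite t0 ltW.
  have Ss0 : 0 <= S - s by rewrite subr_ge0 ltW.
  have hS : `|s - S| <= S by rewrite distrC (ger0_norm Ss0) gerBl ltW.
  have SSn : `|S| <= S by rewrite (ger0_norm (ltW S0)).
  have rem := HC t S (s - S) tT' SSn hS; have [d1 d2] := HM1 t S tT' SSn.
  have ES : S + (s - S) = s by ring.
  rewrite ES in rem.
  rewrite (F_cst s0 sS) /F; have -> : T - s ^+ 2 = t by rewrite s2; ring.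
  have d : `|al * AA 1 t S - be * BB 1 t S| <= (`|al| + `|be|) * M1.
    by apply: (le_trans (ler_normB _ _)); rewrite !normrM mulrDl lerD// ler_wpM2l.
  have Sst : S - s <= t / S.
    rewrite ler_pdivlMr//; have -> : t = (S - s) * (S + s) by rewrite -subr_sqr SS s2; ring.
    by rewrite ler_wpM2l ?subr_ge0 ?ltW// ltrDl.
  apply: (@le_trans _ _ (K * (S - s))); last by rewrite mulrAC -mulrA ler_wpM2l.
  have -> : AA 0 t s - AA 0 t S = (AA 0 t s - AA 0 t S - (s - S) * (2 * S * (al * AA 1 t S - be * BB 1 t S)))
     + (s - S) * (2 * S * (al * AA 1 t S - be * BB 1 t S)).
    by rewrite subrK.
  apply: (le_trans (ler_normD _ _)); rewrite /K [X in _ <= X]mulrDl; apply: lerD.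
    apply: (le_trans rem); rewrite -mulrA ler_wpM2l// -sqrrN opprB expr2 ler_wpM2r ?subr_ge0 ?ltW// gtrBl//.
  have nS : `|2 * S| = 2 * S by rewrite ger0_norm// mulr_ge0// ltW.
  rewrite normrM mulrC distrC (ger0_norm Ss0) ler_wpM2r//.
  by rewrite normrM nS ler_wpM2l// mulr_ge0// ltW.
have lim' : AA 0 t S @[t --> 0^'+] --> F 0.
  apply/cvgrPdist_le => e e0.
  pose d := Num.min T (e / (K / S + 1)).
  have KS : 0 < K / S + 1 by rewrite ltr_pwDr// divr_ge0// ltW.
  have d0 : 0 < d by rewrite lt_min T0/= divr_gt0.
  exists d => // t /= td t0; move: td; rewrite sub0r normrN gtr0_norm//.
  rewrite lt_min => /andP[tT te].
  apply: (le_trans (key t t0 tT)); apply: (@le_trans _ _ ((K / S + 1) * t)).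
    by rewrite ler_wpM2r ?ltW// ltrDl.
  by move: te; rewrite ltr_pdivlMr// mulrC => /ltW.
by rewrite -F0; exact: cvg_unique lim' lim.
Qed.

End evolution.

(** * The thermoelastic system *)

Section characteristic_cubic.
Context {R : realType}.

(* The eigenvalues of A_0 + A_1, the roots of z^3 - 2 z^2 + 3 z - 1, are 2 - 2 al and al +- i be. *)
Lemma cubic_roots : exists al be : R, [/\ 0 < al, 0 < be, 0 < 2 - 2 * al,
  be ^+ 2 = 3 - 4 * al + 3 * al ^+ 2 & 5 - 14 * al + 16 * al ^+ 2 - 8 * al ^+ 3 = 0].
Proof.
(* From Vieta's formulas: the sum 2 of the roots makes the real one [2 - 2 al], the second symmetric
   function 3 determines [be^2], and the product 1 becomes the cubic [g al = 0]. *)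
pose g (x : R) := 5 - 14 * x + 16 * x ^+ 2 - 8 * x ^+ 3.
have cg : continuous g.
  move=> x; apply: cvgB; last by apply: cvgM; [exact: cvg_cst|exact: exprn_continuous].
  apply: cvgD; last by apply: cvgM; [exact: cvg_cst|exact: exprn_continuous].
  by apply: cvgB; [exact: cvg_cst|apply: cvgM; [exact: cvg_cst|exact: cvg_id]].
have [|||al] := @IVT R g (1 / 2) 1 0.
- lra.
- exact: continuous_subspaceT.
- have -> : g (1 / 2) = 1 by rewrite /g; field.
  have -> : g 1 = - 1 by rewrite /g; ring.
  by rewrite min_r ?max_l; lra.
rewrite in_itv/= => /andP[a1 a2] ga.
have a3 : al != 1 by apply/eqP => a; move: ga; rewrite /g a; lra.
have a4 : al < 1 by rewrite lt_neqAle a3.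
have b2 : 0 < 3 - 4 * al + 3 * al ^+ 2 by have := sqr_ge0 (al - 2 / 3); nra.
exists al, (Num.sqrt (3 - 4 * al + 3 * al ^+ 2)); split => //; [lra| |lra|].
- by rewrite sqrtr_gt0.
- by rewrite sqr_sqrtr// ltW.
Qed.

(* The rows (1 - z, z - z^2, z) with z = x and z = al + i be are left eigenvectors of the matrix
   of the system for (|D|^2 u, u_t, theta). *)
Lemma eigen_inverse (al be x : R) : be != 0 ->
  exists q : nat -> nat -> R, forall W1 W2 W3,
  let p1 := (1 - x) * W1 + (x - x ^+ 2) * W2 + x * W3 in
  let p2 := (1 - al) * W1 + (al - al ^+ 2 + be ^+ 2) * W2 + al * W3 in
  let p3 := (- be) * W1 + (be - 2 * al * be) * W2 + be * W3 in
  [/\ W1 = q 0%N 0%N * p1 + q 0%N 1%N * p2 + q 0%N 2%N * p3,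
      W2 = q 1%N 0%N * p1 + q 1%N 1%N * p2 + q 1%N 2%N * p3 &
      W3 = q 2%N 0%N * p1 + q 2%N 1%N * p2 + q 2%N 2%N * p3].
Proof.
move=> be0; pose D := (x - al) ^+ 2 + be ^+ 2.
have D0 : (x - al) ^+ 2 + be ^+ 2 != 0.
  by rewrite gt_eqF// ltr_wpDl ?sqr_ge0// lt_neqAle eq_sym sqrf_eq0 be0 sqr_ge0.
pose m := al ^+ 2 + be ^+ 2.
(* The row for [z] applied to [W] is the polynomial [W1 + (W2 + W3 - W1) z - W2 z^2]. Its
   coefficients [c0], [c1], [c2] are recovered by Lagrange interpolation from the values at [x] and
   at [al + i be] with its conjugate. *)
pose c2 i := if i == 0%N then D^-1 else if i == 1%N then - D^-1 else (al - x) / (be * D).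
pose c1 i := (if i == 2%N then be^-1 else 0) - 2 * al * c2 i.
pose c0 i := (if i == 0%N then 0 else if i == 1%N then 1 else - al / be) + m * c2 i.
exists (fun i j => if i == 0%N then c0 j else if i == 1%N then - c2 j else c1 j + c0 j + c2 j).
move=> W1 W2 W3 /=; rewrite /c1 /c0 /c2 /= /m /D.
by split; field; rewrite be0 D0.
Qed.

End characteristic_cubic.

Section system.
Context {R : realType} (n : nat).
Local Notation rn := 'rV[R]_n.
Local Notation dist := ((rn -> R) -> R).
Implicit Types (phi : rn -> R).

Lemma tempered_lin (a : R) (T1 T2 : dist) : tempered T1 -> tempered T2 ->
  tempered (fun phi => a * T1 phi + T2 phi).
Proof.
move=> [l1 [N1 [k1 [C1 b1]]]] [l2 [N2 [k2 [C2 b2]]]]; split.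
  by move=> c f g sf sg; rewrite l1// l2//; ring.
exists (maxn N1 N2), (maxn k1 k2), (`|a| * C1 + C2) => phi sphi M HM.
have en1 (x : rn) : 1 <= 1 + enorm x by rewrite lerDl sqrtr_ge0.
rewrite mulrDl (le_trans (ler_normD _ _))// normrM -mulrA lerD//.
  rewrite ler_wpM2l// b1// => l ll x; apply: le_trans (HM l _ x); last by rewrite (leq_trans ll)// leq_maxl.
  by rewrite ler_wpM2r// ler_weXn2l// leq_maxl.
apply: b2 => // l ll x; apply: le_trans (HM l _ x); last by rewrite (leq_trans ll)// leq_maxr.
by rewrite ler_wpM2r// ler_weXn2l// leq_maxr.
Qed.

Lemma nlap_lin (a : R) (f g : rn -> R) : schwartz f -> schwartz g ->
  nlap (fun x => a * f x + g x) = (fun x => a * nlap f x + nlap g x).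
Proof.
move=> sf sg; apply/funext => x; rewrite /nlap /laplacian mulrN -opprD mulr_sumr -big_split/=.
congr (- _); apply: eq_bigr => i _.
by have := pderivs_lin [:: i; i] a sf sg => /= ->.
Qed.

Lemma tempered_nlap (T : dist) : tempered T -> tempered (fun phi => T (nlap phi)).
Proof.
move=> [lT [N [k [C bT]]]]; split.
  by move=> a f g sf sg; rewrite nlap_lin// lT//; exact: schwartz_nlap.
exists N.+2, k, (C * n%:R) => phi sphi M HM; rewrite -mulrA; apply: bT; first exact: schwartz_nlap.
move=> l ll x.
have -> : nlap phi = (fun x => (-1) * laplacian phi x) by apply/funext => y; rewrite mulN1r.
rewrite pderivsZ; last exact: schwartz_laplacian.
rewrite mulN1r normrN pderivs_sum; last by move=> i; do 2 apply: schwartz_pderiv.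
have en0 : 0 <= (1 + enorm x) ^+ k by rewrite exprn_ge0// addr_ge0// sqrtr_ge0.
apply: (@le_trans _ _ (\sum_(i < n) M)); last by rewrite sumr_const card_ord mulr_natl lexx.
apply: (le_trans (ler_wpM2l en0 (ler_norm_sum _ _ _))); rewrite mulr_sumr; apply: ler_sum => i _.
have := HM (l ++ [:: i; i]) _ x; rewrite pderivs_cat; apply.
by rewrite size_cat addn2.
Qed.

(** [W 0], [W 1], [W 2] stand for [|D|^2 u], [u_t], [theta]. As [|D|^2 u = - Delta u], each term on
    the right carries exactly one Laplacian, placed on the test function. *)
Definition plate_system (W : nat -> R -> dist) (W0 : nat -> dist) : Prop :=
  [/\ forall i t, 0 < t -> tempered (W i t),
      forall (t : R) phi, 0 < t -> schwartz phi ->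
        [/\ is_derive t (1 : R) (W 0%N ^~ phi) (- W 1%N t (laplacian phi)),
            is_derive t (1 : R) (W 1%N ^~ phi)
              (W 0%N t (laplacian phi) + W 1%N t (laplacian phi) - W 2%N t (laplacian phi)) &
            is_derive t (1 : R) (W 2%N ^~ phi) (W 1%N t (laplacian phi) + W 2%N t (laplacian phi))] &
      forall i phi, schwartz phi -> W i t phi @[t --> 0^'+] --> W0 i phi].

Section solution.
Variables (W : nat -> R -> dist) (W0 : nat -> dist).
Hypothesis sys : plate_system W W0.

Let comb (a b c : R) t phi := a * W 0%N t phi + (b * W 1%N t phi + c * W 2%N t phi).
Let comb0 (a b c : R) phi := a * W0 0%N phi + (b * W0 1%N phi + c * W0 2%N phi).

Let tcomb a b c t : 0 < t -> tempered (comb a b c t).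
Proof.
move=> t0; have [tW _ _] := sys; apply: tempered_lin; first exact: tW.
apply: tempered_lin; first exact: tW.
have -> : (fun phi => c * W 2%N t phi) = (fun phi => (c - 1) * W 2%N t phi + W 2%N t phi).
  by apply/funext => phi; ring.
by apply: tempered_lin; exact: tW.
Qed.

(** The new coefficients are the row [(a, b, c)] times the matrix of the system. *)
Let dcomb a b c (t : R) phi : 0 < t -> schwartz phi ->
  is_derive t (1 : R) (comb a b c ^~ phi) (comb b (b + c - a) (c - b) t (laplacian phi)).
Proof.
move=> t0 sphi; have [_ dW _] := sys; have [d0 d1 d2] := dW t phi t0 sphi.
apply: isd_eq (isdD (isdZ a d0) (isdD (isdZ b d1) (isdZ c d2))) _.
rewrite /comb; move: (W 0%N t _) (W 1%N t _) (W 2%N t _) => x y z; ring.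
Qed.

Let lcomb a b c phi : schwartz phi -> comb a b c t phi @[t --> 0^'+] --> comb0 a b c phi.
Proof.
move=> sphi; have [_ _ lW] := sys; apply: cvgD; first by apply: cvgM; [exact: cvg_cst|exact: lW].
by apply: cvgD; (apply: cvgM; [exact: cvg_cst|exact: lW]).
Qed.

(** The initial values are limits of the tempered distributions [W i t], from which they inherit
    linearity. *)
Lemma initial_lin i (a : R) (f g : rn -> R) : schwartz f -> schwartz g ->
  W0 i (fun x => a * f x + g x) = a * W0 i f + W0 i g.
Proof.
move=> sf sg; have [tW _ lW] := sys.
have l1 := lW i _ (schwartz_lin a sf sg).
have l2 : (a * W i t f + W i t g) @[t --> 0^'+] --> a * W0 i f + W0 i g.
  by apply: cvgD; [apply: cvgM; [exact: cvg_cst|exact: lW]|exact: lW].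
suff l3 : W i t (fun x => a * f x + g x) @[t --> 0^'+] --> a * W0 i f + W0 i g by exact: cvg_unique l1 l3.
apply: cvg_trans l2; apply: near_eq_cvg.
by near=> t; rewrite (temp_lin _ (tW i t _))//; near: t; exact: nbhs_right_gt.
Unshelve. all: by end_near.
Qed.

Lemma initialZ i (a : R) (f : rn -> R) : schwartz f -> W0 i (fun x => a * f x) = a * W0 i f.
Proof.
move=> sf; have z : W0 i (fun _ => 0) = 0.
  by have := initial_lin i (-1) (@schwartz0 R n) (@schwartz0 R n); rewrite mulr0 addr0 mulN1r addNr.
have := initial_lin i a sf (@schwartz0 R n); rewrite z addr0 => <-; congr W0.
by apply/funext => x; rewrite addr0.
Qed.

(** The equations say that [(a2, b2, c2) + i (a3, b3, c3)] is a left eigenvector for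
    [z = al + i be], so the two combinations are the real and imaginary parts of a solution of
    [w_t = z Delta w]. *)
Lemma pair_evolution (al be : R) kR kI (a2 b2 c2 a3 b3 c3 : R) T phi :
  zkernel al be kR kI ->
  [/\ b2 = al * a2 - be * a3, b2 + c2 - a2 = al * b2 - be * b3 & c2 - b2 = al * c2 - be * c3] ->
  [/\ b3 = al * a3 + be * a2, b3 + c3 - a3 = al * b3 + be * b2 & c3 - b3 = al * c3 + be * c2] ->
  0 < T -> schwartz phi ->
  comb a2 b2 c2 T phi = comb0 a2 b2 c2 (cv (Num.sqrt T) kR phi) - comb0 a3 b3 c3 (cv (Num.sqrt T) kI phi).
Proof.
move=> zk [e1 e2 e3] [e4 e5 e6] T0 sphi.
apply: (@evolution R n al be kR kI zk (comb a2 b2 c2) (comb a3 b3 c3)) => //.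
- by move=> t t0; exact: tcomb.
- by move=> t t0; exact: tcomb.
- move=> t psi t0 sp; apply: isd_eq (dcomb a2 b2 c2 t0 sp) _.
  rewrite /comb e2 e3; rewrite [X in X * W 0%N _ _ + _]e1; move: (W 0%N t _) (W 1%N t _) (W 2%N t _) => x y z; ring.
- move=> t psi t0 sp; apply: isd_eq (dcomb a3 b3 c3 t0 sp) _.
  rewrite /comb e5 e6; rewrite [X in X * W 0%N _ _ + _]e4; move: (W 0%N t _) (W 1%N t _) (W 2%N t _) => x y z; ring.
- by move=> psi sp; exact: lcomb.
- by move=> psi sp; exact: lcomb.
Qed.

End solution.

Lemma system_representation : exists K : nat -> nat -> rn -> R,
  (forall i j, schwartz (K i j)) /\
  forall W W0, plate_system W W0 -> forall (T : R) phi i, 0 < T -> schwartz phi -> (i < 3)%N ->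
  W i T phi = W0 0%N (cv (Num.sqrt T) (K i 0%N) phi) + W0 1%N (cv (Num.sqrt T) (K i 1%N) phi)
              + W0 2%N (cv (Num.sqrt T) (K i 2%N) phi).
Proof.
have [al [be [al0 be0 x0 B Q]]] := @cubic_roots R.
pose x := 2 - 2 * al.
have [k1 [k1' zk1]] := @zkernel_exists R n x 0 x0 (lexx _).
have [kR [kI zk]] := @zkernel_exists R n al be al0 (ltW be0).
have [q Hq] := @eigen_inverse R al be x (lt0r_neq0 be0).
pose l1 (j : nat) := if j == 0%N then 1 - x else if j == 1%N then x - x ^+ 2 else x.
pose l2 (j : nat) := if j == 0%N then 1 - al else if j == 1%N then al - al ^+ 2 + be ^+ 2 else al.
pose l3 (j : nat) := if j == 0%N then - be else if j == 1%N then be - 2 * al * be else be.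
(* Inverting the eigenvector transformation by [q] and collecting terms: [ca], [cb], [cc] are the
   coefficients of the real Gaussian [k1] and of [kR] and [kI]. *)
pose ca i j := q i 0%N * l1 j; pose cb i j := q i 1%N * l2 j + q i 2%N * l3 j.
pose cc i j := q i 2%N * l2 j - q i 1%N * l3 j.
have s1 := zk_sR zk1; have sR := zk_sR zk; have sI := zk_sI zk.
exists (fun i j y => ca i j * k1 y + (cb i j * kR y + cc i j * kI y)); split.
  by move=> i j; apply: schwartz_lin => //; apply: schwartz_lin => //; exact: schwartzZ.
move=> W W0 sys T phi i T0 sphi i3; set S := Num.sqrt T.
(* With the root relations multiplied by [al] and [be], the eigenvector equations are linear in the
   monomials that occur. *)
have Bal : al * be ^+ 2 = al * (3 - 4 * al + 3 * al ^+ 2) by rewrite B.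
have Bbe : be * be ^+ 2 = be * (3 - 4 * al + 3 * al ^+ 2) by rewrite B.
have Qbe : be * (5 - 14 * al + 16 * al ^+ 2 - 8 * al ^+ 3) = 0 by rewrite Q mulr0.
have Qal : al * (5 - 14 * al + 16 * al ^+ 2 - 8 * al ^+ 3) = 0 by rewrite Q mulr0.
have P1 : (1 - x) * W 0%N T phi + (x - x ^+ 2) * W 1%N T phi + x * W 2%N T phi =
    l1 0%N * W0 0%N (cv S k1 phi) + l1 1%N * W0 1%N (cv S k1 phi) + l1 2%N * W0 2%N (cv S k1 phi).
  have h1 : [/\ x - x ^+ 2 = x * (1 - x) - 0 * 0, x - x ^+ 2 + x - (1 - x) = x * (x - x ^+ 2) - 0 * 0
     & x - (x - x ^+ 2) = x * x - 0 * 0] by split; rewrite /x; lra.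
  have h2 : [/\ 0 = x * 0 + 0 * (1 - x), 0 + 0 - 0 = x * 0 + 0 * (x - x ^+ 2)
     & 0 - 0 = x * 0 + 0 * x] by split; ring.
  have := @pair_evolution W W0 sys x 0 k1 k1' (1 - x) (x - x ^+ 2) x 0 0 0 T phi zk1 h1 h2 T0 sphi.
  rewrite !mul0r !addr0 subr0 => H.
  rewrite -addrA H /l1/= addrA.
  by [].
have E2 : [/\ al - al ^+ 2 + be ^+ 2 = al * (1 - al) - be * - be,
    al - al ^+ 2 + be ^+ 2 + al - (1 - al) = al * (al - al ^+ 2 + be ^+ 2) - be * (be - 2 * al * be) &
    al - (al - al ^+ 2 + be ^+ 2) = al * al - be * be].
  by split; lra.
have E3 : [/\ be - 2 * al * be = al * - be + be * (1 - al),
    be - 2 * al * be + be - - be = al * (be - 2 * al * be) + be * (al - al ^+ 2 + be ^+ 2) &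
    be - (be - 2 * al * be) = al * be + be * al].
  by split; lra.
have P2 : (1 - al) * W 0%N T phi + (al - al ^+ 2 + be ^+ 2) * W 1%N T phi + al * W 2%N T phi =
    (l2 0%N * W0 0%N (cv S kR phi) + l2 1%N * W0 1%N (cv S kR phi) + l2 2%N * W0 2%N (cv S kR phi))
    - (l3 0%N * W0 0%N (cv S kI phi) + l3 1%N * W0 1%N (cv S kI phi) + l3 2%N * W0 2%N (cv S kI phi)).
  have H := @pair_evolution W W0 sys al be kR kI _ _ _ _ _ _ T phi zk E2 E3 T0 sphi.
  by rewrite -addrA H /l2 /l3/= !addrA.
(* [pair_evolution] returns the real part only. Multiplying the eigenvector by [- i] makes its
   imaginary row the real one. *)
have E3' : [/\ be - 2 * al * be = al * - be - be * - (1 - al),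
    be - 2 * al * be + be - - be = al * (be - 2 * al * be) - be * - (al - al ^+ 2 + be ^+ 2) &
    be - (be - 2 * al * be) = al * be - be * - al].
  by split; lra.
have E2' : [/\ - (al - al ^+ 2 + be ^+ 2) = al * (- (1 - al)) + be * (- be),
    - (al - al ^+ 2 + be ^+ 2) + (- al) - (- (1 - al)) = al * (- (al - al ^+ 2 + be ^+ 2)) + be * (be - 2 * al * be) &
    - al - - (al - al ^+ 2 + be ^+ 2) = al * (- al) + be * be].
  by split; lra.
have P3 : (- be) * W 0%N T phi + (be - 2 * al * be) * W 1%N T phi + be * W 2%N T phi =
    (l3 0%N * W0 0%N (cv S kR phi) + l3 1%N * W0 1%N (cv S kR phi) + l3 2%N * W0 2%N (cv S kR phi))
    + (l2 0%N * W0 0%N (cv S kI phi) + l2 1%N * W0 1%N (cv S kI phi) + l2 2%N * W0 2%N (cv S kI phi)).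
  have H := @pair_evolution W W0 sys al be kR kI _ _ _ _ _ _ T phi zk E3' E2' T0 sphi.
  rewrite -addrA H /l2 /l3/= -/S; clear.
  by move: (W0 _ _) (W0 _ _) (W0 _ _) (W0 _ _) (W0 _ _) (W0 _ _) => *; ring.
have KE j : W0 j (cv S (fun y => ca i j * k1 y + (cb i j * kR y + cc i j * kI y)) phi) =
   ca i j * W0 j (cv S k1 phi) + (cb i j * W0 j (cv S kR phi) + cc i j * W0 j (cv S kI phi)).
  have kk1 := kern_schwartz s1; have kkR := kern_schwartz sR; have kkI := kern_schwartz sI.
  have kkcI := kern_schwartz (schwartzZ (cc i j) sI).
  have kk2 := kern_schwartz (schwartz_lin (cb i j) sR (schwartzZ (cc i j) sI)).
  rewrite cv_lin_l// cv_lin_l//.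
  have -> : cv S (fun y => cc i j * kI y) phi = (fun x => cc i j * cv S kI phi x).
    apply/funext => z; rewrite /cv -RintZl.
      by apply: eq_Rint => y; rewrite mulrA.
    by apply: intg_cv => //; [exact: schwartz_measurable|exact: schwartz_bounded].
  have c1 := schwartz_cv S kk1 sphi; have c2 := schwartz_cv S kkR sphi; have c3 := schwartz_cv S kkI sphi.
  rewrite (initial_lin sys)//; last by apply: schwartz_lin => //; exact: schwartzZ.
  rewrite (initial_lin sys)//; last exact: schwartzZ.
  by rewrite (initialZ sys).
rewrite !KE /ca /cb /cc.
have [w0 w1 w2] := Hq (W 0%N T phi) (W 1%N T phi) (W 2%N T phi).
rewrite P1 P2 P3 in w0 w1 w2.
have lin (q0 q1 q2 : R) (y0 y1 y2 r0 r1 r2 i0 i1 i2 a0 a1 a2 b0 b1 b2 c0 c1 c2 : R) :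
  q0 * (a0 * y0 + a1 * y1 + a2 * y2) +
  q1 * (b0 * r0 + b1 * r1 + b2 * r2 - (c0 * i0 + c1 * i1 + c2 * i2)) +
  q2 * (c0 * r0 + c1 * r1 + c2 * r2 + (b0 * i0 + b1 * i1 + b2 * i2)) =
  q0 * a0 * y0 + ((q1 * b0 + q2 * c0) * r0 + (q2 * b0 - q1 * c0) * i0) +
  (q0 * a1 * y1 + ((q1 * b1 + q2 * c1) * r1 + (q2 * b1 - q1 * c1) * i1)) +
  (q0 * a2 * y2 + ((q1 * b2 + q2 * c2) * r2 + (q2 * b2 - q1 * c2) * i2)) by ring.
by case: i i3 {KE} => [|[|[|//]]] _; rewrite ?w0 ?w1 ?w2; exact: lin.
Qed.

Lemma plate_is_system (u0 u1 th0 : dist) (u th : R -> dist) : plate_solution u0 u1 th0 u th ->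
  plate_system (fun i t phi => if i == 0%N then u t (nlap phi) else if i == 1%N then dt u t phi else th t phi)
    (fun i phi => if i == 0%N then u0 (nlap phi) else if i == 1%N then u1 phi else th0 phi).
Proof.
move=> [tem der eq1 eq2 init]; split.
- move=> [|[|i]] t t0 /=; have [h1 h2 h3] := tem t t0 => //.
  exact: tempered_nlap.
- move=> t phi t0 sphi /=.
  have snl := schwartz_nlap sphi; have sl := schwartz_laplacian sphi.
  have [t1 t2 t3] := tem t t0.
  have [dnl _ _] := der t _ t0 snl; have [_ d2 d3] := der t _ t0 sphi.
  have e1 := eq1 t _ t0 sphi; have e2 := eq2 t _ t0 sphi.
  have Enl : u t (nlap (laplacian phi)) = - u t (laplacian (laplacian phi)).
    exact: (tempN t1 (schwartz_laplacian sl)).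
  split.
  + by apply: DeriveDef => //; rewrite -derive1E; exact: (tempN t2 sl).
  + apply: DeriveDef => //; rewrite -derive1E Enl -[LHS]/(dt (dt u) t phi).
    by move: e1; move: (dt (dt u) t phi) (u t _) (th t _) (dt u t _) => a b c d; lra.
  + apply: DeriveDef => //; rewrite -derive1E -[LHS]/(dt th t phi).
    by move: e2; move: (dt th t phi) (th t _) (dt u t _) => a b c; lra.
- move=> [|[|i]] phi sphi /=.
  + by have [] := init _ (schwartz_nlap sphi).
  + by have [] := init _ sphi.
  + by have [] := init _ sphi.
Qed.

End system.

(** * L^p-L^q estimates *)

Section young_scalar.
Context {R : realType}.
Implicit Types (a l p m V A : R).

(** If [a > l], then [a = a^(1 - p) a^p], and the exponent [1 - p] is not positive. *)
Lemma split_powR a l p : 0 <= a -> 0 < l -> 1 <= p -> a <= l + l `^ (1 - p) * a `^ p.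
Proof.
move=> a0 l0 p1; have [al|la] := leP a l.
  by apply: (le_trans al); rewrite lerDl mulr_ge0// powR_ge0.
have a1 : 0 < a by exact: lt_trans la.
apply: (@le_trans _ _ (l `^ (1 - p) * a `^ p)); last by rewrite lerDr ltW.
rewrite -[X in X <= _](lnK a1) /powR !gt_eqF// -expRD ler_expR.
have : ln l <= ln a by rewrite ler_ln ?posrE// ltW.
by nra.
Qed.

(* Replaces Hoelder's inequality: choose l to balance the two terms. *)
Lemma young_optimize A V m p : 0 <= V -> 0 < m -> 1 <= p ->
  (forall l, 0 < l -> A <= l * m + l `^ (1 - p) * V) ->
  A <= 2 * (m `^ (1 - p^-1) * V `^ p^-1).
Proof.
move=> V0 m0 p1 H; have p0 : 0 < p by exact: lt_le_trans p1.
have [Vz|Vn] := eqVneq V 0.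
  apply: (@le_trans _ _ 0); last by rewrite !mulr_ge0 ?powR_ge0.
  apply/ler_addgt0Pr => e e0; rewrite add0r; have := H (e / m) (divr_gt0 e0 m0).
  by rewrite Vz mulr0 addr0 divfK// gt_eqF.
have V1 : 0 < V by rewrite lt_neqAle eq_sym Vn.
set X := m `^ (1 - p^-1) * V `^ p^-1.
pose l := expR ((ln V - ln m) / p).
have -> : 2 * X = l * m + l `^ (1 - p) * V; last by apply: H; exact: expR_gt0.
have E1 : l * m = X.
  rewrite /X /l /powR !gt_eqF// -expRD -[in LHS](lnK m0) -expRD; congr expR.
  by rewrite lnK ?posrE//; field; rewrite gt_eqF.
have E2 : l `^ (1 - p) * V = X.
  rewrite /X /powR !gt_eqF ?expR_gt0// -expRD -[in LHS](lnK V1) -expRD; congr expR.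
  by rewrite /l expRK; field; rewrite gt_eqF.
by rewrite E1 E2; ring.
Qed.

End young_scalar.

Section young.
Context {R : realType} (n : nat).
Local Notation rn := 'rV[R]_n.
Local Notation mu := (@lebesgue_rV R n).
Implicit Types (h w a psi : rn -> R) (z : rn).

Definition conv h w z : R := \int[mu]_x (h (z - x) * w x).

(** Bounded by a constant plus an integrable function. This covers all [L^p] with [p >= 1], given a
    bounded representative when [p = +oo], and makes convolution with a bounded integrable kernel
    converge at every point. *)
Definition tame w : Prop := measurable_fun setT w /\
  exists (c : R) b, [/\ 0 <= c, forall x, 0 <= b x, intg mu b & forall x, `|w x| <= c + b x].

Section fixed_kernel.
Variables (h : rn -> R) (H : R).
Hypotheses (ih : intg mu h) (hH : forall x, `|h x| <= H).

Let mh : measurable_fun setT h := intg_measurable ih.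
Let H0 : 0 <= H. Proof. exact: le_trans (hH 0). Qed.

Let mhs : measurable_fun setT (fun z : rn * rn => h (z.1 - z.2)).
Proof. by apply: (measurableT_comp mh); apply: measurable_funB_rV; [exact: measurable_fst|exact: measurable_snd]. Qed.

Let ihs z : intg mu (fun x => h (z - x)). Proof. exact: intg_reflect. Qed.

Lemma intg_conv w z : tame w -> intg mu (fun x => h (z - x) * w x).
Proof.
move=> [mw [c [b [c0 b0 ib wb]]]].
apply: (@intg_le _ _ _ mu _ (fun x => c * `|h (z - x)| + H * b x)).
- by apply: measurable_funM => //; exact: intg_measurable (ihs z).
- by apply: intgD; apply: intgZl => //; exact: intg_norm (ihs z).
- move=> x; rewrite normrM; apply: (@le_trans _ _ (`|h (z - x)| * (c + b x))).
    by rewrite ler_wpM2l.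
  by rewrite mulrDr [_ * c]mulrC lerD// ler_wpM2r.
Qed.

Lemma measurable_conv w : tame w -> measurable_fun setT (conv h w).
Proof.
move=> tw; have [mw _] := tw; apply: measurable_Rint_intg; last by move=> z; exact: intg_conv.
by apply: measurable_funM => //; exact: measurableT_comp mw measurable_snd.
Qed.

Lemma conv_fubini w psi : tame w -> intg mu psi ->
  intg mu (fun z => psi z * conv h w z) /\
  \int[mu]_z (psi z * conv h w z) = \int[mu]_x (w x * \int[mu]_z (psi z * h (z - x))).
Proof.
move=> tw ip; have [mw [c [b [c0 b0 ib wb]]]] := tw; have mp := intg_measurable ip.
pose f z x := psi z * (h (z - x) * w x).
have ix z : intg mu (f z) by apply: intgZl; exact: intg_conv.
have isz x : intg mu (fun z => psi z * h (z - x)).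
  apply: (@intg_mul_bounded _ _ _ mu _ (fun z => h (z - x)) H) => //.
  by apply: (measurableT_comp mh); apply: measurable_funB_rV; [exact: measurable_id|exact: measurable_cst].
have iz x : intg mu (f ^~ x).
  apply: (@intg_eq _ _ _ mu (fun z => w x * (psi z * h (z - x)))); last exact: intgZl.
  by move=> z; rewrite /f; ring.
have mf : measurable_fun setT (fun z : rn * rn => f z.1 z.2).
  apply: measurable_funM; first exact: measurableT_comp mp measurable_fst.
  by apply: measurable_funM => //; exact: measurableT_comp mw measurable_snd.
have J z : \int[mu]_x `|h (z - x) * w x| <= c * (\int[mu]_x `|h x|) + H * \int[mu]_x b x.
  rewrite -(Rint_reflect z (intg_norm ih)).
  have i1 := intgZl c (intg_norm (ihs z)); have i2 := intgZl H ib.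
  rewrite -(RintZl c (intg_norm (ihs z))) -(RintZl H ib) -(RintegralD measurableT i1 i2).
  apply: (le_trans (ler_norm _)); apply: Rint_norm_le; [by apply: intg_norm; exact: intg_conv|exact: intgD|].
  move=> x; rewrite normr_id normrM; apply: (@le_trans _ _ (`|h (z - x)| * (c + b x))).
    by rewrite ler_wpM2l.
  by rewrite mulrDr [_ * c]mulrC lerD// ler_wpM2r.
have if_ : intg (mu \x mu)%E (fun z : rn * rn => f z.1 z.2).
  apply: (@intg_prodP _ _ _ _ _ mu mu f (fun z => `|psi z| * (c * (\int[mu]_x `|h x|) + H * \int[mu]_x b x))) => //.
    move=> z; apply: le_trans (ler_wpM2l (normr_ge0 (psi z)) (J z)).
    rewrite -(RintZl _ (intg_norm (intg_conv z tw))).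
    have e x : `|f z x| = `|psi z| * `|h (z - x) * w x| by rewrite normrM.
    by rewrite (eq_Rint mu e); exact: lexx.
  by apply: intgZr; exact: intg_norm.
have fE z : \int[mu]_x f z x = psi z * conv h w z := RintZl (psi z) (intg_conv z tw).
have fE' x : \int[mu]_z f z x = w x * \int[mu]_z (psi z * h (z - x)).
  rewrite -(RintZl _ (isz x)); apply: eq_Rint => z; rewrite /f; ring.
have [i1 _ E] := RFubini if_ ix iz; split.
  by apply: intg_eq i1; exact: fE.
exact: (etrans (esym (eq_Rint mu fE)) (etrans E (eq_Rint mu fE'))).
Qed.

Variable m : R.
Hypotheses (m0 : 0 < m) (hm : \int[mu]_x `|h x| <= m).

Let V a z := \int[mu]_x (`|h (z - x)| * a x).

Let ihV a z : intg mu a -> intg mu (fun x => `|h (z - x)| * a x).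
Proof.
move=> ia; apply: (@intg_eq _ _ _ mu (fun x => a x * `|h (z - x)|)); first by move=> x; rewrite mulrC.
apply: (@intg_mul_bounded _ _ _ mu _ _ H) => //; last by move=> x; rewrite normr_id.
exact: intg_measurable (intg_norm (ihs z)).
Qed.

Lemma conv_abs_le a z : intg mu a -> (forall x, 0 <= a x) ->
  0 <= V a z <= H * \int[mu]_x a x.
Proof.
move=> ia a0; apply/andP; split.
  by apply: Rintegral_ge0 => x _; rewrite mulr_ge0.
rewrite -(RintZl _ ia); apply: (le_trans (ler_norm _)); apply: Rint_norm_le; [exact: ihV|exact: intgZl|].
by move=> x; rewrite ger0_norm ?mulr_ge0// ler_wpM2r.
Qed.

Lemma conv_abs_intg a : intg mu a -> (forall x, 0 <= a x) ->
  intg mu (V a) /\ \int[mu]_z V a z <= m * \int[mu]_x a x.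
Proof.
move=> ia a0; have ma := intg_measurable ia; have ihn := intg_norm ih.
pose f x z := `|h (z - x)| * a x.
have ishift x : intg mu (fun z => `|h (z - x)|) by exact: intg_shift ihn.
have iz x : intg mu (f x) by exact: intgZr.
have ix z : intg mu (f ^~ z) by exact: ihV.
have fE x : \int[mu]_z f x z = (\int[mu]_z `|h z|) * a x.
  by rewrite -(Rint_shift (- x) ihn) -(RintZr _ (ishift x)).
have mf : measurable_fun setT (fun z : rn * rn => f z.1 z.2).
  apply: measurable_funM; last exact: measurableT_comp ma measurable_fst.
  apply: measurableT_comp => //; apply: (measurableT_comp mh).
  by apply: measurable_funB_rV; [exact: measurable_snd|exact: measurable_fst].
have if_ : intg (mu \x mu)%E (fun z : rn * rn => f z.1 z.2).
  apply: (@intg_prodP _ _ _ _ _ mu mu f (fun x => (\int[mu]_z `|h z|) * a x)) => //; last exact: intgZl.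
  move=> x; rewrite -fE (eq_Rint mu (g := f x))// => z.
  by rewrite ger0_norm// mulr_ge0.
have [_ i2 E] := RFubini if_ iz ix; split; first exact: i2.
have E' : \int[mu]_z V a z = (\int[mu]_z `|h z|) * \int[mu]_x a x.
  exact: (etrans (esym E) (etrans (eq_Rint mu fE) (RintZl _ ia))).
by rewrite E' ler_wpM2r// Rintegral_ge0.
Qed.

Section finite_exponent.
Variables (w : rn -> R) (p : R).
Hypotheses (mw : measurable_fun setT w) (p1 : 1 <= p) (iw : intg mu (fun x => `|w x| `^ p)).

Lemma tame_powR : tame w.
Proof.
split => //; exists 1, (fun x => `|w x| `^ p); split => // x.
by have := split_powR (normr_ge0 (w x)) ltr01 p1; rewrite powR1 mul1r.
Qed.

Let W z := V (fun x => `|w x| `^ p) z.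

(** Split [|w|] at level [l] under the integral and optimize in [l]: a pointwise Hoelder bound that
    loses a factor 2. *)
Lemma conv_pointwise z : `|conv h w z| <= 2 * (m `^ (1 - p^-1) * (W z) `^ p^-1).
Proof.
have a0 x : 0 <= `|w x| `^ p by exact: powR_ge0.
apply: young_optimize => //; first by case/andP: (conv_abs_le z iw a0).
move=> l l0.
have i1 := intgZl l (intg_norm (ihs z)); have i2 := intgZl (l `^ (1 - p)) (ihV z iw).
apply: (@le_trans _ _ (l * (\int[mu]_x `|h (z - x)|) + l `^ (1 - p) * W z)); last first.
  rewrite lerD2r; apply: (ler_wpM2l (ltW l0)).
  by rewrite (Rint_reflect z (intg_norm ih)).
rewrite -(RintZl l (intg_norm (ihs z))) /W /V -(RintZl (l `^ (1 - p)) (ihV z iw)) -(RintegralD measurableT i1 i2).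
apply: Rint_norm_le; [exact: intg_conv tame_powR|exact: intgD|].
move=> x; rewrite normrM [l * _]mulrC mulrCA -mulrDr ler_wpM2l//.
exact: split_powR.
Qed.

Let N := \int[mu]_x (`|w x| `^ p).
Let N0 : 0 <= N. Proof. by apply: Rintegral_ge0 => x _; exact: powR_ge0. Qed.

Lemma conv_sup z : `|conv h w z| <= 2 * (m `^ (1 - p^-1) * (H * N) `^ p^-1).
Proof.
have a0 x : 0 <= `|w x| `^ p by exact: powR_ge0.
have /andP[W0 WH] := conv_abs_le z iw a0.
apply: (le_trans (conv_pointwise z)); rewrite ler_wpM2l// ler_wpM2l ?powR_ge0//.
apply: ge0_ler_powR => //; first by rewrite invr_ge0 (le_trans _ p1).
by rewrite nnegrE mulr_ge0.
Qed.

(** In the [q]-th power of the pointwise bound, [W^(q / p)] is [W^(q / p - 1)], controlled by the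
    supremum [H N] of [W], times [W], whose integral is at most [m N]. *)
Lemma conv_Lq q : p <= q -> intg mu (fun z => `|conv h w z| `^ q) /\
  \int[mu]_z (`|conv h w z| `^ q) <= (2 * m `^ (1 - p^-1)) `^ q * (H * N) `^ (q / p - 1) * (m * N).
Proof.
move=> pq; have a0 x : 0 <= `|w x| `^ p by exact: powR_ge0.
have p0 : 0 < p by exact: lt_le_trans p1.
have q0 : 0 < q by exact: lt_le_trans pq.
have qp : 1 <= q / p by rewrite ler_pdivlMr// mul1r.
have [iW WN] := conv_abs_intg iw a0.
set c := (2 * m `^ (1 - p^-1)) `^ q * (H * N) `^ (q / p - 1).
have c0 : 0 <= c by rewrite mulr_ge0 ?powR_ge0.
have L z : `|conv h w z| `^ q <= c * W z.
  have /andP[W0 WH] := conv_abs_le z iw a0.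
  apply: (@le_trans _ _ ((2 * m `^ (1 - p^-1) * (W z) `^ p^-1) `^ q)).
    apply: ge0_ler_powR; rewrite ?nnegrE ?mulr_ge0 ?powR_ge0 ?(ltW q0)//.
    by rewrite -mulrA; exact: conv_pointwise.
  rewrite powRM ?mulr_ge0 ?powR_ge0// /c -mulrA ler_wpM2l ?powR_ge0//.
  rewrite -powRrM mulrC.
  have [Wz|Wn] := eqVneq (W z) 0.
    by rewrite Wz mulr0 powR0// mulf_neq0 ?invr_neq0 ?gt_eqF.
  have -> : q / p = (q / p - 1) + 1 by rewrite subrK.
  rewrite powRD; last by rewrite Wn implybT.
  rewrite powRr1// addrK ler_wpM2r//; apply: ge0_ler_powR; rewrite ?nnegrE ?subr_ge0 ?mulr_ge0//.
have ic : intg mu (fun z => `|conv h w z| `^ q).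
  apply: (@intg_le _ _ _ mu _ (fun z => c * W z)); last by move=> z; rewrite ger0_norm ?powR_ge0.
    apply: (measurableT_comp (measurable_powR q)); apply: measurableT_comp => //.
    exact: measurable_conv tame_powR.
  exact: intgZl.
split => //; apply: (@le_trans _ _ (c * \int[mu]_z W z)); last by rewrite ler_wpM2l.
rewrite -(RintZl c iW); apply: (le_trans (ler_norm _)); apply: Rint_norm_le => //; first exact: intgZl.
by move=> z; rewrite ger0_norm ?powR_ge0.
Qed.

End finite_exponent.

End fixed_kernel.

End young.

Section lebesgue_norms.
Context {R : realType} (n : nat).
Local Notation rn := 'rV[R]_n.
Local Notation mu := (@lebesgue_rV R n).
Implicit Types (w f h : rn -> R).

(** On a null space the heat kernel would have integral 0. Positivity is what makes the norm for
    [p = +oo] an essential supremum. *)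
Lemma lebesgue_rV_gt0 : (0 < mu [set: rn])%E.
Proof.
rewrite lt_neqAle measure_ge0 andbT eq_sym; apply/eqP => m0.
have := @Rint_heat R n; rewrite /Rintegral.
have ih : mu.-integrable setT (EFin \o @heat R n) by exact: schwartz_intg (@schwartz_heat R n).
rewrite null_set_integral//; last by apply/measurable_EFinP; exact: intg_measurable (schwartz_intg (@schwartz_heat R n)).
by move=> /eqP; rewrite eq_sym oner_eq0.
Qed.

(* For p = +oo the bound holds everywhere, not only almost everywhere. *)
Definition Lbound (p : \bar R) (P : R) w : Prop :=
  measurable_fun setT w /\
  match p with
  | r%:E => intg mu (fun x => `|w x| `^ r) /\ \int[mu]_x (`|w x| `^ r) = P `^ r
  | +oo%E => forall x, `|w x| <= P
  | -oo%E => False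
  end.

Lemma Lbound_tame p P w : (1 <= p)%E -> 0 <= P -> Lbound p P w -> tame w.
Proof.
case: p => [r| |]// p1 P0 [mw]; first by move=> [iw _]; exact: tame_powR mw p1 iw.
move=> wP; split=> //; exists P, (fun _ => 0); split => // [|x]; first exact: intg0.
by rewrite addr0.
Qed.

(** For [p = +oo] the representative is [w] set to 0 where it exceeds its norm. It agrees with [w]
    almost everywhere, so it defines the same distribution, and it satisfies the bound at every
    point. *)
Lemma Lfun_Lbound (p : \bar R) w : (1 <= p)%E -> w \in Lfun mu p ->
  exists (P : R) w', [/\ 0 <= P, ('N[mu]_p[EFin \o w] = P%:E)%E, Lbound p P w' &
    forall psi, measurable_fun setT psi -> dist_of w psi = dist_of w' psi].
Proof.
move=> p1 wL; have mw : measurable_fun setT w by have := sub_Lfun_mfun wL; rewrite inE.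
have Lw : ('N[mu]_p[EFin \o w] < +oo)%E by have := sub_Lfun_finLfun wL; rewrite inE.
have N0 : (0 <= 'N[mu]_p[EFin \o w])%E by exact: Lnorm_ge0.
have NE : ('N[mu]_p[EFin \o w] = (fine ('N[mu]_p[EFin \o w]))%:E)%E.
  by rewrite fineK// ge0_fin_numE.
have P0 : 0 <= fine ('N[mu]_p[EFin \o w]) by rewrite fine_ge0.
move: (fine _) NE P0 => P NE P0; exists P.
case: p => [r| |]// in p1 wL Lw N0 NE *.
- exists w; split => //; split => //.
  have r0 : r != 0 by rewrite gt_eqF// (lt_le_trans ltr01).
  have E : (\int[mu]_x (`|w x| `^ r)%:E = (P `^ r)%:E)%E.
    by rewrite -poweR_EFin -NE poweR_Lnorm//; apply: eq_integral => x _; rewrite -poweR_EFin.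
  have mp : measurable_fun setT (fun x : rn => `|w x| `^ r).
    by apply: (measurableT_comp (measurable_powR r)); exact: measurableT_comp.
  have i : intg mu (fun x => `|w x| `^ r).
    apply: (intg_ltyP mu mp).2; rewrite (_ : integral _ _ _ = (P `^ r)%:E) ?ltry//.
    by rewrite -E; apply: eq_integral => x _; rewrite ger0_norm// powR_ge0.
  by split => //; rewrite /Rintegral E.
- pose w' x := if `|w x| <= P then w x else 0.
  exists w'; split => //.
    have ms : measurable_fun setT (fun x => `|w x| <= P).
      by apply: measurable_fun_ler => //; exact: measurableT_comp.
    split; first by apply: measurable_fun_ifT => //; exact: measurable_cst.
    by move=> x; rewrite /w'; case: ifP => // _; rewrite normr0.
  have ae : \forall x \ae mu, w x = w' x.
    have : (ess_sup_inf.ess_sup mu (abse \o (EFin \o w)) <= P%:E)%E.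
      by rewrite -NE unlock /Lnorm lebesgue_rV_gt0.
    move=> /ess_sup_inf.ess_supP; apply: filterS => x /=; rewrite lee_fin /w' => ->.
    by [].
  move=> psi mpsi; rewrite /dist_of /Rintegral; congr fine; apply: ae_eq_integral => //.
  + by apply/measurable_EFinP; exact: measurable_funM.
  + apply/measurable_EFinP; apply: measurable_funM => //.
    apply: measurable_fun_ifT => //.
    by apply: measurable_fun_ler => //; exact: measurableT_comp.
  + by apply: filterS ae => x wx _ /=; rewrite wx.
Qed.

Lemma Lnorm_le_bound (q : R) f (B : R) : 0 < q -> intg mu (fun x => `|f x| `^ q) ->
  \int[mu]_x (`|f x| `^ q) <= B -> ('N[mu]_(q%:E)[EFin \o f] <= (B `^ q^-1)%:E)%E.
Proof.
move=> q0 iq B1; have I0 : 0 <= \int[mu]_x (`|f x| `^ q) by apply: Rintegral_ge0 => x _; exact: powR_ge0.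
rewrite unlock /Lnorm.
have -> : (\int[mu]_x (`|(EFin \o f) x| `^ q) = (\int[mu]_x (`|f x| `^ q))%R%:E)%E.
  by rewrite (EFin_Rint iq); apply: eq_integral => x _; rewrite -poweR_EFin.
rewrite poweR_EFin lee_fin; apply: ge0_ler_powR; rewrite ?invr_ge0 ?nnegrE ?(ltW q0)//.
exact: le_trans B1.
Qed.

Lemma Lnormy_le_bound f (B : R) : 0 <= B -> (forall x, `|f x| <= B) -> ('N[mu]_(+oo)[EFin \o f] <= B%:E)%E.
Proof.
move=> B0 fB; rewrite unlock /Lnorm; case: ifP => _; last by rewrite lee_fin.
by apply/ess_sup_inf.ess_supP; apply: nearW => x /=; rewrite lee_fin.
Qed.

(** [m^(1 - d) H^d] interpolates the [L^r] norm of [h], with [1 / r = 1 - d] as in Young's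
    inequality, between its L^1 bound and its supremum bound. The factor 2 stems from the substitute
    for Hoelder's inequality. *)
Lemma young (p q : \bar R) (P : R) h w (H m : R) : (1 <= p)%E -> (p <= q)%E -> 0 <= P ->
  intg mu h -> (forall x, `|h x| <= H) -> 0 < m -> 0 < H -> \int[mu]_x `|h x| <= m -> Lbound p P w ->
  let d := fine (p^-1)%E - fine (q^-1)%E in
  ('N[mu]_q[EFin \o conv h w] <= (2 * (m `^ (1 - d) * H `^ d) * P)%:E)%E.
Proof.
move=> p1 pq P0 ih hH m0 H0 hm Lw /=.
case: p => [r| |]// in p1 pq Lw *; case: q => [t| |]// in pq *.
- have r1 : 1 <= r by rewrite -lee_fin.
  have rt : r <= t by rewrite -lee_fin.
  have r0 : 0 < r by exact: lt_le_trans r1.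
  have t0 : 0 < t by exact: lt_le_trans rt.
  move: Lw => [mw [iw Nw]].
  have [ic Ic] := conv_Lq ih hH m0 hm mw r1 iw rt.
  apply: (le_trans (Lnorm_le_bound t0 ic Ic)); rewrite lee_fin Nw.
  rewrite !inver !gt_eqF//=.
  have k2 : 0 <= 2 * m `^ (1 - r^-1) by rewrite mulr_ge0// powR_ge0.
  have Pr : 0 <= P `^ r by exact: powR_ge0.
  have HP : 0 <= H * P `^ r by rewrite mulr_ge0// ltW.
  have mP : 0 <= m * P `^ r by rewrite mulr_ge0// ltW.
  rewrite (powRM _ (mulr_ge0 (powR_ge0 _ _) (powR_ge0 _ _)) mP) (powRM _ (powR_ge0 _ _) (powR_ge0 _ _)).
  rewrite -!powRrM mulfV ?gt_eqF// powRr1//.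
  rewrite (powRM _ (ltW H0) Pr) (powRM _ (ltW m0) Pr) -!powRrM.
  set a := (t / r - 1) / t; have -> : r^-1 - t^-1 = a by rewrite /a; field; rewrite !gt_eqF.
  have PP : P `^ (r * a) * P `^ (r / t) = P.
    rewrite -powRD; first by rewrite (_ : _ + _ = 1) ?powRr1// /a; field; rewrite !gt_eqF.
    by rewrite (_ : _ + _ = 1) ?oner_eq0// /a; field; rewrite !gt_eqF.
  have MM : m `^ (1 - r^-1) * m `^ t^-1 = m `^ (1 - a).
    rewrite -powRD; last by rewrite (gt_eqF m0) implybT.
    by congr (m `^ _); rewrite /a; field; rewrite !gt_eqF.
  rewrite -MM -[in X in _ <= X]PP le_eqVlt; apply/orP; left; apply/eqP; ring.
- have r1 : 1 <= r by rewrite -lee_fin.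
  have r0 : 0 < r by exact: lt_le_trans r1.
  move: Lw => [mw [iw Nw]].
  have Pr : 0 <= P `^ r by exact: powR_ge0.
  have B0 : 0 <= 2 * (m `^ (1 - r^-1) * (H * P `^ r) `^ r^-1) by rewrite !mulr_ge0 ?powR_ge0.
  have := conv_sup ih hH m0 hm mw r1 iw; rewrite Nw => C.
  apply: (le_trans (Lnormy_le_bound B0 C)); rewrite lee_fin invey inver gt_eqF//= subr0.
  rewrite (powRM _ (ltW H0) Pr) -powRrM mulfV ?gt_eqF// powRr1//.
  by rewrite !mulrA.
- move: Lw => [mw wP].
  have B0 : 0 <= m * P by rewrite mulr_ge0// ltW.
  apply: (@le_trans _ _ (m * P)%:E); last first.
    rewrite lee_fin invey /= subrr subr0 powRr1 ?(ltW m0)// powRr0 mulr1 -mulrA ler_peMl//.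
    by rewrite ler1n.
  apply: Lnormy_le_bound => // z.
  have tw := Lbound_tame (leey 1%E) P0 (conj mw wP : Lbound +oo%E P w).
  have ihs : intg mu (fun x => h (z - x)) by exact: intg_reflect.
  apply: (@le_trans _ _ (P * \int[mu]_x `|h (z - x)|)); last first.
    by rewrite mulrC ler_wpM2r// (Rint_reflect z (intg_norm ih)).
  apply: Rint_norm_le_bound; [exact: intg_conv ih hH _ _ tw|exact: intg_norm|].
  by move=> x; rewrite normrM mulrC ler_wpM2r.
Qed.

End lebesgue_norms.

(** * Dilated kernels and the decay rate *)

Section rescaled_kernels.
Context {R : realType} (n : nat).
Local Notation rn := 'rV[R]_n.
Local Notation mu := (@lebesgue_rV R n).
Implicit Types (phi K w : rn -> R).

Definition reflected K : rn -> R := fun u => K (- 1 *: u).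

(** Convolution with [kap S K] is the transpose of [cv S K], hence the reflection. *)
Definition kap (S : R) K : rn -> R := fun u => S ^- n * reflected K (S^-1 *: u).

Lemma schwartz_reflected K : schwartz K -> schwartz (reflected K).
Proof.
move=> sK; have n1 : - 1 != 0 :> R by rewrite oppr_eq0 oner_eq0.
by apply: schwartz_ext (schwartz_affine 0 n1 sK) => y; rewrite addr0.
Qed.

Lemma schwartz_kap (S : R) K : 0 < S -> schwartz K -> schwartz (kap S K).
Proof.
move=> S0 sK; have S1 : S^-1 != 0 by rewrite invr_neq0// gt_eqF.
apply: schwartzZ; apply: schwartz_ext (schwartz_affine 0 S1 (schwartz_reflected sK)) => y.
by rewrite addr0.
Qed.

Lemma cv_kap (S : R) K phi x : 0 < S -> schwartz K -> schwartz phi ->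
  cv S K phi x = \int[mu]_z (phi z * kap S K (z - x)).
Proof.
move=> S0 sK sphi; have nS : - S != 0 by rewrite oppr_eq0 gt_eqF.
have [M HM] := schwartz_bounded (schwartz_kap S0 sK).
have iF : intg mu (fun z => phi z * kap S K (z - x)).
  apply: (@intg_mul_bounded _ _ _ mu _ (fun z => kap S K (z - x)) M) => //.
    exact: schwartz_intg.
  by apply: intg_measurable (intg_shift (- x) (schwartz_intg (schwartz_kap S0 sK))).
rewrite (Rint_affine x nS iF) -(RintZl _ (intg_affine x nS iF)).
apply: eq_Rint => y; rewrite normrN (ger0_norm (ltW S0)) addrK /kap /reflected.
have -> : -1 *: (S^-1 *: (- S *: y)) = y.
  by rewrite !scalerA mulN1r mulrNN mulVf ?gt_eqF// scale1r.
rewrite [- S *: y + x]addrC scaleNr.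
by field; rewrite gt_eqF ?exprn_gt0.
Qed.

Lemma absDZ (s c : R) phi : 0 <= s -> schwartz phi ->
  absD s (fun x => c * phi x) = (fun x => c * absD s phi x).
Proof.
move=> s0 sphi; apply/funext => x; rewrite !absDE//; last exact: schwartzZ.
rewrite mulrCA -(RintZl c (intg_absD x s0 sphi)); apply: (congr1 (GRing.mul _)).
apply: eq_Rint => xi; rewrite FcZ; last exact: schwartz_intg.
by rewrite mulrCA.
Qed.

Lemma absD_kap (s S : R) K u : 0 <= s -> 0 < S -> schwartz K ->
  absD s (kap S K) u = S ^- n * (S^-1) `^ s * absD s (reflected K) (S^-1 *: u).
Proof.
move=> s0 S0 sK; have S1 : 0 < S^-1 by rewrite invr_gt0.
have sr := schwartz_reflected sK.
have sr' : schwartz (fun u => reflected K (S^-1 *: u)).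
  by apply: schwartz_ext (schwartz_affine 0 (lt0r_neq0 S1) sr) => y; rewrite addr0.
by rewrite (absDZ _ s0 sr') (absD_scale u s0 S1 sr) mulrA.
Qed.

Lemma absD_kap_sup (s S M : R) K u : 0 <= s -> 0 < S -> schwartz K ->
  (forall x, `|absD s (reflected K) x| <= M) ->
  `|absD s (kap S K) u| <= M * (S^-1) `^ s * S ^- n.
Proof.
move=> s0 S0 sK HM; rewrite absD_kap// !normrM.
have p1 : 0 <= S ^- n by rewrite invr_ge0 exprn_ge0// ltW.
rewrite (ger0_norm p1) (ger0_norm (powR_ge0 _ _)).
rewrite [X in _ <= X](_ : _ = S ^- n * (S^-1) `^ s * M); last by ring.
by rewrite ler_wpM2l// mulr_ge0// powR_ge0.
Qed.

Lemma absD_kap_L1 (s S M : R) K : 0 <= s -> 0 < S -> schwartz K ->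
  \int[mu]_x `|absD s (reflected K) x| <= M ->
  \int[mu]_x `|absD s (kap S K) x| <= M * (S^-1) `^ s.
Proof.
move=> s0 S0 sK HM; have S1 : 0 < S^-1 by rewrite invr_gt0.
have i := intg_norm (absD_intg s0 (schwartz_reflected sK)).
have ia := intg_affine 0 (lt0r_neq0 S1) i.
have p1 : 0 <= S ^- n by rewrite invr_ge0 exprn_ge0// ltW.
have E x : `|absD s (kap S K) x| = (S^-1) `^ s * (S ^- n * `|absD s (reflected K) (S^-1 *: x + 0)|).
  by rewrite absD_kap// !normrM (ger0_norm p1) (ger0_norm (powR_ge0 _ _)) addr0; ring.
have F := Rint_affine 0 (lt0r_neq0 S1) i.
rewrite (eq_Rint mu E) (RintZl _ (intgZl _ ia)) (RintZl _ ia).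
have <- : `|S^-1| ^+ n = S ^- n by rewrite (ger0_norm (ltW S1)) exprVn.
by rewrite -F mulrC ler_wpM2r// powR_ge0.
Qed.

(** One constant serves for both bounds, so that its powers [1 - d] and [d] in Young's inequality
    combine to [M] itself. *)
Definition kernel_bound (s M : R) K : Prop :=
  [/\ 0 < M, \int[mu]_x `|absD s (reflected K) x| <= M & forall x, `|absD s (reflected K) x| <= M].

Lemma kernel_bound_exists (s : R) K : 0 <= s -> schwartz K -> exists M, kernel_bound s M K.
Proof.
move=> s0 sK; have [M HM] := absD_bounded s0 (schwartz_reflected sK).
have M0 : 0 <= M := le_trans (normr_ge0 _) (HM 0).
have J0 : 0 <= \int[mu]_x `|absD s (reflected K) x| by apply: Rintegral_ge0 => x _.
exists (1 + M + \int[mu]_x `|absD s (reflected K) x|); split.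
- by rewrite -addrA ltr_pwDl// addr_ge0.
- by rewrite lerDr addr_ge0.
- by move=> x; apply: (le_trans (HM x)); rewrite -addrA addrCA lerDl addr_ge0.
Qed.

Lemma kernel_bound_le (s M M' : R) K : M <= M' -> kernel_bound s M K -> kernel_bound s M' K.
Proof.
move=> MM [h1 h2 h3]; split; [exact: lt_le_trans MM|exact: le_trans MM|].
by move=> x; exact: le_trans (h3 x) MM.
Qed.

Section one_term.
Variables (s S M P : R) (p q : \bar R) (K w : rn -> R).
Hypotheses (s0 : 0 <= s) (S0 : 0 < S) (sK : schwartz K) (p1 : (1 <= p)%E) (pq : (p <= q)%E)
  (P0 : 0 <= P) (wP : Lbound p P w) (KM : kernel_bound s M K).

Let f := conv (kap S K) w.
Let g := conv (absD s (kap S K)) w.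
Let sk : schwartz (kap S K). Proof. exact: schwartz_kap. Qed.
Let ik : intg mu (absD s (kap S K)). Proof. exact: absD_intg. Qed.
Let tw : tame w. Proof. exact: Lbound_tame wP. Qed.

Let bk : exists N, forall x, `|kap S K x| <= N. Proof. exact: schwartz_bounded. Qed.
Let bg : exists N, forall x, `|absD s (kap S K) x| <= N. Proof. exact: absD_bounded. Qed.

Lemma term_dist phi : schwartz phi -> intg mu (fun x => f x * phi x) /\
  dist_of w (cv S K phi) = \int[mu]_x (f x * phi x).
Proof.
move=> sphi; have [N HN] := bk.
have [i E] := conv_fubini (schwartz_intg sk) HN tw (schwartz_intg sphi).
have C x : phi x * conv (kap S K) w x = f x * phi x by rewrite mulrC.
split; first exact: intg_eq C i.
rewrite -(eq_Rint mu C) E; apply: eq_Rint => x.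
by rewrite cv_kap.
Qed.

(** Fubini rewrites both pairings as integrals against [w], where [absD_symmetric] identifies the
    two kernels. *)
Lemma term_absD phi : schwartz phi ->
  [/\ intg mu (fun x => f x * absD s phi x), intg mu (fun x => g x * phi x) &
      \int[mu]_x (g x * phi x) = \int[mu]_x (f x * absD s phi x)].
Proof.
move=> sphi; have [N HN] := bk; have [N' HN'] := bg.
have [i E] := conv_fubini (schwartz_intg sk) HN tw (absD_intg s0 sphi).
have [i' E'] := conv_fubini ik HN' tw (schwartz_intg sphi).
have C x : absD s phi x * conv (kap S K) w x = f x * absD s phi x by rewrite mulrC.
have C' x : phi x * conv (absD s (kap S K)) w x = g x * phi x by rewrite mulrC.
split; [exact: intg_eq C i|by apply: intg_eq i'; exact: C'|].
rewrite -(eq_Rint mu C) -(eq_Rint mu C') E E'; apply: eq_Rint => x; apply: (congr1 (GRing.mul _)).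
apply: (etrans (esym (absD_symmetric x s0 sphi sk))).
by apply: eq_Rint => z; rewrite mulrC.
Qed.

Lemma measurable_term : measurable_fun setT g.
Proof. by have [N HN] := bg; exact: measurable_conv ik HN _ tw. Qed.

(** Here [m = M S^(-s)] and [H = M S^(-s - n)], so with [d = 1/p - 1/q] one has
    [m^(1 - d) H^d = M S^(-s - n d)], which is [M] times [S^2] to the power
    [- (s / 2 + n d / 2)]. *)
Lemma term_norm : ('N[mu]_q[EFin \o g] <= (2 * M * (S ^+ 2) `^ (- mu1 n p q s) * P)%:E)%E.
Proof.
have [M0 L1 sup] := KM; have S1 : 0 < S^-1 by rewrite invr_gt0.
have e0 : 0 < (S^-1) `^ s by rewrite powR_gt0.
have en : 0 < S ^- n by rewrite invr_gt0 exprn_gt0.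
have m0 : 0 < M * (S^-1) `^ s by rewrite mulr_gt0.
have H0 : 0 < M * (S^-1) `^ s * S ^- n by rewrite mulr_gt0.
have := young p1 pq P0 ik (fun u => absD_kap_sup u s0 S0 sK sup) m0 H0 (absD_kap_L1 s0 S0 sK L1) wP.
rewrite /= => Y; apply: (le_trans Y); rewrite lee_fin; apply: ler_wpM2r => //.
rewrite -[X in _ <= X]mulrA ler_wpM2l// /mu1; set d := (_ - _)%R.
rewrite (powRM _ (ltW m0) (ltW en)) mulrA -powRD; last by rewrite (gt_eqF m0) implybT.
rewrite subrK powRr1 ?(ltW m0)// -mulrA ler_wpM2l ?(ltW M0)//.
rewrite /powR !gt_eqF// ?exprn_gt0// -expRD ler_expR.
rewrite -[in X in ln (X ^+ 2)](lnK S0) -expRM_natl expRK lnV ?posrE//.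
rewrite lnV ?posrE ?exprn_gt0// -[in X in ln (X ^+ n)](lnK S0) -expRM_natl expRK.
by rewrite le_eqVlt; apply/orP; left; apply/eqP; field.
Qed.

End one_term.

Lemma component_estimate (s T M : R) (p q : \bar R) (K0 K1 K2 w0 w1 w2 : rn -> R) (P0 P1 P2 : R)
    (W : (rn -> R) -> R) : 0 <= s -> 0 < T -> (1 <= p)%E -> (p <= q)%E ->
  schwartz K0 -> schwartz K1 -> schwartz K2 ->
  kernel_bound s M K0 -> kernel_bound s M K1 -> kernel_bound s M K2 ->
  0 <= P0 -> 0 <= P1 -> 0 <= P2 -> Lbound p P0 w0 -> Lbound p P1 w1 -> Lbound p P2 w2 ->
  (forall phi, schwartz phi -> W phi = dist_of w0 (cv (Num.sqrt T) K0 phi) +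
      dist_of w1 (cv (Num.sqrt T) K1 phi) + dist_of w2 (cv (Num.sqrt T) K2 phi)) ->
  (Hdot_norm s q W <= (2 * M * T `^ (- mu1 n p q s) * (P0 + P1 + P2))%:E)%E.
Proof.
move=> s0 T0 p1 pq sK0 sK1 sK2 M0 M1 M2 P00 P10 P20 L0 L1 L2 HW.
set S := Num.sqrt T in HW; have S0 : 0 < S by rewrite sqrtr_gt0.
have ST : S ^+ 2 = T by rewrite sqr_sqrtr// ltW.
pose f K w := conv (kap S K) w; pose g K w := conv (absD s (kap S K)) w.
have mg0 := @measurable_term s S P0 p K0 w0 s0 S0 sK0 p1 P00 L0.
have mg1 := @measurable_term s S P1 p K1 w1 s0 S0 sK1 p1 P10 L1.
have mg2 := @measurable_term s S P2 p K2 w2 s0 S0 sK2 p1 P20 L2.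
pose G := (g K0 w0 \+ (g K1 w1 \+ g K2 w2))%R.
(* [Hdot_norm] is an infimum, so the norm of the explicit function [G] bounds it once [G] is shown
   to be [|D|^s] of a function that represents [W]. *)
apply: (@le_trans _ _ ('N[mu]_q[EFin \o G])%E).
  apply: ereal_inf_lbound; exists G => //; split; first by do 2 apply: measurable_funD => //.
  exists (fun x => f K0 w0 x + (f K1 w1 x + f K2 w2 x)).
    move=> phi sphi; rewrite HW//.
    have [i0 E0] := @term_dist S P0 p K0 w0 S0 sK0 p1 P00 L0 phi sphi.
    have [i1 E1] := @term_dist S P1 p K1 w1 S0 sK1 p1 P10 L1 phi sphi.
    have [i2 E2] := @term_dist S P2 p K2 w2 S0 sK2 p1 P20 L2 phi sphi.
    have D x : f K0 w0 x * phi x + (f K1 w1 x * phi x + f K2 w2 x * phi x) =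
      (f K0 w0 x + (f K1 w1 x + f K2 w2 x)) * phi x by ring.
    split; first by apply: (intg_eq D); apply: intgD => //; exact: intgD.
    rewrite E0 E1 E2 -addrA; apply: (etrans _ (eq_Rint mu D)).
    by rewrite (RintegralD measurableT i0 (intgD i1 i2)) (RintegralD measurableT i1 i2).
  move=> phi sphi.
  have [i0 j0 E0] := @term_absD s S P0 p K0 w0 s0 S0 sK0 p1 P00 L0 phi sphi.
  have [i1 j1 E1] := @term_absD s S P1 p K1 w1 s0 S0 sK1 p1 P10 L1 phi sphi.
  have [i2 j2 E2] := @term_absD s S P2 p K2 w2 s0 S0 sK2 p1 P20 L2 phi sphi.
  have D x : f K0 w0 x * absD s phi x + (f K1 w1 x * absD s phi x + f K2 w2 x * absD s phi x) =
    (f K0 w0 x + (f K1 w1 x + f K2 w2 x)) * absD s phi x by ring.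
  have D' x : g K0 w0 x * phi x + (g K1 w1 x * phi x + g K2 w2 x * phi x) = G x * phi x.
    by rewrite /G /=; ring.
  split.
  - by apply: (intg_eq D); apply: intgD => //; exact: intgD.
  - by apply: (intg_eq D'); apply: intgD => //; exact: intgD.
  rewrite -(eq_Rint mu D) -(eq_Rint mu D').
  rewrite (RintegralD measurableT i0 (intgD i1 i2)) (RintegralD measurableT i1 i2).
  rewrite (RintegralD measurableT j0 (intgD j1 j2)) (RintegralD measurableT j1 j2).
  by rewrite E0 E1 E2.
have q1 : (1 <= q)%E by exact: le_trans pq.
have N0 := @term_norm s S M P0 p q K0 w0 s0 S0 sK0 p1 pq P00 L0 M0.
have N1 := @term_norm s S M P1 p q K1 w1 s0 S0 sK1 p1 pq P10 L1 M1.
have N2 := @term_norm s S M P2 p q K2 w2 s0 S0 sK2 p1 pq P20 L2 M2.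
have m12 : measurable_fun setT (g K1 w1 \+ g K2 w2)%R by exact: measurable_funD.
apply: (le_trans (eminkowski mu mg0 m12 q1)).
apply: (le_trans (leeD (lexx _) (eminkowski mu mg1 mg2 q1))).
apply: (le_trans (leeD N0 (leeD N1 N2))).
by rewrite -!EFinD lee_fin ST -!mulrDr addrA.
Qed.

End rescaled_kernels.

Lemma le_double_sum {R : numDomainType} (m : nat) (b : nat -> nat -> R) (i j : nat) :
  (forall i j, 0 <= b i j) -> (i < m)%N -> (j < m)%N ->
  b i j <= \sum_(k < m) \sum_(l < m) b k l.
Proof.
move=> b0 im jm; rewrite (bigD1 (Ordinal im))//= (bigD1 (Ordinal jm))//= -addrA lerDl.
apply: addr_ge0; apply: sumr_ge0 => k _; first exact: b0.
by apply: sumr_ge0 => l _; exact: b0.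
Qed.

Theorem theorem4p5 (R : realType) (n : nat) (s : R) (p q : \bar R)
  (n_ge1 : (1 <= n)%N) (s_ge0 : 0 <= s) (p_ge1 : (1 <= p)%E) (p_le_q : (p <= q)%E) :
  exists2 C : R, 0 < C &
    forall (u0 : ('rV[R]_n -> R) -> R) (v0 u1 theta0 : 'rV[R]_n -> R),
      tempered u0 -> is_dist_of v0 (absD2 u0) ->
      v0 \in Lfun (lebesgue_rV n) p ->
      u1 \in Lfun (lebesgue_rV n) p ->
      theta0 \in Lfun (lebesgue_rV n) p ->
    forall u theta : R -> ('rV[R]_n -> R) -> R,
      plate_solution u0 (dist_of u1) (dist_of theta0) u theta ->
    forall t : R, 0 < t ->
      (Hdot_norm s q (absD2 (u t)) + Hdot_norm s q (dt u t)
         + Hdot_norm s q (theta t)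
       <= (C * t `^ (- mu1 n p q s))%:E
          * ('N[lebesgue_rV n]_p[EFin \o v0] + 'N[lebesgue_rV n]_p[EFin \o u1]
             + 'N[lebesgue_rV n]_p[EFin \o theta0]))%E.
Proof.
have [K [sK rep]] := @system_representation R n.
have kb i j := kernel_bound_exists s_ge0 (sK i j).
pose B (i j : nat) := projT1 (cid (kb i j)).
have HB i j : kernel_bound s (B i j) (K i j) by rewrite /B; case: cid.
have B0 i j : 0 < B i j by have [] := HB i j.
pose M := \sum_(i < 3) \sum_(j < 3) B i j.
have HM i j : (i < 3)%N -> (j < 3)%N -> kernel_bound s M (K i j).
  move=> i3 j3; apply: kernel_bound_le (HB i j).
  exact: (le_double_sum (fun i j => ltW (B0 i j))).
have M0 : 0 < M by have [] := HM 0 0 isT isT.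
(* A factor [2 * M] for each of the three components of the solution. *)
exists (6 * M); first by rewrite mulr_gt0.
move=> u0 v0 u1 th0 tu0 dv0 Lv0 Lu1 Lth0 u th sol t t0.
have [P0 [w0 [P00 -> L0 D0]]] := Lfun_Lbound p_ge1 Lv0.
have [P1 [w1 [P10 -> L1 D1]]] := Lfun_Lbound p_ge1 Lu1.
have [P2 [w2 [P20 -> L2 D2]]] := Lfun_Lbound p_ge1 Lth0.
have r0 : 0 < Num.sqrt t by rewrite sqrtr_gt0.
have est i (W : ('rV[R]_n -> R) -> R) : (i < 3)%N ->
    (forall phi, schwartz phi -> W phi =
      (if i == 0%N then u t (nlap phi) else if i == 1%N then dt u t phi else th t phi)) ->
    (Hdot_norm s q W <= (2 * M * t `^ (- mu1 n p q s) * (P0 + P1 + P2))%:E)%E.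
  move=> i3 WE; apply: (@component_estimate R n s t M p q (K i 0%N) (K i 1%N) (K i 2%N) w0 w1 w2) => //;
    try exact: HM.
  move=> phi sphi; rewrite WE//.
  have sc j : schwartz (cv (Num.sqrt t) (K i j) phi) by apply: schwartz_cv => //; exact: kern_schwartz.
  have mc j := schwartz_measurable (sc j).
  have := rep _ _ (plate_is_system sol) t phi i t0 sphi i3 => /= ->.
  (* The first component starts from [u0] composed with [nlap], which is [|D|^2 u0] on Schwartz
     functions and is represented by [v0]. *)
  have [_ E0] := dv0 _ (sc 0%N).
  rewrite -(D0 _ (mc 0%N)) -(D1 _ (mc 1%N)) -(D2 _ (mc 2%N)) -E0 /absD2 absD_2//.
have e0 := est 0%N (absD2 (u t)) isT (fun phi sphi => congr1 (u t) (absD_2 sphi)).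
have e1 := est 1%N (dt u t) isT (fun _ _ => erefl).
have e2 := est 2%N (th t) isT (fun _ _ => erefl).
apply: (le_trans (leeD (leeD e0 e1) e2)).
rewrite -!EFinD -EFinM lee_fin le_eqVlt; apply/orP; left; apply/eqP.
by move: (t `^ _) => x; ring.
Qed.
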